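(* Let $0<1/n\ll\varepsilon\ll\gamma\ll 1/r$ where $n,r\in\mathbb N$, $r\ge 3$ and $r$ divides $n$, and let $T\in\mathcal T_r\setminus\{C_3\}$. Suppose that $G$ is a digraph on $n$ vertices with $\delta^0(G)\ge (1-1/r-\varepsilon)n$, and that $G$ does not contain any $\gamma$-independent set of size at least $n/r$. Then $G$ contains a perfect $T$-packing.
   Context: Hierarchy notation: $0<a\ll b\ll c$ means the constants are chosen from right to left, each sufficiently small in terms of those to its right. A digraph has no loops and at most one edge in each direction between any two vertices; $\delta^0(G)$ is the minimum of the minimum out- and indegree. $\mathcal T_r$ is the set of tournaments on $r$ vertices; $C_3$ is the cyclic triangle. A perfect $T$-packing is a collection of vertex-disjoint (not necessarily induced) copies of $T$ covering all vertices. For $G$ on $n$ vertices, $S\subseteq V(G)$ is $\gamma$-independent if $G[S]$ has at most $\gamma n^2$ edges. *)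

(* Defs.v *)
From mathcomp Require Import all_boot.
From mathcomp Require Import all_order all_algebra.
From mathcomp Require Import reals.

Set Implicit Arguments.
Unset Strict Implicit.
Unset Printing Implicit Defensive.

Import Order.TTheory GRing.Theory Num.Theory.

(* An edge relation allows at most one edge in each direction between any two
   vertices; irreflexivity excludes loops. *)
Record digraph (V : finType) := Digraph {
  edge :> rel V;
  edge_irr : irreflexive edge
}.

Section Digraphs.

Variables (V : finType) (G : digraph V).

Definition outdegree (x : V) : nat := #|[set y | G x y]|.
Definition indegree (x : V) : nat := #|[set y | G y x]|.

(* Every degree is less than #|V|, so the default value #|V| of the iterated
   minimum matters only when V is empty. *)
Definition min_outdegree : nat := \big[minn/#|V|]_(x : V) outdegree x.
Definition min_indegree : nat := \big[minn/#|V|]_(x : V) indegree x.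
Definition min_semidegree : nat := minn min_outdegree min_indegree.

(* The number of edges of the induced subdigraph G[S]. *)
Definition num_edges_in (S : {set V}) : nat :=
  #|[set p : V * V | [&& p.1 \in S, p.2 \in S & G p.1 p.2]]|.

Definition independent_upto (R : realType) (gamma : R) (S : {set V}) : Prop :=
  ((num_edges_in S)%:R <= gamma * #|V|%:R ^+ 2)%R.

Definition tournament : Prop := forall x y : V, x != y -> G x y = ~~ G y x.

End Digraphs.

Definition digraph_iso (V W : finType) (G : digraph V) (H : digraph W) : Prop :=
  exists2 f : V -> W, bijective f & forall x y, H (f x) (f y) = G x y.

Definition C3_edge : rel 'I_3 := fun i j => j == i.+1 %% 3 :> nat.

Lemma C3_edge_irr : irreflexive C3_edge.
Proof. by case=> [[|[|[|]]]]. Qed.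

Definition C3 : digraph 'I_3 := Digraph C3_edge_irr.

Section Packings.

Variables (W V : finType) (T : digraph W) (G : digraph V).

(* A not necessarily induced copy of T in G is given by an injective
   edge-preserving map; its vertex set is the image of that map. *)
Definition is_copy (f : {ffun W -> V}) : Prop :=
  injective f /\ forall x y, T x y -> G (f x) (f y).

Definition copy_verts (f : {ffun W -> V}) : {set V} := [set f x | x : W].

Definition packing (P : {set {ffun W -> V}}) : Prop :=
  (forall f, f \in P -> is_copy f) /\
  (forall f g, f \in P -> g \in P -> f != g ->
    [disjoint copy_verts f & copy_verts g]).

Definition perfect_packing (P : {set {ffun W -> V}}) : Prop :=
  packing P /\ \bigcup_(f in P) copy_verts f = [set: V].

End Packings.

(* Main.v *)
Require Import Defs.
From mathcomp Require Import all_boot.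
From mathcomp Require Import all_order all_algebra.
From mathcomp Require Import reals.
From mathcomp Require Import sequences exp.
From mathcomp Require Import ring lra zify.

Set Implicit Arguments.
Unset Strict Implicit.
Unset Printing Implicit Defensive.

Import Order.TTheory GRing.Theory Num.Theory.

Local Open Scope ring_scope.

(* The proof combines absorption with an almost perfect packing.

   Given vertices x and y, embedding T minus a vertex greedily into their common
   neighbourhoods only loses n/r vertices per step, and can fail only in its last
   step, between two sets of size about n/r. Either some first choices leave
   linearly more room than this count guarantees, or the structure of the
   non-neighbourhoods yields a nearly independent set of size about n/r. Hence any
   two vertices have many common (r - 1)-sets completing either of them to a copy
   of T; this is where T must not be the cyclic triangle. Arrays built from such
   sets absorb any small leftover.

   For the almost perfect packing, fix a cost on the vertices. Embedding T
   greedily into the cheapest vertices available, with a correction from the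
   absence of large nearly independent sets, gives a distribution on copies of T
   whose expected cost is at most r times the average cost and in which no copy
   is too likely. By a Frank-Wolfe iteration there is then a nearly perfect
   fractional packing with small codegrees, and a greedy choice of disjoint copies
   keeping the weighted degrees of the uncovered vertices close to each other in
   quadratic mean turns it into a packing of almost all vertices. *)

(** * Embeddings of ordered tournaments *)

(** With [a = n / r], a greedy embedding of [m] vertices into a set of size about [(m - 1) a] runs
    out of room exactly at its last vertex. The number of embeddings does not depend on the order of
    placement, so it suffices to find one vertex of T whose candidate set exceeds the guaranteed
    size by a constant fraction of [a], and to place it last: every other vertex then has about [a]
    to spare. A transitive triangle in T supplies such a vertex. For the cyclic triangle, deleting a
    vertex leaves an edge that must go from the common outneighbours of x and y to their common
    inneighbours, two sets of guaranteed size only about [a], between which there need not be any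
    edge. All existence arguments are by averaging over counted families, with explicit potential
    functions in place of probability. The order of the constants matters: the leftover that can be
    absorbed depends on the size of the absorber, which in turn depends on the degree slack
    tolerated by the almost perfect packing. *)

Section Embeddings.

Variables (W V : finType) (T : rel W) (G : rel V).

Implicit Types (l : seq W) (B : W -> {set V}) (s : seq V).

(* The admissible images of [w'] once [w] has been mapped to [v]. *)
Definition nb (w w' : W) (v : V) : {set V} :=
  if T w w' then [set x | G v x] else [set x | G x v].

(* Embeddings of T[l] sending each w in l into [B w]: [okl] recognises them as
   sequences of images in the order of l, and [cnt] counts them. *)
Fixpoint okl (l : seq W) (B : W -> {set V}) (s : seq V) : bool :=
  match l, s with
  | [::], [::] => true
  | w :: l', v :: s' =>
      (v \in B w) && okl l' (fun u => B u :&: nb w u v) s'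
  | _, _ => false
  end.

Fixpoint cnt (l : seq W) (B : W -> {set V}) : nat :=
  if l is w :: l' then (\sum_(v in B w) cnt l' (fun u => B u :&: nb w u v))%N
  else 1%N.

(** The enumeration of W is left open, so that tuples found with different vertices deleted or
    placed first are all tiles. *)
Definition tile (s : seq V) : bool :=
  has (fun l => okl l (fun=> setT) s) (permutations (enum W)).

Lemma okl_size l B s : okl l B s -> size s = size l.
Proof.
by elim: l B s => [|w l IH] B [|v s] //= /andP[_ /IH ->].
Qed.

Lemma sub_okl l B B' s : {in l, forall w, B w \subset B' w} ->
  okl l B s -> okl l B' s.
Proof.
elim: l B B' s => [|w l IH] B B' [|v s] //= sBB' /andP[vB].
rewrite (subsetP (sBB' _ (mem_head _ _)) _ vB) /=; apply: IH => u ul.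
by apply: setSI; apply: sBB'; rewrite in_cons ul orbT.
Qed.

Lemma okl_in l B s w0 v0 i : okl l B s -> (i < size l)%N ->
  nth v0 s i \in B (nth w0 l i).
Proof.
elim: l B s i => [|w l IH] B [|v s] [|i] //= /andP[vB ok] il //.
by have := IH _ _ i ok il; rewrite inE => /andP[].
Qed.

Lemma okl_nb l B s w0 v0 i j : okl l B s -> (i < j < size l)%N ->
  nth v0 s j \in nb (nth w0 l i) (nth w0 l j) (nth v0 s i).
Proof.
elim: l B s i j => [|w l IH] B [|v s] i [|j] //=; rewrite ?andbF //.
move=> /andP[vB ok]; case: i => [|i] ij /=; last exact: IH ok ij.
by have := okl_in w0 v0 ok ij; rewrite inE => /andP[].
Qed.

Lemma eq_cnt l B B' : {in l, B =1 B'} -> cnt l B = cnt l B'.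
Proof.
elim: l B B' => [|w l IH] B B' eqB //=.
rewrite eqB ?mem_head //; apply: eq_bigr => v _; apply: IH => u ul.
by rewrite eqB // in_cons ul orbT.
Qed.

Lemma card_tuple_cons n (P : pred (seq V)) :
  #|[set s : n.+1.-tuple V | P s]| =
  (\sum_v #|[set s : n.-tuple V | P (v :: s)]|)%N.
Proof.
transitivity (\sum_(s : n.+1.-tuple V | P s) 1)%N.
  by rewrite sum1dep_card.
rewrite (reindex (fun p : V * n.-tuple V => [tuple of p.1 :: p.2])) /=; last first.
  exists (fun s : n.+1.-tuple V => (thead s, [tuple of behead s])) => [[v s] _|s _] /=.
    by congr (_, _); apply: val_inj.
  by rewrite [RHS]tuple_eta; apply: val_inj.
transitivity (\sum_v \sum_(s : n.-tuple V | P (v :: s)) 1)%N.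
  by rewrite pair_big_dep.
by apply: eq_bigr => v _; rewrite sum1dep_card.
Qed.

Lemma cnt_card l B n : size l = n ->
  cnt l B = #|[set s : n.-tuple V | okl l B s]|.
Proof.
elim: l B n => [|w l IH] B n <-.
  rewrite -[LHS](_ : #|[set: 0.-tuple V]| = 1%N); last by rewrite cardsT card_tuple.
  by apply: eq_card => s; rewrite !inE tuple0.
rewrite (@card_tuple_cons (size l) (okl (w :: l) B)) /= big_mkcond; apply: eq_bigr => v _.
case: ifP => vB /=; last by apply/esym/eqP; rewrite cards_eq0; apply/eqP/setP => s; rewrite !inE.
exact: IH.
Qed.

Hypothesis tourT : forall w w', w != w' -> T w w' = ~~ T w' w.

Lemma nb_sym w w' v v' : w != w' -> (v' \in nb w w' v) = (v \in nb w' w v').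
Proof.
by move=> ww'; rewrite /nb (tourT ww'); case: (T w' w); rewrite !inE.
Qed.

(** In a tournament the constraint between the images of [w] and [w'] can be read from either side,
    by [nb_sym]; the remaining constraints commute. *)
Lemma cnt_swap w w' l B : w != w' -> cnt (w :: w' :: l) B = cnt (w' :: w :: l) B.
Proof.
move=> ww' /=.
rewrite (exchange_big_dep (mem (B w'))) /=; last by move=> v v' _; rewrite inE => /andP[].
apply: eq_bigr => v' v'B; apply: eq_big => [v|v _].
  by rewrite !inE v'B (nb_sym _ _ ww').
by apply: eq_cnt => u _; rewrite setIAC.
Qed.

Lemma cnt_rcons p l B : p \notin l -> cnt (p :: l) B = cnt (rcons l p) B.
Proof.
elim: l B => [|w l IH] B // pl.
move: pl; rewrite in_cons negb_or => /andP[pw pl].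
rewrite cnt_swap // rcons_cons; apply: eq_bigr => v _; exact: IH.
Qed.

Hypothesis irrT : irreflexive T.
Hypothesis irrG : irreflexive G.

Lemma tile_size s : tile s -> size s = #|W|.
Proof.
case/hasP=> l; rewrite mem_permutations => pl /okl_size ->.
by rewrite (perm_size pl) cardE.
Qed.

Lemma tileW l s : perm_eq l (enum W) -> okl l (fun=> setT) s -> tile s.
Proof. by move=> pl ok; apply/hasP; exists l => //; rewrite mem_permutations. Qed.

Lemma okl_edge l s v0 w w' : okl l (fun=> setT) s -> w \in l -> w' \in l ->
  T w w' -> G (nth v0 s (index w l)) (nth v0 s (index w' l)).
Proof.
move=> ok wl w'l Tww'.
have ww' : w != w' by apply: contraTneq Tww' => ->; rewrite irrT.
have ii : index w l != index w' l.
  by apply: contra ww' => /eqP e; rewrite -(nth_index w wl) -(nth_index w w'l) e.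
case: (ltngtP (index w l) (index w' l)) ii => // lt _.
  have := @okl_nb _ _ _ w v0 (index w l) (index w' l) ok.
  by rewrite lt index_mem w'l !nth_index // /nb Tww' inE; apply.
have := @okl_nb _ _ _ w v0 (index w' l) (index w l) ok.
rewrite lt index_mem wl !nth_index // /nb.
by rewrite tourT 1?eq_sym // Tww' inE; apply.
Qed.

Lemma tile_copy s : tile s ->
  exists2 f : {ffun W -> V}, injective f /\ (forall x y, T x y -> G (f x) (f y))
                     & perm_eq (codom f) s.
Proof.
move=> ts; have /hasP[l] := ts; rewrite mem_permutations => pl ok.
have wl w : w \in l by rewrite (perm_mem pl) mem_enum.
have szs := okl_size ok.
case: s => [|v0 s0] in ts ok szs *.
  case: l => // in pl wl ok szs *.
  have W0 : W -> False by move=> w; have := wl w.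
  exists [ffun w => match W0 w return V with end].
    by split=> w; case: (W0 w).
  have c0 : #|W| = 0%N by rewrite cardE -(perm_size pl).
  have : size (codom [ffun w : W => match W0 w return V with end]) = 0%N.
    by rewrite size_codom.
  by move/size0nil=> ->.
move: (v0 :: s0) ts ok szs => s ts ok szs.
pose f := [ffun w => nth v0 s (index w l)].
have fE x y : T x y -> G (f x) (f y).
  by move=> Txy; rewrite !ffunE; apply: okl_edge.
have injf : injective f.
  move=> x y fxy; apply/eqP; apply: contraT => xy.
  have [/fE|] := boolP (T x y); first by rewrite fxy irrG.
  by rewrite tourT // negbK => /fE; rewrite fxy irrG.
exists f => //.
have ul : uniq l by rewrite (perm_uniq pl) enum_uniq.
have -> : s = map f l.
  apply: (@eq_from_nth _ v0); first by rewrite size_map.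
  move=> i; rewrite szs => il.
  have [w0 _] : exists w0 : W, w0 \in l by case: (l) il => // w0 ? _; exists w0; rewrite mem_head.
  by rewrite (nth_map w0) // ffunE index_uniq.
by rewrite codomE perm_map // perm_sym.
Qed.

Lemma tile_uniq s : tile s -> uniq s.
Proof.
move=> /tile_copy[f [injf _] pf].
by rewrite -(perm_uniq pf) codomE map_inj_uniq ?enum_uniq.
Qed.

Lemma tile_subdigraph (s : seq V) l B :
  perm_eq l (enum W) -> okl l B s -> tile s.
Proof. by move=> pl ok; apply: (tileW pl); apply: sub_okl ok => w _; apply: subsetT. Qed.

End Embeddings.

(** * Greedy lower bounds for numbers of embeddings *)

Section Counting.

Variables (R : realType) (W V : finType) (T : rel W) (G : rel V).
Hypothesis tourT : forall w w', w != w' -> T w w' = ~~ T w' w.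
Implicit Types (A m : R) (B : W -> {set V}) (l : seq W).

Local Notation nb := (nb T G).
Local Notation cnt := (cnt T G).

(** Non-neighbours are taken in the whole vertex set; for a loopless G they include [v] itself. *)
Definition codeg_le A := forall v,
  #|[set x | ~~ G v x]|%:R <= A /\ #|[set x | ~~ G x v]|%:R <= A.

Lemma card_nbC A w w' v : codeg_le A -> #|~: nb w w' v|%:R <= A.
Proof.
move=> /(_ v)[d1 d2]; rewrite /nb; case: ifP => _.
  by apply: le_trans d1; rewrite ler_nat; apply/subset_leq_card/subsetP => x; rewrite !inE.
by apply: le_trans d2; rewrite ler_nat; apply/subset_leq_card/subsetP => x; rewrite !inE.
Qed.

Lemma card_nonnbr A (S : {set V}) v : codeg_le A ->
  #|S :\: [set x | G v x]|%:R <= A /\ #|S :\: [set x | G x v]|%:R <= A.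
Proof.
move=> dA; have [d1 d2] := dA v; split; [apply: le_trans d1|apply: le_trans d2];
  by rewrite ler_nat; apply/subset_leq_card/subsetP => x; rewrite !inE => /andP[].
Qed.

Lemma card_setIC (X Y : {set V}) : #|X|%:R - #|~: Y|%:R <= #|X :&: Y|%:R :> R.
Proof.
rewrite lerBlDr -natrD ler_nat -(cardsID Y X) leq_add2l.
by apply/subset_leq_card; rewrite setDE subsetIr.
Qed.

Lemma card_setI_nb A (X : {set V}) w w' v : codeg_le A ->
  #|X|%:R - A <= #|X :&: nb w w' v|%:R :> R.
Proof.
by move=> dA; apply: le_trans (card_setIC _ _); rewrite lerB // card_nbC.
Qed.

Lemma ler_sum_cst (X : {set V}) (F : V -> nat) (c : R) :
  (forall v, v \in X -> c <= (F v)%:R) -> #|X|%:R * c <= (\sum_(v in X) F v)%:R.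
Proof.
move=> cF; rewrite natr_sum -sumr_const mulr_suml.
by apply: ler_sum => v /cF; rewrite mul1r.
Qed.

(** Each vertex placed earlier costs a candidate set at most [A]. The prefix [l1] keeps its own
    count because that count may come from a finer argument than the greedy one. *)
Lemma cnt_cat A m l1 l2 B (w0 : W) : codeg_le A -> 0 <= m ->
  (forall i, (i < size l2)%N ->
     (size l1 + i)%:R * A + m <= #|B (nth w0 l2 i)|%:R) ->
  (cnt l1 B)%:R * m ^+ size l2 <= (cnt (l1 ++ l2) B)%:R.
Proof.
move=> dA m0; elim: l1 B => [|w l1 IH] B /= HB.
  rewrite mul1r; elim: l2 B HB => [|w l IH] B HB //=.
  have mB : m <= #|B w|%:R by have := HB 0%N isT; rewrite mul0r add0r.
  rewrite exprS; apply: le_trans (_ : #|B w|%:R * m ^+ size l <= _).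
    by rewrite ler_wpM2r // exprn_ge0.
  apply: ler_sum_cst => v _; apply: IH => i il.
  apply: le_trans (@card_setI_nb A _ _ _ _ dA).
  by have := HB i.+1 il; rewrite /= !add0n -natr1; lra.
rewrite !natr_sum mulr_suml; apply: ler_sum => v _; apply: IH => i il.
apply: le_trans (@card_setI_nb A _ _ _ _ dA).
by have := HB i il; rewrite addSn -natr1; lra.
Qed.

Lemma cnt_ge A m l B (w0 : W) : codeg_le A -> 0 <= m ->
  (forall i, (i < size l)%N -> i%:R * A + m <= #|B (nth w0 l i)|%:R) ->
  m ^+ size l <= (cnt l B)%:R.
Proof.
by move=> dA m0 /(@cnt_cat _ _ [::] _ _ _ dA m0); rewrite mul1r.
Qed.

(** Placing [p] last means that only its set must survive [size l] losses; every other set has to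
    survive one loss less. *)
Lemma cnt_boost A m p l B : codeg_le A -> 0 <= A -> 0 <= m -> p \notin l ->
  (size l)%:R * A + m <= #|B p|%:R ->
  {in l, forall w, (size l).-1%:R * A + m <= #|B w|%:R} ->
  m ^+ (size l).+1 <= (cnt (p :: l) B)%:R.
Proof.
move=> dA A0 m0 pl Bp Bl; rewrite cnt_rcons // -(size_rcons l p).
apply: (@cnt_ge A m _ _ p) => // i; rewrite size_rcons nth_rcons ltnS => il.
case: ltngtP il => // [il|-> //] _.
apply: le_trans (Bl _ (mem_nth _ il)); rewrite lerD2r ler_wpM2r // ler_nat.
by case: (size l) il => // k; rewrite ltnS.
Qed.

End Counting.

(** * Embeddings into large sets *)

Lemma sumr_card (R : realType) (I : finType) (X : {set I}) (z : R) :
  \sum_(i in X) z = #|X|%:R * z.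
Proof. by rewrite sumr_const mulr_natl. Qed.

Lemma natrS3 (R : realType) n : n.+3%:R = n%:R + 3 :> R.
Proof. by rewrite -addn3 natrD. Qed.

Section LargeSets.

Variables (R : realType) (V : finType) (G : rel V).
Implicit Types (L S : {set V}) (a alpha gamma nu : R).

Definition edgeset S : {set V * V} :=
  [set p | [&& p.1 \in S, p.2 \in S & G p.1 p.2]].

(* [a] stands for n / r. *)
Definition nonext a alpha gamma := forall S,
  (1 - alpha) * a <= #|S|%:R -> gamma * a ^+ 2 <= #|edgeset S|%:R.


Lemma reverse_markov (I : finType) (D : {set I}) (f : I -> R) (M c : R) :
  0 <= M -> 0 <= c -> {in D, forall i, f i <= M} ->
  \sum_(i in D) f i <= #|[set i in D | c <= f i]|%:R * M + #|D|%:R * c.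
Proof.
move=> M0 c0 fM.
apply: le_trans (_ : \sum_(i in D) ((if c <= f i then M else 0) + c) <= _).
  apply: ler_sum => i iD; case: (leP c (f i)) => [_|/ltW]; last by rewrite add0r.
  by have := fM _ iD; lra.
rewrite big_split /= sumr_card lerD2r -big_mkcondr /=.
by rewrite -sumr_card le_eqVlt; apply/orP; left; apply/eqP; apply: eq_bigl => i; rewrite inE.
Qed.

Lemma sum_edgeset S (F : V -> V -> nat) :
  (\sum_(p in edgeset S) F p.1 p.2 =
   \sum_(v in S) \sum_(w in S :&: [set x | G v x]) F v w)%N.
Proof.
rewrite pair_big_dep /=; apply: eq_bigl => -[v w] /=.
by rewrite !inE.
Qed.

Lemma sum_nonedges L S :
  (\sum_(v in L) #|S :\: [set x | G v x]| =
   \sum_(w in S) #|L :\: [set x | G x w]|)%N.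
Proof.
transitivity (\sum_(v in L) \sum_(w in S | ~~ G v w) 1)%N.
  by apply: eq_bigr => v _; rewrite sum1dep_card; apply: eq_card => w; rewrite !inE andbC.
rewrite (exchange_big_dep (mem S)) /=; last by move=> v w _ /andP[].
apply: eq_bigr => w wS; rewrite sum1dep_card; apply: eq_card => v.
by rewrite !inE wS andbC.
Qed.

(** Both sides count edges of L together with a vertex of L that neither end sends an edge to. *)
Lemma sum_common_nonnbrs L :
  (\sum_(p in edgeset L) #|(L :\: [set x | G p.1 x]) :&: (L :\: [set x | G p.2 x])| =
   \sum_(w in L) #|edgeset (L :\: [set x | G x w])|)%N.
Proof.
transitivity (\sum_(p in edgeset L) \sum_(w in L | ~~ G p.1 w && ~~ G p.2 w) 1)%N.
  apply: eq_bigr => p _; rewrite sum1dep_card; apply: eq_card => w; rewrite !inE.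
  by case: (w \in L); rewrite ?andbF ?andbT.
rewrite (exchange_big_dep (mem L)) /=; last by move=> v w _ /andP[].
apply: eq_bigr => w wL; rewrite sum1dep_card; apply: eq_card => -[v u].
rewrite !inE wL /=.
by case: (v \in L); case: (u \in L); case: (G v u); case: (G v w); case: (G u w).
Qed.

Variables (a alpha gamma nu : R).
Hypotheses (a0 : 0 < a) (alpha0 : 0 < alpha) (gamma0 : 0 < gamma).
Hypotheses (nu0 : 0 <= nu) (nu1 : nu <= 4^-1).
Local Notation A := ((1 + nu) * a).
Hypotheses (dG : codeg_le G A) (xG : nonext a alpha gamma).

(** The gain of the common outneighbourhood of the two ends in L over the size [#|L| - 2 A] that the
    greedy count guarantees. *)
Definition excess L (p : V * V) : R :=
  #|L :&: [set x | G p.1 x] :&: [set x | G p.2 x]|%:R - #|L|%:R + 2 * A.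

Lemma excessE L p : excess L p =
  (A - #|L :\: [set x | G p.1 x]|%:R) + (A - #|L :\: [set x | G p.2 x]|%:R) +
  #|(L :\: [set x | G p.1 x]) :&: (L :\: [set x | G p.2 x])|%:R.
Proof.
rewrite /excess; set N1 := [set x | G p.1 x]; set N2 := [set x | G p.2 x].
have := cardsUI (L :\: N1) (L :\: N2); rewrite -setDIr => e1.
have := cardsID (N1 :&: N2) L; rewrite setIA => e2.
have : (#|L :\: (N1 :&: N2)| + #|(L :\: N1) :&: (L :\: N2)|)%:R =
       (#|L :\: N1| + #|L :\: N2|)%:R :> R by rewrite e1.
by rewrite -e2 !natrD; lra.
Qed.

(** Let X be the vertices of L with about [a] non-inneighbours in L. If X is large, these sets of
    non-inneighbours span many edges by [nonext], and each such edge has a common non-outneighbour,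
    so the two losses overlap. If X is small, most vertices of L miss clearly fewer than A
    inneighbours; by double counting the losses on the outneighbour side are also below A in total,
    and each vertex of L starts at least [a / 2] edges in L. *)
Lemma sum_excess L c : (2 - 4^-1) * a <= #|L|%:R ->
  c <= gamma / 4 -> c <= alpha / 2 ->
  c * a ^+ 3 <= \sum_(p in edgeset L) excess L p.
Proof.
move=> La cg ca; have a0' := a0.
pose Mi w := L :\: [set x | G x w]; pose Mo v := L :\: [set x | G v x].
pose X := [set w in L | (1 - alpha) * a <= #|Mi w|%:R].
have [Xbig|Xsmall] := lerP (a / 4) (#|X|%:R : R).
  apply: le_trans (_ : \sum_(p in edgeset L) #|Mo p.1 :&: Mo p.2|%:R <= _); last first.
    apply: ler_sum => p _; rewrite excessE /Mo.
    by have [d1 _] := @card_nonnbr R V G A L p.1 dG; have [d2 _] := @card_nonnbr R V G A L p.2 dG; lra.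
  rewrite -natr_sum sum_common_nonnbrs.
  apply: le_trans (_ : #|X|%:R * (gamma * a ^+ 2) <= _); last first.
    rewrite natr_sum -sumr_card.
    rewrite [leLHS](eq_bigl (fun w => (w \in L) && ((1 - alpha) * a <= #|Mi w|%:R))); last first.
      by move=> w; rewrite inE.
    rewrite big_mkcondr; apply: ler_sum => w _; case: ifP => [/xG//|_].
    by rewrite ler0n.
  apply: le_trans (_ : (a / 4) * (gamma * a ^+ 2) <= _).
    have -> : a / 4 * (gamma * a ^+ 2) = gamma / 4 * a ^+ 3 by ring.
    by rewrite ler_wpM2r // exprn_ge0 // ltW.
  by rewrite ler_wpM2r // mulr_ge0 ?exprn_ge0 // ltW.
pose f v : R := A - #|Mo v|%:R.
have f0 v : 0 <= f v by rewrite subr_ge0; have [] := @card_nonnbr R V G A L v dG.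
have sumf : a * (alpha * a) <= \sum_(v in L) f v.
  have -> : \sum_(v in L) f v = \sum_(w in L) (A - #|Mi w|%:R).
    by rewrite !sumrB -!natr_sum sum_nonedges.
  apply: le_trans (_ : \sum_(w in L) (if w \in X then 0 else alpha * a) <= _); last first.
    apply: ler_sum => w wL; rewrite inE wL /=; case: ifP => [_|/negbT Mw].
      by rewrite subr_ge0; have [] := @card_nonnbr R V G A L w dG.
    have : 0 <= nu * a by rewrite mulr_ge0 // ltW.
    by move: Mw; rewrite -ltNge; lra.
  rewrite (eq_bigr (fun w => if w \notin X then alpha * a else 0)); last first.
    by move=> w _; case: (w \in X).
  rewrite -big_mkcondr (eq_bigl (fun w => w \in L :\: X)); last first.
    by move=> w; rewrite /= in_setD andbC.
  rewrite sumr_card ler_wpM2r ?mulr_ge0 // ?ltW //.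
  have := cardsID X L; rewrite (setIidPr _); last first.
    by apply/subsetP => w; rewrite inE => /andP[].
  move=> e; have : #|L|%:R = #|X|%:R + #|L :\: X|%:R :> R by rewrite -natrD e.
  by move: Xsmall La; lra.
apply: le_trans (_ : \sum_(p in edgeset L) f p.1 <= _); last first.
  apply: ler_sum => p _; rewrite excessE.
  have := f0 p.2; have : 0 <= #|Mo p.1 :&: Mo p.2|%:R :> R by rewrite ler0n.
  by rewrite /f /Mo; lra.
have -> : \sum_(p in edgeset L) f p.1 =
    \sum_(v in L) #|L :&: [set x | G v x]|%:R * f v.
  rewrite (eq_bigr (fun v => \sum_(w in L :&: [set x | G v x]) f v)); last first.
    by move=> v _; rewrite sumr_const mulr_natl.
  by rewrite pair_big_dep /=; apply: eq_bigl => -[v w] /=; rewrite !inE.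
apply: le_trans (_ : \sum_(v in L) a / 2 * f v <= _); last first.
  apply: ler_sum => v _; apply: ler_wpM2r => //.
  have := @card_nonnbr R V G A L v dG => -[d _].
  have := cardsID [set x | G v x] L => e.
  have : #|L|%:R = #|L :&: [set x | G v x]|%:R + #|L :\: [set x | G v x]|%:R :> R.
    by rewrite -natrD e.
  have : nu * a <= 4^-1 * a by rewrite ler_wpM2r // ltW.
  by move: La d; lra.
rewrite -mulr_sumr; apply: le_trans (_ : a / 2 * (a * (alpha * a)) <= _); last first.
  by rewrite ler_wpM2l // divr_ge0 // ltW.
have -> : a / 2 * (a * (alpha * a)) = alpha / 2 * a ^+ 3 by ring.
by rewrite ler_wpM2r // exprn_ge0 // ltW.
Qed.

(** There are at most [(rr * a) ^+ 2] edges, so those below the threshold carry at most half of the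
    lower bound in [sum_excess]; a single excess is at most [4 * a]. *)
Lemma card_heavy_pairs L c (rr : R) : 0 < c -> 1 <= rr -> #|V|%:R = rr * a ->
  (2 - 4^-1) * a <= #|L|%:R -> c <= gamma / 4 -> c <= alpha / 2 ->
  c / 8 * a ^+ 2 <=
    #|[set p in edgeset L | c / (2 * rr ^+ 2) * a <= excess L p]|%:R.
Proof.
move=> c0 rr1 Va La cg ca; have h1 := sum_excess La cg ca.
have a0' := a0; have a0'' := ltW a0; have rr0 : 0 < rr by lra.
set D := [set p in _ | _].
have M0 : 0 <= 4 * a by lra.
have k0 : 0 <= c / (2 * rr ^+ 2) * a.
  by rewrite mulr_ge0 // divr_ge0 ?ltW // mulr_gt0 // exprn_gt0.
have fM : {in edgeset L, forall p, excess L p <= 4 * a}.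
  move=> p _; rewrite /excess.
  have : #|L :&: [set x | G p.1 x] :&: [set x | G p.2 x]|%:R <= #|L|%:R :> R.
    by rewrite ler_nat; apply/subset_leq_card; rewrite -setIA subsetIl.
  have : nu * a <= 4^-1 * a by rewrite ler_wpM2r.
  by lra.
have := reverse_markov M0 k0 fM; rewrite -/D => h2.
have h3 : #|edgeset L|%:R <= (rr * a) ^+ 2.
  by rewrite -Va -natrX ler_nat (leq_trans (max_card _)) // card_prod expnS expn1.
have h4 : #|edgeset L|%:R * (c / (2 * rr ^+ 2) * a) <= c / 2 * a ^+ 3.
  apply: le_trans (_ : (rr * a) ^+ 2 * (c / (2 * rr ^+ 2) * a) <= _).
    by rewrite ler_wpM2r // !mulr_ge0 // ?ltW // invr_gt0 mulr_gt0 // exprn_gt0.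
  by rewrite le_eqVlt; apply/orP; left; apply/eqP; field; rewrite gt_eqF.
have h5 : c / 8 * a ^+ 2 * (4 * a) <= #|D|%:R * (4 * a).
  have -> : c / 8 * a ^+ 2 * (4 * a) = c / 2 * a ^+ 3 by field.
  by lra.
by rewrite ler_pM2r in h5 => //; lra.
Qed.

End LargeSets.

(** * Embedding into a set slightly too small for the greedy count *)

Section Embed.

Variables (R : realType) (W V : finType) (T : rel W) (G : rel V).
Hypothesis tourT : forall w w', w != w' -> T w w' = ~~ T w' w.

(** A transitive triangle at the start confines the third vertex to the common outneighbourhood of
    the images of the first two, which is what [excess] measures. *)
Definition trans_prefix (l : seq W) := match l with
  | [:: u1, u2, u3 & _] => [&& T u1 u2, T u1 u3 & T u2 u3]
  | [:: u1; u2] => T u1 u2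
  | _ => false
  end.

Lemma cnt_cons2 u1 u2 l (L : {set V}) : T u1 u2 ->
  (cnt T G (u1 :: u2 :: l) (fun=> L) = \sum_(p in edgeset G L)
     cnt T G l (fun u => L :&: nb T G u1 u p.1 :&: nb T G u2 u p.2))%N.
Proof.
move=> T12; rewrite (sum_edgeset G L
  (fun v w => cnt T G l (fun u => L :&: nb T G u1 u v :&: nb T G u2 u w))) /=.
by apply: eq_bigr => v _; apply: eq_bigl => w; rewrite /nb T12.
Qed.

End Embed.

Lemma cnt_large (R : realType) (r : nat) (alpha gamma : R) :
  (2 <= r)%N -> 0 < alpha -> 0 < gamma ->
  exists c : R, [/\ 0 < c, c <= 1 &
  forall (W V : finType) (T : rel W) (G : rel V) (a : R) (l : seq W)
    (L : {set V}),
  (forall w w', w != w' -> T w w' = ~~ T w' w) -> 0 < a ->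
  #|V|%:R = r%:R * a -> codeg_le G ((1 + c) * a) -> nonext G a alpha gamma ->
  uniq l -> trans_prefix T l -> (size l <= r)%N ->
  ((size l).-1%:R - c) * a <= #|L|%:R ->
  (c * a) ^+ size l <= (cnt T G l (fun=> L))%:R].
Proof.
move=> r2 alpha0 gamma0.
have [rr Err rr2] : exists2 rr : R, rr = r%:R & 2 <= rr by exists r%:R; rewrite ?ler_nat.
have rr0 : 0 < rr by lra.
pose c0 := Num.min 1 (Num.min (gamma / 4) (alpha / 2)).
have c00 : 0 < c0 by rewrite !lt_min ltr01 !divr_gt0.
have [c01 cg ca] : [/\ c0 <= 1, c0 <= gamma / 4 & c0 <= alpha / 2].
  by split; rewrite !ge_min lexx ?orbT.
pose k : R := c0 / (2 * rr ^+ 2).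
have k0 : 0 < k by rewrite divr_gt0 // mulr_gt0 // exprn_gt0.
have k1 : k * 8 <= c0.
  rewrite /k mulrAC ler_pdivrMr ?mulr_gt0 ?exprn_gt0 //.
  by rewrite ler_pM2l //; nra.
(* The slacks [c * a] of up to [r] placements together use only a quarter of the gain [k * a] made
   at the third vertex. *)
pose c : R := k / (4 * rr).
have c0' : 0 < c by rewrite divr_gt0 // mulr_gt0.
have crr : c * rr = k / 4 by rewrite /c; field; rewrite gt_eqF.
have c8 : c * 8 <= k.
  have : c * 2 <= c * rr by rewrite ler_pM2l.
  by lra.
exists c; split=> //; first by lra.
move=> W V T G a l L tourT a0 Va dG xG ul tl sl Ls.
have a0' := ltW a0; have ca0 : 0 <= c * a by rewrite mulr_ge0 // ltW.
have cle1 : c <= 4^-1 by lra.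
have cge0 := ltW c0'.
have k2a : 0 <= k / 2 * a by rewrite mulr_ge0 //; lra.
have ck : c * a <= k / 2 * a by rewrite ler_wpM2r //; lra.
have pw j : (c * a) ^+ j.+2 <= c * a ^+ 2 * (k / 2 * a) ^+ j.
  rewrite -addn2 addnC exprD ler_pM ?exprn_ge0 //.
    by rewrite exprMn ler_wpM2r ?exprn_ge0 //; nra.
  by rewrite lerXn2r ?nnegrE.
case: l => [|u1 [|u2 [|p [|q l]]]] // in ul tl sl Ls *.
- rewrite cnt_cons2 //= sum1_card; apply: le_trans (xG L _).
    by rewrite exprMn ler_wpM2r ?exprn_ge0 //; nra.
  by apply: le_trans Ls; rewrite ler_wpM2r //=; lra.
- have /and3P[T12 T1p T2p] := tl.
  rewrite -[cnt _ _ _ _]/(\sum_(v in L) cnt T G [:: u2; p]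
    (fun u => L :&: nb T G u1 u v))%N.
  apply: le_trans (_ : #|L|%:R * (gamma * a ^+ 2) <= _); last first.
    apply: ler_sum_cst => v vL.
    rewrite (@eq_cnt _ _ T G [:: u2; p] _ (fun=> L :&: [set x | G v x])); last first.
      by move=> u; rewrite !inE /nb => /orP[]/eqP->; rewrite ?T12 ?T1p.
    rewrite cnt_cons2 //= sum1_card; apply: xG.
    have := @card_setI_nb R _ _ T _ _ L u1 u2 v dG; rewrite /nb T12.
    by apply: le_trans; move: Ls => /=; nra.
  rewrite (exprD _ 1 2) expr1 ler_pM ?exprn_ge0 //.
    by apply: le_trans Ls => /=; rewrite ler_wpM2r //; lra.
  by rewrite exprMn ler_wpM2r ?exprn_ge0 //; nra.
(* From four vertices on, the first two are mapped to a heavy edge, and the third vertex [p], whose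
   set has gained [k * a], is placed last. *)
have /and3P[T12 T1p T2p] := tl.
rewrite cnt_cons2 //; set D := edgeset G L.
have La : (2 - 4^-1) * a <= #|L|%:R.
  apply: le_trans Ls; rewrite ler_wpM2r //= (natrS3 R (size l)).
  by have := ler0n R (size l); lra.
rewrite -Err in Va; have rr1 : 1 <= rr by lra.
have := card_heavy_pairs a0 alpha0 gamma0 cge0 cle1 dG xG c00 rr1 Va La cg ca.
set D' := [set p in _ | _] => cD'.
apply: le_trans (_ : #|D'|%:R * (k / 2 * a) ^+ (size (p :: q :: l)) <= _).
  apply: (le_trans (pw (size (p :: q :: l)))); rewrite ler_wpM2r ?exprn_ge0 //.
  by apply: le_trans cD'; rewrite ler_wpM2r ?exprn_ge0 //; lra.
apply: le_trans (_ : (\sum_(p0 in D')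
   cnt T G (p :: q :: l) (fun u => L :&: nb T G u1 u p0.1 :&: nb T G u2 u p0.2))%:R <= _).
  rewrite natr_sum -sumr_card.
  apply: ler_sum => e; rewrite inE => /andP[eD hx].
  have sz : (size l).+3%:R * ((1 + c) * a) <= (size l).+3%:R * a + k / 4 * a.
    have -> : k / 4 = rr * c by rewrite -crr mulrC.
    have : (size l).+3%:R * (c * a) <= rr * (c * a).
      by rewrite ler_wpM2r // Err ler_nat ltnW.
    by lra.
  apply: (@cnt_boost R W V T G tourT ((1 + c) * a) (k / 2 * a) p (q :: l)) => //.
  - by rewrite mulr_ge0 //; lra.
  - by move: ul => /= /and4P[].
  - rewrite /nb T1p T2p; move: hx; rewrite /excess /= -/k; move: Ls sz.
    rewrite /= (natrS3 R (size l)) -(natr1 (size l)); have : c * a * 8 <= k * a.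
      by rewrite mulrAC ler_wpM2r.
    by lra.
  move=> w _; apply: le_trans (@card_setI_nb R _ _ T G _ _ _ _ _ dG).
  apply: le_trans (_ : #|L|%:R - (1 + c) * a - (1 + c) * a <= _); last first.
    by rewrite lerD2r; apply: card_setI_nb.
  move: Ls sz; rewrite /= (natrS3 R (size l)); have : c * a * 8 <= k * a.
      by rewrite mulrAC ler_wpM2r.
  have : k * a * 8 <= a.
    by rewrite mulrAC -[leRHS]mul1r ler_wpM2r //; lra.
  by lra.
rewrite ler_nat [X in (_ <= X)%N](bigID (mem D')) /=.
apply: leq_trans (leq_addr _ _); rewrite leq_eqVlt; apply/orP; left; apply/eqP.
by apply: eq_bigl => e; rewrite /D' inE andbA andbb.
Qed.

(** * Exchanging two vertices *)

Section Reachability.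

Variables (R : realType) (W V : finType) (T : rel W) (G : rel V).
Hypothesis tourT : forall w w', w != w' -> T w w' = ~~ T w' w.

Implicit Types (l : seq W) (B : W -> {set V}).

Lemma cnt_le_reach t l B x y n : perm_eq (t :: l) (enum W) -> size l = n ->
  {in l, forall w, B w \subset nb T G t w x :&: nb T G t w y} ->
  (cnt T G l B <=
   #|[set S : n.-tuple V | tile T G (x :: S) && tile T G (y :: S)]|)%N.
Proof.
move=> pl sl sB; rewrite (cnt_card _ _ _ sl); apply/subset_leq_card/subsetP => S.
rewrite !inE => ok; apply/andP; split; apply: (tileW pl) => /=; rewrite inE /=;
  apply: sub_okl ok => w wl; apply: subset_trans (sB _ wl) _; rewrite setTI.
  exact: subsetIl.
exact: subsetIr.
Qed.

Variables (a nu : R).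
Local Notation A := ((1 + nu) * a).

Lemma card_common_nb t w x y : codeg_le G A ->
  #|V|%:R - 2 * A <= #|nb T G t w x :&: nb T G t w y|%:R :> R.
Proof.
move=> dG; apply: le_trans (@card_setI_nb R _ _ T G A _ _ _ _ dG).
apply: le_trans (_ : #|V|%:R - A - A <= _); first by lra.
by have := @card_setI_nb R _ _ T G A setT t w x dG; rewrite cardsT setTI lerD2r.
Qed.

(** The summand for [v] is the gain of [p] over the guaranteed [#|B p| - A] when [u] is mapped to
    [v]. At least [d / 4 * a] choices of [v] give a gain of [d / (2 * rr) * a]; after each of them
    [p] is placed last. *)
Lemma cnt_pair_boost (d rr m : R) u p l B : 0 < a -> 0 <= nu -> nu <= 1 ->
  codeg_le G A -> T u p -> uniq [:: u, p & l] -> 0 < d -> 1 <= rr ->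
  #|V|%:R = rr * a -> 0 <= m -> d / (2 * rr) <= 1 ->
  ((size l)%:R + 3) * nu * a + m <= d / (2 * rr) * a ->
  {in p :: l, forall w, ((size l)%:R + 1 - 2 * nu) * a <= #|B w|%:R} ->
  d * a ^+ 2 <= \sum_(v in B u) (A - #|B p :\: [set x | G v x]|%:R) ->
  d / 4 * a * m ^+ (size l).+1 <= (cnt T G [:: u, p & l] B)%:R.
Proof.
move=> a0 nu0 nu1 dG Tup ul d0 rr1 Va m0 k1 hm HB hsum; have a0' := ltW a0.
set k := d / (2 * rr) in k1 hm; have k0 : 0 < k by rewrite divr_gt0 // mulr_gt0 //; lra.
pose f v := A - #|B p :\: [set x | G v x]|%:R.
have nua : nu * a <= a by rewrite ler_piMl.
have M0 : 0 <= 2 * a by lra.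
have ka0 : 0 <= k * a by rewrite mulr_ge0 // ltW.
have fM : {in B u, forall v, f v <= 2 * a}.
  by move=> v _; have := ler0n R #|B p :\: [set x | G v x]|; rewrite /f; lra.
have := reverse_markov M0 ka0 fM; set D := [set v in _ | _] => hD.
have hBu : #|B u|%:R * (k * a) <= d / 2 * a ^+ 2.
  apply: le_trans (_ : rr * a * (k * a) <= _).
    by rewrite ler_wpM2r // -Va ler_nat max_card.
  by rewrite le_eqVlt; apply/orP; left; apply/eqP; rewrite /k; field; rewrite gt_eqF //; lra.
have hD' : d / 4 * a <= #|D|%:R.
  have : d / 4 * a * (2 * a) <= #|D|%:R * (2 * a).
    have -> : d / 4 * a * (2 * a) = d / 2 * a ^+ 2 by field.
    by move: hsum hD hBu; rewrite -/(f _); lra.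
  by rewrite ler_pM2r //; lra.
apply: le_trans (_ : #|D|%:R * m ^+ (size l).+1 <= _).
  by rewrite ler_wpM2r // exprn_ge0.
apply: le_trans (_ : (\sum_(v in D)
   cnt T G (p :: l) (fun w => B w :&: nb T G u w v))%:R <= _); last first.
  rewrite ler_nat [X in (_ <= X)%N](bigID (mem D)) /=.
  apply: leq_trans (leq_addr _ _); rewrite leq_eqVlt; apply/orP; left; apply/eqP.
  by apply: eq_bigl => v; rewrite /D !inE; case: (v \in B u).
apply: ler_sum_cst => v; rewrite inE => /andP[_ fv].
have [pl A0] : p \notin l /\ 0 <= A.
  by split; [move: ul => /and3P[]|rewrite mulr_ge0 //; lra].
apply: (@cnt_boost R W V T G tourT A m p l) => //.
  have := cardsID [set x | G v x] (B p) => e.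
  have {e} : #|B p|%:R = #|B p :&: [set x | G v x]|%:R + #|B p :\: [set x | G v x]|%:R :> R.
    by rewrite -natrD e.
  by rewrite /nb Tup; have := HB p (mem_head _ _); move: fv hm; rewrite /f; lra.
move=> w wl; apply: le_trans (@card_setI_nb R _ _ T G A _ _ _ _ dG).
have := HB w; rewrite in_cons wl orbT => /(_ isT).
have ka1 : k * a <= a by rewrite ler_piMl.
have nua0 : 0 <= nu * a by rewrite mulr_ge0.
case: (l) wl hm => // w0 l' _; rewrite /= -(natr1 (size l')); lra.
Qed.

Lemma card_setDUI (P Q N : {set V}) :
  #|P :\: N|%:R + #|Q :\: N|%:R =
  #|(P :|: Q) :\: N|%:R + #|(P :&: Q) :\: N|%:R :> R.
Proof.
rewrite -!natrD -cardsUI setDUl; congr ((_ + _)%:R).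
by apply: eq_card => x; rewrite !inE; case: (x \in N); rewrite //= ?andbF.
Qed.

(** A typical vertex of Q has nearly A non-outneighbours in P and nearly A in Q, but at most A in
    the union; so nearly A of them lie in both. The non-edges from Q to [P :&: Q] thus number nearly
    [#|Q| * A], while each vertex of [P :&: Q] receives at most A. *)
Lemma card_setI_sources (P Q : {set V}) d : 0 < a -> 0 <= nu -> codeg_le G A ->
  \sum_(v in Q) (A - #|P :\: [set x | G v x]|%:R) < d * a ^+ 2 ->
  \sum_(v in Q) (A - #|Q :\: [set x | G v x]|%:R) < d * a ^+ 2 ->
  #|Q|%:R - 2 * d * a <= #|P :&: Q|%:R.
Proof.
move=> a0 nu0 dG h1 h2.
have Aa : a <= A by rewrite ler_peMl ?(ltW a0) //; lra.
have h3 : \sum_(v in Q) #|(P :&: Q) :\: [set x | G v x]|%:R <= #|P :&: Q|%:R * A.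
  rewrite -natr_sum sum_nonedges natr_sum -sumr_card; apply: ler_sum => w _.
  by have [] := @card_nonnbr R V G A Q w dG.
have h4 : \sum_(v in Q) (#|P :\: [set x | G v x]|%:R + #|Q :\: [set x | G v x]|%:R) <=
          \sum_(v in Q) (A + #|(P :&: Q) :\: [set x | G v x]|%:R) :> R.
  by apply: ler_sum => v _; rewrite card_setDUI lerD2r; have [] := @card_nonnbr R V G A (P :|: Q) v dG.
move: h1 h2 h4; rewrite !sumrB !big_split /= !sumr_card => h1 h2 h4.
(* A negative [d] contradicts the first hypothesis, whose summands are nonnegative. *)
have h5 : (#|Q|%:R - 2 * d * a) * A <= #|P :&: Q|%:R * A \/ d < 0.
  have [d0|d0] := lerP 0 d; last by right.
  left; have : d * a * a <= d * a * A by rewrite ler_wpM2l // mulr_ge0 // ltW.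
  by lra.
case: h5 => [|d0]; first by rewrite ler_pM2r //; lra.
have : 0 <= \sum_(v in Q) (A - #|P :\: [set x | G v x]|%:R) :> R.
  by apply: sumr_ge0 => v _; rewrite subr_ge0; have [] := @card_nonnbr R V G A P v dG.
rewrite sumrB sumr_card; have : d * a ^+ 2 < 0 by rewrite pmulr_llt0 // exprn_gt0.
by lra.
Qed.

(** The mirror image of [card_setI_sources]: the non-edges from Q and from P into P are counted at
    their ends in P. *)
Lemma card_setI_targets (P Q : {set V}) d : 0 < a -> 0 <= nu -> codeg_le G A ->
  \sum_(v in Q) (A - #|P :\: [set x | G v x]|%:R) < d * a ^+ 2 ->
  \sum_(v in P) (A - #|P :\: [set x | G v x]|%:R) < d * a ^+ 2 ->
  #|Q|%:R - 2 * d * a <= #|P :&: Q|%:R.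
Proof.
move=> a0 nu0 dG.
rewrite !sumrB -!natr_sum (sum_nonedges G Q P) (sum_nonedges G P P) !natr_sum => h1 h2.
have Aa : a <= A by rewrite ler_peMl ?(ltW a0) //; lra.
have h3 : \sum_(v in P) #|(P :&: Q) :\: [set x | G x v]|%:R <= #|P :&: Q|%:R * A.
  rewrite -natr_sum -sum_nonedges natr_sum -sumr_card; apply: ler_sum => w _.
  by have [] := @card_nonnbr R V G A P w dG.
have h4 : \sum_(v in P) (#|P :\: [set x | G x v]|%:R + #|Q :\: [set x | G x v]|%:R) <=
          \sum_(v in P) (A + #|(P :&: Q) :\: [set x | G x v]|%:R) :> R.
  by apply: ler_sum => v _; rewrite card_setDUI lerD2r; have [] := @card_nonnbr R V G A (P :|: Q) v dG.
move: h1 h2 h4; rewrite !big_split /= !sumr_card => h1 h2 h4.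
have h5 : (#|Q|%:R - 2 * d * a) * A <= #|P :&: Q|%:R * A \/ d < 0.
  have [d0|d0] := lerP 0 d; last by right.
  left; have : d * a * a <= d * a * A by rewrite ler_wpM2l // mulr_ge0 // ltW.
  by lra.
case: h5 => [|d0]; first by rewrite ler_pM2r //; lra.
have : 0 <= \sum_(v in P) (A - #|P :\: [set x | G x v]|%:R) :> R.
  by apply: sumr_ge0 => v _; rewrite subr_ge0; have [] := @card_nonnbr R V G A P v dG.
rewrite sumrB sumr_card; have : d * a ^+ 2 < 0 by rewrite pmulr_llt0 // exprn_gt0.
by lra.
Qed.

End Reachability.

Lemma perm_four (X : eqType) (x1 x2 x3 x4 : X) (s : seq X) :
  let s0 := [:: x1, x2, x3, x4 & s] in
  [/\ perm_eq [:: x4, x1, x2, x3 & s] s0, perm_eq [:: x2, x1, x3, x4 & s] s0,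
      perm_eq [:: x2, x3, x4, x1 & s] s0, perm_eq [:: x2, x4, x3, x1 & s] s0 &
      perm_eq [:: x2, x1, x4, x3 & s] s0 /\ perm_eq [:: x2, x4, x1, x3 & s] s0].
Proof. by split; [..|split]; apply/permP => p /=; lia. Qed.

(** Either the common in- and outneighbourhoods of x and y nearly coincide, and any vertex of T can
    be deleted, or the middle vertex of a transitive triangle is deleted and some edge among the
    remaining vertices yields a gain. *)
Lemma exchange_pairs (R : realType) (r : nat) (alpha gamma : R) :
  (3 <= r)%N -> 0 < alpha -> 0 < gamma ->
  exists c : R, [/\ 0 < c, c <= 1 &
  forall (W V : finType) (T : rel W) (G : rel V) (a : R) (l : seq W) (x y : V),
  (forall w w', w != w' -> T w w' = ~~ T w' w) -> 0 < a ->
  #|V|%:R = r%:R * a -> codeg_le G ((1 + c) * a) -> nonext G a alpha gamma ->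
  perm_eq l (enum W) -> trans_prefix T l -> size l = r ->
  (c * a) ^+ r.-1 <=
  #|[set S : r.-1.-tuple V | tile T G (x :: S) && tile T G (y :: S)]|%:R].
Proof.
move=> r3 alpha0 gamma0.
have [ce [ce0 ce1 Hce]] := cnt_large (ltnW r3) alpha0 gamma0.
have [rr Err rr3] : exists2 rr : R, rr = r%:R & 3 <= rr by exists r%:R; rewrite ?ler_nat.
(* In [contra1] the losses [2 * d * a] and [2 * c * a] must stay within [ce * a]. *)
pose d : R := ce / 4; have d0 : 0 < d by rewrite divr_gt0.
pose k : R := d / (2 * rr); have k0 : 0 < k by rewrite divr_gt0 // mulr_gt0 //; lra.
pose c : R := k / (2 * rr); have c0 : 0 < c by rewrite divr_gt0 // mulr_gt0 //; lra.
have crr : c * rr = k / 2 by rewrite /c; field; rewrite gt_eqF //; lra.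
have krr : k * rr = d / 2 by rewrite /k; field; rewrite gt_eqF //; lra.
have kd : k * 6 <= d by have : k * 3 <= k * rr; [rewrite ler_pM2l|lra].
have ck : c * 6 <= k by have : c * 3 <= c * rr; [rewrite ler_pM2l|lra].
have dce : d * 4 = ce by rewrite /d; field.
exists c; split=> //; first by lra.
move=> W V T G a l x y tourT a0 Va dG xG pl tl sl.
have a0' := ltW a0; have c0' := ltW c0.
have ca0 : 0 <= c * a by rewrite mulr_ge0.
have cea : c * a <= ce * a by rewrite ler_wpM2r //; lra.
have dG' : codeg_le G ((1 + ce) * a).
  by move=> v; have [d1 d2] := dG v; split; [apply: le_trans d1 _|apply: le_trans d2 _]; lra.
have ul : uniq l by rewrite (perm_uniq pl) enum_uniq.
have nbP t w : (r%:R - 2 - 2 * c) * a <= #|nb T G t w x :&: nb T G t w y|%:R.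
  by apply: le_trans (card_common_nb _ _ _ _ _ dG); rewrite Va; lra.
case: l => [|u1 [|u2 [|u3 l]]] // in pl tl sl ul *.
  by rewrite -sl in r3.
have /and3P[T12 T13 T23] := tl.
have neT u v : T u v -> u != v -> T v u = false.
  by move=> Tuv uv; rewrite tourT 1?eq_sym // Tuv.
case: l => [|q l] in pl tl sl ul *.
  (* When [r = 3], the vertex [u1] dominates the other two, so both go into the common
     outneighbourhood, where an edge exists. *)
  apply: le_trans (_ : (ce * a) ^+ 2 <= _).
    by rewrite -sl /= lerXn2r ?nnegrE // mulr_ge0 // ltW.
  pose B (w : W) := nb T G u1 u2 x :&: nb T G u1 u2 y.
  apply: le_trans (_ : (cnt T G [:: u2; u3] B)%:R <= _); last first.
    rewrite ler_nat; apply: (@cnt_le_reach _ _ _ _ u1) => //; first by rewrite -sl.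
    by move=> w; rewrite !inE /B /nb T12 => /orP[]/eqP->; rewrite ?T12 ?T13.
  apply: (Hce W V T G a [:: u2; u3]) => //; first by move: ul => /andP[].
    by rewrite ltnW.
  by apply: le_trans (nbP _ _); rewrite -sl /= ler_wpM2r //; lra.
have sl' : r = (size l).+4 by rewrite -sl.
have [p1 p2 p3 p4 [p5 p6]] := perm_four u1 u2 u3 q l.
have rK : r%:R = (size l).+1%:R + 3 :> R by rewrite sl' natrS3.
(* Common outneighbours [P] and inneighbours [Q] of x and y. With [u2] deleted, every other vertex
   of T must go into one of them. *)
pose P := nb T G u2 u3 x :&: nb T G u2 u3 y.
pose Q := nb T G u2 u1 x :&: nb T G u2 u1 y.
have [PQ|PQ] := lerP ((r%:R - 2 - ce) * a) #|P :&: Q|%:R.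
  (* Vertices of [P :&: Q] are joined to x and y in both directions, so the deleted vertex may be
     [q] and the transitive triangle stays. *)
  apply: le_trans (_ : (cnt T G [:: u1, u2, u3 & l] (fun=> P :&: Q))%:R <= _); last first.
    rewrite ler_nat; apply: (@cnt_le_reach _ _ _ _ q) => //; last 1 first.
    - move=> w _; have u12 : u1 != u2 by move: ul; rewrite /= !inE; case: eqP.
      rewrite /P /Q /nb T23 (neT _ _ T12 u12); apply/subsetP => v.
      by case: (T q w); rewrite !inE => /andP[/andP[g1 g2] /andP[g3 g4]]; rewrite ?g1 ?g2 ?g3 ?g4.
    - exact: perm_trans pl.
    - by rewrite sl'.
  apply: le_trans (_ : (ce * a) ^+ r.-1 <= _).
    by rewrite lerXn2r ?nnegrE // mulr_ge0 // ltW.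
  rewrite sl' /=; apply: (Hce W V T G a [:: u1, u2, u3 & l]) => //.
  - by move: ul; rewrite /= !inE !negb_or => /and4P[/and4P[-> -> _ ->] /and3P[-> _ ->] /andP[_ ->] /andP[_ ->]].
  - by rewrite sl' /=.
  apply: le_trans PQ; rewrite ler_wpM2r //= rK.
  by rewrite -(natr1 (size l).+1); lra.
pose B w := nb T G u2 w x :&: nb T G u2 w y.
have main u p l' : T u p -> perm_eq [:: u2, u, p & l'] (enum W) ->
    d * a ^+ 2 <= \sum_(v in B u) ((1 + c) * a - #|B p :\: [set z | G v z]|%:R) ->
    (c * a) ^+ r.-1 <=
    #|[set S : r.-1.-tuple V | tile T G (x :: S) && tile T G (y :: S)]|%:R.
  move=> Tup pl' hs.
  have sz : (size l').+3 = r.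
    by rewrite -sl (perm_size pl) -(perm_size pl').
  have rK' : r%:R = (size l')%:R + 3 :> R by rewrite -sz natrS3.
  apply: le_trans (_ : (cnt T G [:: u, p & l'] B)%:R <= _); last first.
    by rewrite ler_nat; apply: (cnt_le_reach pl') => //; rewrite -sz.
  apply: le_trans (_ : d / 4 * a * (k / 2 * a) ^+ (size l').+1 <= _).
    rewrite -sz /= exprS ler_pM ?exprn_ge0 // ?ler_wpM2r //; first by lra.
    have k2 : c * a <= k / 2 * a by rewrite ler_wpM2r //; lra.
    by rewrite lerXn2r ?nnegrE //; lra.
  apply: (@cnt_pair_boost R W V T G tourT a c d rr) => //.
  - by lra.
  - by move: (perm_uniq pl'); rewrite enum_uniq => /andP[].
  - by lra.
  - by rewrite Va Err.
  - by rewrite mulr_ge0 //; lra.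
  - by rewrite -/k; lra.
  - rewrite -rK' -/k -Err [rr * c]mulrC crr; lra.
  - by move=> w _; apply: le_trans (nbP _ _); rewrite rK'; lra.
have [h|h1] := lerP (d * a ^+ 2)
    (\sum_(v in B u1) ((1 + c) * a - #|B u3 :\: [set z | G v z]|%:R)).
  apply: (main _ _ (q :: l) T13 _ h); exact: perm_trans pl.
(* Without a gain from [u1] to [u3], the fourth vertex [q] decides: it shares the set [P] with [u3]
   or [Q] with [u1], and the edge joining it to that vertex gains inside this set unless [P] and [Q]
   nearly coincide. *)
have uq : [/\ u1 != q, u3 != q & u2 != q].
  by move: ul; rewrite /= !inE !negb_or => /and4P[/and4P[_ _ -> _] /and3P[_ -> _] /andP[-> _] _].
have [u1q u3q u2q] := uq.
have QX : ((size l).+1%:R + 1 - 2 * c) * a <= #|Q|%:R.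
  by apply: le_trans (nbP _ _); rewrite rK; lra.
have contra1 : #|Q|%:R - 2 * d * a <= #|P :&: Q|%:R -> False.
  have c4 : c * a <= d * a by rewrite ler_wpM2r //; lra.
  have da0 : 0 < d * a by rewrite mulr_gt0.
  by move: PQ QX; rewrite rK -dce; lra.
have Bq : B q = if T u2 q then P else Q.
  have u12 : u1 != u2 by move: ul; rewrite /= !inE; case: eqP.
  by rewrite /B /P /Q /nb (neT _ _ T12 u12) T23; case: (T u2 q).
case T2q: (T u2 q) in Bq.
  have [h|h2] := lerP (d * a ^+ 2) (\sum_(v in P) ((1 + c) * a - #|P :\: [set z | G v z]|%:R)).
    have [T3q|T3q] := boolP (T u3 q).
      apply: (main u3 q (u1 :: l)) => //; last by rewrite Bq.
      exact: perm_trans pl.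
    apply: (main q u3 (u1 :: l)) => //; first by rewrite tourT 1?eq_sym // T3q.
      exact: perm_trans pl.
    by rewrite Bq.
  by exfalso; apply: contra1; apply: (card_setI_targets a0 c0' dG).
have [h|h2] := lerP (d * a ^+ 2) (\sum_(v in Q) ((1 + c) * a - #|Q :\: [set z | G v z]|%:R)).
  have [T1q|T1q] := boolP (T u1 q).
    apply: (main u1 q (u3 :: l)) => //; last by rewrite Bq.
    exact: perm_trans pl.
  apply: (main q u1 (u3 :: l)) => //; first by rewrite tourT 1?eq_sym // T1q.
    exact: perm_trans pl.
  by rewrite Bq.
by exfalso; apply: contra1; apply: (card_setI_sources a0 c0' dG).
Qed.

(** * A greedy packing with regular degrees *)

Section PowerBounds.

Variable R : realType.

Lemma exprB_le q (s h : R) : 0 <= h -> h <= s -> s <= 1 ->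
  0 <= s ^+ q - (s - h) ^+ q <= q%:R * h.
Proof.
move=> h0 hs s1; elim: q => [|q /andP[IH1 IH2]]; first by rewrite !expr0 subrr mul0r lexx.
have -> : s ^+ q.+1 - (s - h) ^+ q.+1 = s * (s ^+ q - (s - h) ^+ q) + (s - h) ^+ q * h.
  by rewrite !exprS; ring.
have t0 : 0 <= (s - h) ^+ q by rewrite exprn_ge0 // subr_ge0.
have t1 : (s - h) ^+ q <= 1 by rewrite exprn_ile1 //; lra.
apply/andP; split; first by rewrite addr_ge0 // mulr_ge0 //; lra.
rewrite -natr1 mulrDl mul1r lerD //.
  by apply: le_trans IH2; rewrite ler_piMl.
by rewrite ler_piMl.
Qed.

(** The first-order expansion of [s ^+ q], multiplied by [s] so that the exponent [q - 1] does not
    occur. *)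
Lemma exprB_taylor q (s h : R) : 0 <= h -> h <= s -> s <= 1 ->
  q%:R * h * s ^+ q - q%:R ^+ 2 * h ^+ 2 <= s * (s ^+ q - (s - h) ^+ q)
    <= q%:R * h * s ^+ q.
Proof.
move=> h0 hs s1; elim: q => [|q /andP[IH1 IH2]].
  by rewrite !expr0 subrr mulr0 !mul0r expr0n /= mul0r subr0 lexx.
have s0 : 0 <= s by lra.
set D := s ^+ q - (s - h) ^+ q in IH1 IH2.
have E : s * (s ^+ q.+1 - (s - h) ^+ q.+1) = s * (s * D) + s * h * (s ^+ q - D).
  by rewrite /D !exprS; ring.
have sq0 : 0 <= s ^+ q by rewrite exprn_ge0.
have sq1 : s ^+ q <= 1 by rewrite exprn_ile1.
have q0 := ler0n R q.
have D0 : 0 <= D by have /andP[] := exprB_le q h0 hs s1.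
rewrite E exprS -natr1; apply/andP; split; last first.
  have : s * (s * D) <= s * (q%:R * h * s ^+ q) by rewrite ler_wpM2l.
  have : 0 <= s * h * D by rewrite !mulr_ge0.
  by lra.
have : s * (q%:R * h * s ^+ q - q%:R ^+ 2 * h ^+ 2) <= s * (s * D) by rewrite ler_wpM2l.
have : h * (s * D) <= h * (q%:R * h * s ^+ q) by rewrite ler_wpM2l.
have : s * (q%:R ^+ 2 * h ^+ 2) <= q%:R ^+ 2 * h ^+ 2 by rewrite ler_piMl // mulr_ge0 ?sqr_ge0.
have : q%:R * h ^+ 2 * s ^+ q <= q%:R * h ^+ 2 by rewrite ler_piMr // mulr_ge0 // sqr_ge0.
have : 0 <= q%:R * h ^+ 2 by rewrite mulr_ge0 // sqr_ge0.
have : 0 <= h ^+ 2 by rewrite sqr_ge0.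
by lra.
Qed.

(** Cauchy-Schwarz, from the squares of [y v - t] with [t] the mean. *)
Lemma sqr_sum_le (I : finType) (U : {set I}) (y : I -> R) :
  (\sum_(v in U) y v) ^+ 2 <= #|U|%:R * \sum_(v in U) y v ^+ 2.
Proof.
set S := \sum_(v in U) y v; set Q := \sum_(v in U) y v ^+ 2.
have key t : 2 * t * S <= Q + #|U|%:R * t ^+ 2.
  have -> : #|U|%:R * t ^+ 2 = \sum_(v in U) t ^+ 2 by rewrite sumr_const mulr_natl.
  rewrite -big_split mulr_sumr; apply: ler_sum => v _ /=.
  by have := sqr_ge0 (y v - t); lra.
have [U0|U0] := posnP #|U|.
  rewrite U0 mul0r /S big_pred0 ?expr0n // => v.
  by rewrite (cards0_eq U0) inE.
have u0 : 0 < #|U|%:R :> R by rewrite ltr0n.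
have := key (S / #|U|%:R).
have -> : 2 * (S / #|U|%:R) * S = 2 * S ^+ 2 / #|U|%:R by field; rewrite gt_eqF.
have -> : #|U|%:R * (S / #|U|%:R) ^+ 2 = S ^+ 2 / #|U|%:R by field; rewrite gt_eqF.
have -> : 2 * S ^+ 2 / #|U|%:R = S ^+ 2 / #|U|%:R + S ^+ 2 / #|U|%:R by field; rewrite gt_eqF.
by rewrite lerD2r ler_pdivrMr // mulrC.
Qed.

Lemma weighted_min (I : finType) (P : pred I) (w F : I -> R) (Z : R) :
  (forall i, 0 <= w i) -> 0 < \sum_(i | P i) w i ->
  \sum_(i | P i) w i * F i <= Z ->
  exists i, [/\ P i, 0 < w i & F i <= Z / \sum_(i | P i) w i].
Proof.
move=> w0 S0 HZ; set S := \sum_(i | P i) w i in S0 *.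
have [/existsP[i /and3P[Pi wi Fi]]|/existsPn H] :=
  boolP [exists i, [&& P i, 0 < w i & F i <= Z / S]]; first by exists i.
exfalso; have lt i : P i -> 0 < w i -> Z / S < F i.
  by move=> Pi wi; have := H i; rewrite Pi wi /= -ltNge.
have [i0 /andP[Pi0 wi0]] : exists i, P i && (0 < w i).
  apply/existsP; apply: contraT => /existsPn H0; move: S0; rewrite /S big1 ?ltxx // => i Pi.
  by have := H0 i; rewrite Pi /= -leNgt => wi; apply/le_anti; rewrite wi w0.
suff : Z < \sum_(i | P i) w i * F i by rewrite ltNge HZ.
have -> : Z = \sum_(i | P i) w i * (Z / S) by rewrite -mulr_suml -/S; field; rewrite gt_eqF.
rewrite (bigD1 i0) //= [ltRHS](bigD1 i0) //= ltr_leD //.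
  by rewrite ltr_pM2l // lt.
apply: ler_sum => i /andP[Pi _]; have := w0 i; rewrite le_eqVlt => /orP[/eqP<-|wi].
  by rewrite !mul0r.
by rewrite ler_wpM2l // ltW // lt.
Qed.

End PowerBounds.

Section Degrees.

Variables (R : realType) (V E : finType) (f : E -> seq V) (w : E -> R).

Definition wdeg v := \sum_e w e * (v \in f e)%:R.
Definition wcodeg u v := \sum_e w e * ((u \in f e) && (v \in f e))%:R.

End Degrees.

(** * Effect of deleting one edge on the weighted degrees *)

Section NibbleStep.

Variables (R : realType) (V E : finType) (f : E -> seq V) (w : E -> R) (q : nat).
Local Notation r := q.+1.
Local Notation N := (#|V|%:R : R).
Hypotheses (w0 : forall e, 0 <= w e).
Hypothesis fU : forall e, 0 < w e -> uniq (f e) /\ size (f e) = r.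
Variable C : R.
Hypotheses (wC : forall v, wdeg f w v <= C)
  (cC : forall u v, u != v -> wcodeg f w u v <= C / N).

Implicit Types (e : E).

Definition inside (U : {set V}) e := all [in U] (f e).
Definition deg_in U v := \sum_(e | inside U e) w e * (v \in f e)%:R.
Definition codeg_in U u v :=
  \sum_(e | inside U e) w e * ((u \in f e) && (v \in f e))%:R.
Definition weight_in U := \sum_(e | inside U e) w e.
Definition touch U e v := \sum_(u in [set x in f e] | u != v) codeg_in U u v.

Lemma w_pos e (P : Prop) : (0 < w e -> P) -> w e = 0 \/ P.
Proof.
by move=> H; have := w0 e; rewrite le_eqVlt => /orP[/eqP/esym|/H]; [left|right].
Qed.

Lemma eq_wM e (x y : R) : (0 < w e -> x = y) -> w e * x = w e * y.
Proof. by case/w_pos=> [->|->//]; rewrite !mul0r. Qed.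

Lemma deg_in_ge0 U v : 0 <= deg_in U v.
Proof. by apply: sumr_ge0 => e _; rewrite mulr_ge0. Qed.

Lemma codeg_in_ge0 U u v : 0 <= codeg_in U u v.
Proof. by apply: sumr_ge0 => e _; rewrite mulr_ge0. Qed.

Lemma deg_in_le U v : deg_in U v <= C.
Proof.
apply: le_trans (wC v); rewrite /deg_in big_mkcond; apply: ler_sum => e _.
by case: ifP => // _; rewrite mulr_ge0.
Qed.

Lemma codeg_in_le U u v : u != v -> codeg_in U u v <= C / N.
Proof.
move=> uv; apply: le_trans (cC uv); rewrite /codeg_in big_mkcond; apply: ler_sum => e _.
by case: ifP => // _; rewrite mulr_ge0.
Qed.

Lemma sum_mem (U : {set V}) e : 0 < w e -> inside U e ->
  \sum_(v in U) (v \in f e)%:R = r%:R :> R.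
Proof.
move=> /fU[ue se] /allP fe; rewrite -natr_sum -big_mkcondr sum1dep_card -se -(card_uniqP ue).
by congr _%:R; apply: eq_card => v; rewrite !inE; case: (boolP (v \in f e)) => [/fe->|]; rewrite ?andbF.
Qed.

Lemma sum_deg_in (U : {set V})  : \sum_(v in U) deg_in U v = r%:R * weight_in U.
Proof.
rewrite exchange_big /= /weight_in mulr_sumr; apply: eq_bigr => e ie.
by rewrite -mulr_sumr [RHS]mulrC; apply: eq_wM => we; rewrite sum_mem.
Qed.

Lemma sum_codeg_in (U : {set V}) v : v \in U ->
  \sum_(u in U | u != v) codeg_in U u v = q%:R * deg_in U v.
Proof.
move=> vU; rewrite exchange_big /= /deg_in mulr_sumr; apply: eq_bigr => e ie.
rewrite -mulr_sumr mulrCA; apply: eq_wM => we.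
have := sum_mem we ie; rewrite (bigD1 v) //=.
have [ve|ve] := boolP (v \in f e); last by move=> _; rewrite mulr0 big1 // => u _; rewrite andbF.
move=> h; rewrite mulr1; under eq_bigr do rewrite andbT.
by move: h; rewrite addrC -natr1 => /addIr.
Qed.

Lemma sum_touch (U : {set V}) v :
  \sum_(e | inside U e) w e * touch U e v =
  \sum_(u in U | u != v) codeg_in U u v * deg_in U u.
Proof.
rewrite /touch; under eq_bigr do rewrite mulr_sumr.
transitivity (\sum_(e | inside U e) \sum_(u in U | u != v)
    codeg_in U u v * (w e * (u \in f e)%:R)).
  apply: eq_bigr => e /allP ie; rewrite [LHS]big_mkcond [RHS]big_mkcond.
  apply: eq_bigr => u _; rewrite inE.
  have [uf|uf] := boolP (u \in f e).
    by rewrite (ie _ uf); case: ifP => // _; rewrite mulr1 mulrC.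
  by rewrite mulr0 mulr0; case: ifP.
by rewrite exchange_big; apply: eq_bigr => u _; rewrite -mulr_sumr.
Qed.

Lemma touchE (U : {set V}) e v : v \notin f e -> 0 < w e -> touch U e v =
  \sum_(g | inside U g) w g * (v \in f g)%:R * #|[set x in f e] :&: [set x in f g]|%:R.
Proof.
move=> ve we; rewrite /touch /codeg_in exchange_big; apply: eq_bigr => g _.
rewrite -mulr_sumr -mulrA; congr (_ * _).
rewrite -sum1_card natr_sum mulr_sumr big_mkcond [RHS]big_mkcond; apply: eq_bigr => u _.
rewrite !inE mulr1; have [uv|uv] := eqVneq u v; first by rewrite uv (negPf ve).
by rewrite andbT; case: (u \in f e); case: (u \in f g); rewrite ?mulr0.
Qed.

(* Deleting [e] costs [v] the weight [touch U e v], except that edges meeting [e]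
   more than once are counted too often there. *)
Lemma deg_in_setD (U : {set V}) e v : v \notin f e -> 0 < w e ->
  let D := deg_in U v - deg_in (U :\: [set x in f e]) v in
  [/\ 0 <= D, D <= touch U e v &
   touch U e v - D <= \sum_(g | inside U g) w g * (v \in f g)%:R *
     (#|[set x in f e] :&: [set x in f g]|%:R ^+ 2 - #|[set x in f e] :&: [set x in f g]|%:R)].
Proof.
move=> ve we D; pose I g := #|[set x in f e] :&: [set x in f g]|.
have DE : D = \sum_(g | inside U g) w g * (v \in f g)%:R * (I g != 0%N)%:R.
  rewrite /D /deg_in [X in _ - X](eq_bigl (fun g => inside U g && (I g == 0%N))); last first.
    move=> g; apply/allP/andP => [H|[/allP H1 I0] x xg].
      split; first by apply/allP => x /H; rewrite inE => /andP[].
      rewrite cards_eq0; apply/eqP/setP => x; rewrite !inE; apply/negP => /andP[xe /H].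
      by rewrite !inE xe.
    rewrite !inE H1 // andbT; apply/negP => xe; move: I0; rewrite cards_eq0 => /eqP/setP/(_ x).
    by rewrite !inE xe xg.
  rewrite (bigID (fun g => I g == 0%N)) /= addrAC subrr add0r [RHS](bigID (fun g => I g == 0%N)) /=.
  rewrite [X in _ = X + _]big1 ?add0r; last by move=> g /andP[_ ->]; rewrite mulr0.
  by apply: eq_bigr => g /andP[_ ->]; rewrite mulr1.
have wv g : 0 <= w g * (v \in f g)%:R by rewrite mulr_ge0.
rewrite touchE // DE; split.
- by apply: sumr_ge0 => g _; rewrite mulr_ge0.
- by apply: ler_sum => g _; rewrite ler_wpM2l // ler_nat -/(I g); case: (I g).
rewrite -sumrB; apply: ler_sum => g _; rewrite -mulrBr ler_wpM2l // -/(I g).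
case: (I g) => [|k]; first by rewrite expr0n /= !subr0.
by rewrite /= -natr1; have := sqr_ge0 (k%:R : R); lra.
Qed.

(** The difference of square and size of an intersection counts its ordered pairs of distinct
    vertices, so the sum reduces to codegrees of pairs inside [f e]. *)
Lemma sum_overlap (U : {set V}) e : 0 < w e ->
  \sum_(v in U) \sum_(g | inside U g) w g * (v \in f g)%:R *
     (#|[set x in f e] :&: [set x in f g]|%:R ^+ 2 - #|[set x in f e] :&: [set x in f g]|%:R)
  <= r%:R ^+ 3 * (C / N).
Proof.
move=> we; pose I g := #|[set x in f e] :&: [set x in f g]|.
rewrite exchange_big /=.
have ce : #|[set x in f e]| = r by have [ue <-] := fU we; rewrite cardsE; apply/card_uniqP.
have IE g : (I g)%:R = \sum_(u in [set x in f e]) (u \in f g)%:R :> R.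
  rewrite /I -sum1_card natr_sum big_mkcond [RHS]big_mkcond; apply: eq_bigr => u _.
  by rewrite !inE; case: (u \in f e); case: (u \in f g).
have I2 g : (I g)%:R ^+ 2 - (I g)%:R = \sum_(u in [set x in f e])
   \sum_(u' in [set x in f e] | u' != u) ((u \in f g) && (u' \in f g))%:R :> R.
  rewrite expr2 {1}IE mulr_suml IE -sumrB; apply: eq_bigr => u ue.
  rewrite (bigD1 u) //=; have [ug|_] := boolP (u \in f g); last first.
    by rewrite !mul0r subrr big1.
  by rewrite mul1r addrAC subrr add0r.
have -> : \sum_(g | inside U g) \sum_(v in U) w g * (v \in f g)%:R * ((I g)%:R ^+ 2 - (I g)%:R) =
  r%:R * \sum_(u in [set x in f e]) \sum_(u' in [set x in f e] | u' != u) codeg_in U u u'.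
  rewrite mulr_sumr [RHS](eq_bigr (fun u => \sum_(g | inside U g) r%:R * (w g *
     \sum_(u' in [set x in f e] | u' != u) ((u \in f g) && (u' \in f g))%:R))); last first.
    move=> u _; rewrite -mulr_sumr exchange_big /=; congr (_ * _); apply: eq_bigr => g _.
    by rewrite -mulr_sumr.
  rewrite [RHS]exchange_big /=; apply: eq_bigr => g ig.
  rewrite -mulr_suml -mulr_sumr -mulrA -mulr_sumr -mulr_sumr -I2 [RHS]mulrCA.
  by apply: eq_wM => wg; rewrite sum_mem.
rewrite exprS -mulrA ler_wpM2l //.
apply: le_trans (_ : \sum_(u in [set x in f e]) r%:R * (C / N) <= _); last first.
  by rewrite sumr_const ce -[leLHS]mulr_natl expr2 mulrA.
have CN : 0 <= C / N.
  rewrite divr_ge0 //; case: (pickP [in [set x in f e]]) => [v _|H].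
    by apply: le_trans (wC v); apply: sumr_ge0 => g _; rewrite mulr_ge0.
  by move: ce; rewrite (eq_card0 H).
apply: ler_sum => u _; apply: le_trans (_ : \sum_(u' in [set x in f e] | u' != u) (C / N) <= _).
  by apply: ler_sum => u' /andP[_ uu']; rewrite codeg_in_le // eq_sym.
have -> : r%:R * (C / N) = \sum_(u' in [set x in f e]) C / N.
  by rewrite sumr_const ce mulr_natl.
rewrite big_mkcondr; apply: ler_sum => u' _.
by case: ifP.
Qed.

Definition err U (s : R) v := deg_in U v - s.
Definition potential (U : {set V}) (s : R) := \sum_(v in U) err U s v ^+ 2.
(** Half the first-order change of [potential] when [f e] is deleted and the target degree [s] drops
    by [g]. *)
Definition drift (U : {set V}) (s g : R) e := \sum_(v in U) err U s v * (g - touch U e v).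

Lemma touch_bound U e v : 0 <= C -> 0 < w e -> 0 <= touch U e v <= r%:R * (C / N).
Proof.
move=> C0 we; have [ue se] := fU we; have CN : 0 <= C / N by rewrite divr_ge0.
apply/andP; split; first by apply: sumr_ge0 => u _; apply: codeg_in_ge0.
apply: le_trans (_ : \sum_(u in [set x in f e] | u != v) C / N <= _).
  by apply: ler_sum => u /andP[_ uv]; apply: codeg_in_le.
have -> : r%:R * (C / N) = \sum_(u in [set x in f e]) C / N.
  by rewrite sumr_const mulr_natl cardsE (card_uniqP ue) se.
by rewrite big_mkcondr; apply: ler_sum => u _; case: ifP.
Qed.

(** The three error terms come from the vertices of [f e], which [drift] still counts, from edges
    meeting [f e] more than once, and from the squares of the individual changes. *)
Lemma potential_step (U : {set V}) e (s g X D : R) : D = r%:R ^+ 2 + r%:R * C -> 0 <= C -> 0 < N -> 0 < w e -> inside U e ->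
  0 <= g -> g <= r%:R ^+ 2 / N -> {in U, forall v, `|err U s v| <= X} ->
  potential (U :\: [set x in f e]) (s - g) <= potential U s + 2 * drift U s g e
    + (2 * r%:R * X * D + 2 * X * r%:R ^+ 3 * C + D ^+ 2) / N.
Proof.
move=> DE C0 N0 we ie g0 gr HX; set F := [set x in f e].
have FU : F \subset U by apply/subsetP => x; rewrite inE => /(allP ie).
have tb v : `|g - touch U e v| <= D / N.
  have /andP[t0 t1] := touch_bound U v C0 we.
  rewrite ler_norml DE mulrDl; have : 0 <= r%:R ^+ 2 / N by rewrite divr_ge0 ?exprn_ge0.
  have : 0 <= r%:R * (C / N) by rewrite mulr_ge0 // divr_ge0 // ltW.
  by lra.
have X0 v : v \in U -> 0 <= X by move=> /HX; apply: le_trans.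
pose O v := \sum_(g | inside U g) w g * (v \in f g)%:R *
     (#|[set x in f e] :&: [set x in f g]|%:R ^+ 2 - #|[set x in f e] :&: [set x in f g]|%:R).
have O0 v : 0 <= O v.
  apply: sumr_ge0 => g' _; rewrite mulr_ge0 // ?mulr_ge0 //.
  case: #|_| => [|k]; first by rewrite expr0n subrr.
  by rewrite subr_ge0 -natrX ler_nat expnS expn1 leq_pmulr.
have pt v : v \in U :\: F -> err (U :\: F) (s - g) v ^+ 2 <=
    err U s v ^+ 2 + 2 * (err U s v * (g - touch U e v)) + 2 * X * O v + (D / N) ^+ 2.
  rewrite !inE => /andP[ve vU]; have [d0 d1 d2] := deg_in_setD U ve we.
  set Dl := deg_in U v - _ in d0 d1 d2.
  have -> : err (U :\: F) (s - g) v = err U s v + (g - Dl) by rewrite /err /Dl; ring.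
  have /andP[t0 t1] := touch_bound U v C0 we.
  have gD : `|g - Dl| <= D / N.
    have e1 : D / N = r%:R ^+ 2 / N + r%:R * (C / N) by rewrite DE mulrDl mulrA.
    have : 0 <= r%:R ^+ 2 / N by rewrite divr_ge0 ?exprn_ge0.
    by rewrite ler_norml e1; lra.
  have h1 : (g - Dl) ^+ 2 <= (D / N) ^+ 2.
    by rewrite -real_normK ?num_real // lerXn2r ?nnegrE // (le_trans _ gD).
  have h2 : err U s v * (touch U e v - Dl) <= X * O v.
    apply: le_trans (ler_norm _) _; rewrite normrM ler_pM // ?HX //.
    by rewrite ger0_norm ?subr_ge0.
  by move: h1 h2; lra.
have sub (F' : V -> R) : (forall v, v \in U -> 0 <= F' v) ->
    \sum_(v in U :\: F) F' v <= \sum_(v in U) F' v.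
  move=> F0; rewrite [leRHS](big_setID F) /= (setIidPr FU) lerDr.
  by apply: sumr_ge0 => v vF; apply: F0; apply: (subsetP FU).
apply: le_trans (ler_sum _ pt) _; rewrite !big_split /=.
rewrite -[X in _ + X + _ + _]mulr_sumr -[X in _ + _ + X + _]mulr_sumr.
have b1 : \sum_(v in U :\: F) err U s v ^+ 2 <= potential U s.
  by apply: sub => v _; apply: sqr_ge0.
have b2 : \sum_(v in U :\: F) err U s v * (g - touch U e v) <= drift U s g e + r%:R * X * (D / N).
  rewrite /drift [X in _ <= X + _](big_setID F) /= (setIidPr FU) addrAC lerDr.
  have [ue se] := fU we.
  have -> : r%:R * X * (D / N) = \sum_(v in F) X * (D / N).
    by rewrite sumr_const -mulrA mulr_natl /F cardsE (card_uniqP ue) se.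
  rewrite -big_split sumr_ge0 // => v vF /=.
  have : `|err U s v * (g - touch U e v)| <= X * (D / N).
    by rewrite normrM ler_pM // HX // (subsetP FU).
  by rewrite ler_norml; lra.
have b3 : 2 * X * \sum_(v in U :\: F) O v <= 2 * X * (r%:R ^+ 3 * (C / N)).
  have [v0 v0F] : exists v, v \in F.
    have [ue se] := fU we; case: (f e) se @F {FU tb pt sub b1 b2 O O0} => // v s' _ F.
    by exists v; rewrite inE mem_head.
  rewrite ler_wpM2l ?mulr_ge0 // ?(X0 v0) ?(subsetP FU) //.
  by apply: le_trans (sum_overlap U we); apply: sub => v _; apply: O0.
have b4 : \sum_(v in U :\: F) (D / N) ^+ 2 <= D ^+ 2 / N.
  rewrite sumr_const -[leLHS]mulr_natl; apply: le_trans (_ : N * (D / N) ^+ 2 <= _).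
    by rewrite ler_wpM2r ?sqr_ge0 // ler_nat max_card.
  by rewrite le_eqVlt; apply/orP; left; apply/eqP; field; rewrite gt_eqF.
have -> : (2 * r%:R * X * D + 2 * X * r%:R ^+ 3 * C + D ^+ 2) / N =
  2 * (r%:R * X * (D / N)) + 2 * X * (r%:R ^+ 3 * (C / N)) + D ^+ 2 / N.
  by field; rewrite gt_eqF.
by move: b1 b2 b3 b4; lra.
Qed.

(** With S the sum of the errors, [r] times the weight inside U is [#|U| * s + S], and [g] is about
    [q * h * s * N / #|U|], so [g] times the weight is about [q * s ^+ 2]. This cancels the main
    part of the touched weight; what remains is quadratic in the errors or bounded by a multiple of
    X. *)
Lemma sum_drift (U : {set V}) (g X : R) (s := (#|U|%:R / N) ^+ q) (h := r%:R / N) :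
  0 <= C -> 0 < N -> h <= #|U|%:R / N ->
  g = s - (#|U|%:R / N - h) ^+ q -> {in U, forall v, `|err U s v| <= X} -> 0 <= X ->
  \sum_(e | inside U e) w e * drift U s g e <=
    q%:R ^+ 2 * r%:R * X + (q%:R + C) * potential U s.
Proof.
move=> C0 N0 hs gE HX X0; set Phi := potential U s.
pose x v := err U s v; pose S := \sum_(v in U) x v.
have h0 : 0 <= h by rewrite divr_ge0.
have s1 : #|U|%:R / N <= 1 by rewrite ler_pdivrMr // mul1r ler_nat max_card.
have UN0 : 0 <= #|U|%:R / N by rewrite divr_ge0.
have /andP[g0 g1] := exprB_le q h0 hs s1; rewrite -/s -gE in g0 g1.
have /andP[t1 t2] := exprB_taylor q h0 hs s1; rewrite -/s -gE in t1 t2.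
have sN0 : 0 <= s by rewrite exprn_ge0.
have sN1 : s <= 1 by rewrite exprn_ile1.
have Phi0 : 0 <= Phi by apply: sumr_ge0 => v _; apply: sqr_ge0.
have rW : r%:R * weight_in U = #|U|%:R * s + S.
  rewrite -sum_deg_in /S /x /err sumrB sumr_const -[s *+ _]mulr_natl; ring.
have E1 : \sum_(e | inside U e) w e * drift U s g e =
   g * weight_in U * S - \sum_(v in U) x v * \sum_(u in U | u != v) codeg_in U u v * deg_in U u.
  rewrite /drift; under eq_bigr do rewrite mulr_sumr.
  rewrite exchange_big /S mulr_sumr -sumrB; apply: eq_bigr => v vU /=.
  rewrite -sum_touch (eq_bigr (fun e => w e * (x v * g) - w e * touch U e v * x v)).
    by rewrite sumrB -!mulr_suml /weight_in; ring.
  by move=> e _; rewrite /x; ring.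
have E2 : \sum_(v in U) x v * \sum_(u in U | u != v) codeg_in U u v * deg_in U u =
  q%:R * s ^+ 2 * S + q%:R * s * Phi +
  \sum_(v in U) x v * \sum_(u in U | u != v) codeg_in U u v * x u.
  rewrite /Phi /potential /S !mulr_sumr -!big_split; apply: eq_bigr => v vU /=.
  rewrite (eq_bigr (fun u => s * codeg_in U u v + codeg_in U u v * x u)); last first.
    by move=> u _; rewrite /x /err; ring.
  by rewrite big_split /= -mulr_sumr sum_codeg_in // /x /err; ring.
have sumx : `|S| <= \sum_(v in U) `|x v| by apply: ler_norm_sum.
have xx : (\sum_(v in U) `|x v|) ^+ 2 <= N * Phi.
  apply: le_trans (sqr_sum_le U (fun v => `|x v|)) _.
  rewrite (eq_bigr (fun v => x v ^+ 2)); last by move=> v _; rewrite real_normK ?num_real.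
  by rewrite ler_wpM2r // ler_nat max_card.
have xN : \sum_(v in U) `|x v| <= N * X.
  apply: le_trans (_ : \sum_(v in U) X <= _); first exact: ler_sum.
  by rewrite sumr_const -[leLHS]mulr_natl ler_wpM2r // ler_nat max_card.
(* Small codegrees are needed here: they bound the quadratic form by [C / N] times the square of the
   sum of the [|x v|]. *)
have E3 : - \sum_(v in U) x v * \sum_(u in U | u != v) codeg_in U u v * x u <= C * Phi.
  rewrite -sumrN; apply: le_trans (_ : C / N * (\sum_(v in U) `|x v|) ^+ 2 <= _); last first.
    rewrite -mulrA ler_wpM2l // mulrC ler_pdivrMr //; lra.
  rewrite expr2 mulrA mulr_sumr; apply: ler_sum => v _.
  rewrite -mulrN mulrC; apply: le_trans (ler_norm _) _; rewrite normrM ler_wpM2r //.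
  rewrite normrN; apply: le_trans (ler_norm_sum _ _ _) _.
  rewrite mulr_sumr big_mkcondr; apply: ler_sum => u _; case: ifP => uv; last first.
    by rewrite mulr_ge0 // divr_ge0.
  by rewrite normrM ler_wpM2r // ger0_norm ?codeg_in_ge0 // codeg_in_le.
have SX : `|S| <= N * X by apply: le_trans sumx xN.
have S2 : S ^+ 2 <= N * Phi.
  apply: le_trans xx; rewrite -real_normK ?num_real // lerXn2r ?nnegrE //.
  by apply: le_trans sumx.
have Nh : N * h = r%:R by rewrite /h; field; rewrite gt_eqF.
have r0 : 0 < r%:R :> R by [].
have E4 : g * weight_in U * S - q%:R * s ^+ 2 * S <= q%:R ^+ 2 * r%:R * X + q%:R * Phi.
  have -> : g * weight_in U = (g * (#|U|%:R / N) / h) * s + g * S / r%:R.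
    apply: (@mulfI _ r%:R); first by rewrite gt_eqF.
    rewrite mulrCA rW /h; field; rewrite !gt_eqF //.
    by rewrite addrC natr1.
  have hp : 0 < h by rewrite divr_gt0.
  have a1 : `|g * (#|U|%:R / N) / h - q%:R * s| <= q%:R ^+ 2 * h.
    rewrite -(ler_pM2r hp) -[X in _ * X <= _](gtr0_norm hp) -normrM mulrBl divfK ?gt_eqF //.
    by rewrite ler_norml; lra.
  have a2 : (g * (#|U|%:R / N) / h - q%:R * s) * s * S <= q%:R ^+ 2 * h * (N * X).
    apply: le_trans (ler_norm _) _; rewrite normrM ler_pM // normrM.
    by rewrite (ger0_norm sN0); apply: le_trans a1; rewrite ler_piMr.
  have a3 : g * S / r%:R * S <= q%:R * Phi.
    have -> : g * S / r%:R * S = g / r%:R * S ^+ 2 by ring.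
    apply: le_trans (_ : q%:R * h / r%:R * (N * Phi) <= _).
      by rewrite ler_pM ?sqr_ge0 ?divr_ge0 // ler_pM2r ?invr_gt0.
    have -> : q%:R * h / r%:R * (N * Phi) = q%:R * Phi * (N * h / r%:R) by ring.
    by rewrite Nh divff ?mulr1 // gt_eqF.
  have -> : q%:R ^+ 2 * r%:R * X = q%:R ^+ 2 * h * (N * X) by rewrite -Nh; ring.
  apply: le_trans (lerD a2 a3); rewrite le_eqVlt; apply/orP; left; apply/eqP; ring.
have E5 : 0 <= q%:R * s * Phi by rewrite !mulr_ge0.
by rewrite E1 E2; move: E3 E4 E5; lra.
Qed.

End NibbleStep.

(** If U were a random set of density [u], an edge at [v] would keep its other [q] vertices with
    probability about [u ^+ q]; this is the target degree. Averaging with the weights [w] gives an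
    edge whose deletion multiplies the potential by at most [1 + O(1 / N)], up to an additive
    [O(1 / N)], and there are at most N deletions. *)
Lemma nibble (R : realType) (q : nat) (C om : R) : 0 <= C -> 0 < om -> om <= 1 ->
  exists delta n0 : R, 0 < delta /\
  forall (V E : finType) (f : E -> seq V) (w : E -> R),
  0 < #|V|%:R :> R -> n0 <= #|V|%:R -> (forall e, 0 <= w e) ->
  (forall e, 0 < w e -> uniq (f e) /\ size (f e) = q.+1) ->
  (forall v, wdeg f w v <= C) ->
  (forall u v, u != v -> wcodeg f w u v <= C / #|V|%:R) ->
  \sum_v (wdeg f w v - 1) ^+ 2 <= delta * #|V|%:R ->
  exists (es : seq E) (U : {set V}), [/\ all (fun e => 0 < w e) es,
    perm_eq (flatten (map f es) ++ enum U) (enum V) & #|U|%:R <= om * #|V|%:R].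
Proof.
move=> C0 om0 om1; pose r := q.+1.
pose X := C + 1; pose D := r%:R ^+ 2 + r%:R * C.
pose K := 2 * r%:R * X * D + 2 * X * r%:R ^+ 3 * C + D ^+ 2.
(* As long as [om * N < #|U|], the weight inside U is at least [om' * N]. *)
pose om' := om ^+ r / (2 * r%:R).
pose K1 := 2 * (q%:R + C) / om'; pose K2 := 2 * (q%:R ^+ 2 * r%:R * X) / om' + K.
(* [Lam] bounds the total growth. As [2 * b] is the square of [om ^+ r / 2], a potential below
   [2 * b * N] keeps the sum of the errors below half of the main term [om ^+ r * N]. *)
pose Lam := expR (K1 + 1); pose b := om ^+ (2 * r) / 8.
have r0 : 0 < r%:R :> R by [].
have q0 : 0 <= q%:R :> R by [].
have X0 : 0 <= X by rewrite /X; lra.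
have D0 : 0 <= D by rewrite /D addr_ge0 ?mulr_ge0 ?sqr_ge0.
have K0 : 0 <= K by rewrite /K !addr_ge0 ?mulr_ge0 ?exprn_ge0.
have om'0 : 0 < om' by rewrite divr_gt0 ?exprn_gt0 ?mulr_gt0.
have K10 : 0 <= K1 by rewrite divr_ge0 ?(ltW om'0) // mulr_ge0 // addr_ge0.
have K20 : 0 <= K2.
  by rewrite addr_ge0 // divr_ge0 ?(ltW om'0) // !mulr_ge0 // exprn_ge0.
have L0 : 0 < Lam by apply: expR_gt0.
have b0 : 0 < b by rewrite divr_gt0 ?exprn_gt0.
exists (b / Lam), (K2 * Lam / b); split; first by rewrite divr_gt0.
move=> V E f w N0 n0N w0 fU wC cC Phi0; set N : R := #|V|%:R in N0 n0N cC Phi0 *.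
pose sg (U : {set V}) : R := (#|U|%:R / N) ^+ q.
(* The bound never drops below [K2], so the extra 1 in [rho] absorbs the additive error [K2 / N] of
   each step. *)
pose rho := 1 + (K1 + 1) / N; pose B0 := b / Lam * N + K2.
have rho1 : 1 <= rho by rewrite lerDl divr_ge0 // ?(ltW N0) //; lra.
have B0K : K2 <= B0 by rewrite lerDr mulr_ge0 ?(ltW N0) // divr_ge0 ?ltW.
have claim j : (exists (es : seq E) (U : {set V}), [/\ all (fun e => 0 < w e) es,
      perm_eq (flatten (map f es) ++ enum U) (enum V) & #|U|%:R <= om * N]) \/
    (exists (es : seq E) (U : {set V}), [/\ all (fun e => 0 < w e) es,
      perm_eq (flatten (map f es) ++ enum U) (enum V), (#|U| + r * j = #|V|)%N &
      potential f w U (sg U) <= B0 * rho ^+ j]); last first.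
  case: (claim #|V|.+1) => // -[es [U [_ _ szU _]]]; exfalso.
  have h : (#|V|.+1 <= r * #|V|.+1)%N by rewrite leq_pmull.
  by have := leq_addl #|U| (r * #|V|.+1); rewrite szU => /(leq_trans h); rewrite ltnn.
elim: j => [|j [IH|[es [U [pes pU szU pot]]]]]; [right|by left|].
  exists [::], setT; split=> //=; first by rewrite enum_setT enumT.
    by rewrite cardsT muln0 addn0.
  rewrite expr0 mulr1; apply: le_trans (_ : b / Lam * N <= _); last by rewrite lerDl.
  apply: le_trans Phi0; rewrite /potential /sg cardsT divff ?gt_eqF // expr1n.
  rewrite le_eqVlt; apply/orP; left; apply/eqP; apply: eq_big => [v|v _]; first by rewrite inE.
  rewrite /err; congr ((_ - _) ^+ 2); apply: eq_bigl => e.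
  by apply/allP => x _; rewrite inE.
have [small|large] := lerP #|U|%:R (om * N); first by left; exists es, U.
right; set u : R := #|U|%:R / N.
have u1 : u <= 1 by rewrite ler_pdivrMr // mul1r ler_nat max_card.
have omu : om <= u by rewrite ler_pdivlMr // ltW.
have u0 : 0 <= u by lra.
have s0 : 0 <= sg U by rewrite exprn_ge0.
have s1 : sg U <= 1 by rewrite exprn_ile1.
have somq : om ^+ q <= sg U by rewrite lerXn2r ?nnegrE // ltW.
have rhoj : rho ^+ j <= Lam.
  apply: le_trans (_ : expR ((K1 + 1) / N) ^+ j <= _).
    by rewrite lerXn2r ?nnegrE ?expR_ge0 ?expR_ge1Dx //; lra.
  rewrite -expRM_natl ler_expR.
  have jN : j%:R <= N :> R.
    rewrite ler_nat -szU; apply: leq_trans (leq_addl _ _); exact: leq_pmull.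
  rewrite mulrA ler_pdivrMr // mulrC ler_wpM2l //; lra.
have Phib : potential f w U (sg U) <= 2 * b * N.
  apply: le_trans pot _; apply: le_trans (_ : B0 * Lam <= _).
    by rewrite ler_wpM2l //; lra.
  rewrite /B0 mulrDl mulrAC divfK ?gt_eqF //.
  by move: n0N; rewrite ler_pdivrMr //; lra.
set Phi := potential f w U (sg U) in pot Phib.
have HX : {in U, forall v, `|err f w U (sg U) v| <= X}.
  move=> v _; rewrite /err ler_norml /X.
  have := deg_in_ge0 f w0 U v; have := deg_in_le w0 wC U v; lra.
have P0 : 0 <= Phi by apply: sumr_ge0 => v _; apply: sqr_ge0.
pose S := \sum_(v in U) err f w U (sg U) v.
have S2 : S ^+ 2 <= N * Phi.
  apply: le_trans (sqr_sum_le _ _) _; rewrite ler_wpM2r //.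
  by rewrite ler_nat max_card.
have Sb : `|S| <= om ^+ r / 2 * N.
  have t0 : 0 <= om ^+ r / 2 * N.
    by rewrite mulr_ge0 ?(ltW N0) // divr_ge0 // exprn_ge0 // ltW.
  rewrite -(@ler_pXn2r _ 2) ?nnegrE //.
  rewrite real_normK ?num_real //; apply: le_trans S2 _.
  apply: le_trans (_ : N * (2 * b * N) <= _); first by rewrite ler_wpM2l // ltW.
  by rewrite le_eqVlt; apply/orP; left; apply/eqP; rewrite /b mulnC exprM; field.
have rW : r%:R * weight_in f w U = #|U|%:R * sg U + S.
  rewrite -(sum_deg_in w0 fU) /S /err sumrB sumr_const -[sg U *+ _]mulr_natl; ring.
have Wb : om' * N <= weight_in f w U.
  rewrite -(ler_pM2l r0) rW.
  have -> : r%:R * (om' * N) = om ^+ r / 2 * N by rewrite /om'; field; rewrite gt_eqF.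
  have : om * N * om ^+ q <= #|U|%:R * sg U.
    by rewrite ler_pM ?exprn_ge0 ?mulr_ge0 ?(ltW om0) ?(ltW N0) // ltW.
  have -> : om * N * om ^+ q = om ^+ r * N by rewrite /r exprS; ring.
  by move: Sb; rewrite ler_norml; lra.
have W0 : 0 < weight_in f w U by apply: lt_le_trans Wb; rewrite mulr_gt0.
have [rU|Ur] := leqP r #|U|; last first.
  exfalso; have : weight_in f w U = 0; last by move=> h; rewrite h ltxx in W0.
  apply: big1 => e /allP ie; have := w0 e; rewrite le_eqVlt => /orP[/eqP//|we].
  have [ue se] := fU e we; move: Ur; rewrite /r -se ltnNge -(card_uniqP ue) => /negP[].
  by apply/subset_leq_card/subsetP => x /ie.
pose h : R := r%:R / N; pose g := sg U - (u - h) ^+ q.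
have hu : h <= u by rewrite ler_pM2r ?invr_gt0 // ler_nat.
have h0 : 0 <= h by rewrite divr_ge0 // ltW.
have /andP[g0 g1] : 0 <= g <= q%:R * h := exprB_le q h0 hu u1.
have drift_le := sum_drift w0 fU cC C0 N0 hu (erefl g) HX X0.
have [e [ie we Fe]] := weighted_min w0 W0 drift_le.
have gr : g <= r%:R ^+ 2 / N.
  apply: le_trans g1 _; rewrite /h expr2 mulrA ler_pM2r ?invr_gt0 // ler_pM2r //.
  by rewrite ler_nat /r.
have := potential_step w0 fU wC cC (erefl D) C0 N0 we ie g0 gr HX.
rewrite -/K -/Phi => step.
have [ue se] := fU e we; set F := [set x in f e] in step.
have FU : F \subset U by apply/subsetP => x; rewrite inE => /(allP ie).
have cF : #|F| = r by rewrite cardsE (card_uniqP ue) se.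
have cUF : #|U :\: F| = (#|U| - r)%N by rewrite cardsD (setIidPr FU) cF.
exists (e :: es), (U :\: F); split.
- by rewrite /= we.
- apply: perm_trans pU; rewrite /= -catA perm_catC -catA perm_cat2l perm_sym.
  apply: uniq_perm; rewrite ?enum_uniq //.
    rewrite cat_uniq enum_uniq ue andbT /=; apply/hasPn => x xe.
    by rewrite mem_enum !inE xe.
  move=> x; rewrite mem_cat !mem_enum !inE; case: (boolP (x \in f e)) => [xe|_] /=.
    by rewrite ?orbT (allP ie).
  by rewrite ?orbF ?andbT.
- by rewrite cUF mulnS addnA subnK.
have sE : sg (U :\: F) = sg U - g.
  by rewrite /g /sg -/u opprB addrC subrK cUF natrB // mulrBl.
rewrite sE; apply: le_trans step _.
have dr : drift f w U (sg U) g e <= (q%:R ^+ 2 * r%:R * X + (q%:R + C) * Phi) / om' / N.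
  apply: le_trans Fe _; rewrite -[leRHS]mulrA -(invfM om' N) ler_wpM2l //.
    by rewrite addr_ge0 ?mulr_ge0 ?addr_ge0 ?exprn_ge0.
  by rewrite -/(weight_in f w U) lef_pV2 ?posrE ?(mulr_gt0 om'0 N0).
apply: le_trans (_ : Phi + (K1 * Phi + K2) / N <= _).
  have -> : (K1 * Phi + K2) / N =
     2 * ((q%:R ^+ 2 * r%:R * X + (q%:R + C) * Phi) / om' / N) + K / N.
    by rewrite /K1 /K2; ring.
  by move: dr; lra.
rewrite exprS; set B := B0 * rho ^+ j in pot.
have -> : B0 * (rho * rho ^+ j) = B + (K1 * B + B) / N by rewrite /B /rho; ring.
have BK : K2 <= B.
  by apply: (le_trans B0K); rewrite ler_peMr ?exprn_ege1 // (le_trans K20 B0K).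
apply: lerD => //; rewrite ler_pM2r ?invr_gt0 // lerD // ler_wpM2l //.
Qed.

(** * Nearly regular fractional packings *)

Section Distributions.

Variables (R : realType) (E : finType) (P : pred E).
Implicit Types (p : E -> R) (b t : R).

(** The bound [b] on single probabilities is what later limits degrees and codegrees; it survives
    mixing. *)
Definition distribution b p :=
  [/\ forall e, 0 <= p e <= b, \sum_e p e = 1 & forall e, 0 < p e -> P e].

Definition mix t p p' e := (1 - t) * p e + t * p' e.

Lemma sum_mix t p p' (F : E -> R) :
  \sum_e mix t p p' e * F e = (1 - t) * (\sum_e p e * F e) + t * \sum_e p' e * F e.
Proof.
by rewrite !mulr_sumr -big_split; apply: eq_bigr => e _ /=; rewrite /mix; ring.
Qed.

Lemma distribution_mix b t p p' : 0 <= t -> t <= 1 ->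
  distribution b p -> distribution b p' -> distribution b (mix t p p').
Proof.
move=> t0 t1 [p0 p1 pP] [p'0 p'1 p'P].
have t1' : 0 <= 1 - t by lra.
split=> [e||e].
- have /andP[a1 a2] := p0 e; have /andP[b1 b2] := p'0 e.
  rewrite /mix addr_ge0 ?mulr_ge0 //=.
  have : (1 - t) * p e <= (1 - t) * b by rewrite ler_wpM2l.
  have : t * p' e <= t * b by rewrite ler_wpM2l.
  by lra.
- have := sum_mix t p p' (fun=> 1).
  under eq_bigr do rewrite mulr1; under [X in (1 - t) * X]eq_bigr do rewrite mulr1.
  under [X in t * X]eq_bigr do rewrite mulr1.
  by move=> ->; rewrite p1 p'1; lra.
have [/pP//|pe] := ltP 0 (p e); have [/p'P//|p'e] := ltP 0 (p' e).
rewrite ltNge /mix => /negP[]; have : (1 - t) * p e <= 0 by rewrite mulr_ge0_le0.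
have : t * p' e <= 0 by rewrite mulr_ge0_le0.
by lra.
Qed.

Definition uniform (X : {set E}) e : R := if e \in X then #|X|%:R^-1 else 0.

Lemma sum_uniform (X : {set E}) (F : E -> R) :
  \sum_e uniform X e * F e = (\sum_(e in X) F e) / #|X|%:R.
Proof.
rewrite mulr_suml [RHS]big_mkcond; apply: eq_bigr => e _; rewrite /uniform.
by case: ifP => _; rewrite ?mul0r // mulrC.
Qed.

Lemma sum_uniform_ge (X : {set E}) (F : E -> R) (c : R) : (0 < #|X|)%N ->
  {in X, forall e, c <= F e} -> c <= \sum_e uniform X e * F e.
Proof.
move=> X0 cF; rewrite sum_uniform ler_pdivlMr ?ltr0n // mulrC -sumr_card.
exact: ler_sum.
Qed.

Lemma distribution_uniform b z (X : {set E}) : 0 < z -> z <= #|X|%:R -> z^-1 <= b ->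
  {in X, forall e, P e} -> distribution b (uniform X).
Proof.
move=> z0 zX zb XP; have X0 : 0 < #|X|%:R :> R by apply: lt_le_trans zX.
have b0 : #|X|%:R^-1 <= b by apply: le_trans zb; rewrite lef_pV2.
split=> [e||e]; rewrite /uniform.
- case: ifP => _; first by rewrite invr_ge0 ler0n.
  by rewrite lexx (le_trans _ b0) // invr_ge0.
- by rewrite -big_mkcond sumr_const -[LHS]mulr_natl divff // gt_eqF.
by case: ifP => [/XP|_]; rewrite ?ltxx.
Qed.

Variables (V : finType) (f : E -> seq V).

Lemma sum_wdeg p (y : V -> R) :
  \sum_v y v * wdeg f p v = \sum_e p e * \sum_v y v * (v \in f e)%:R.
Proof.
rewrite /wdeg; under eq_bigr do rewrite mulr_sumr.
rewrite exchange_big; apply: eq_bigr => e _; rewrite mulr_sumr.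
by apply: eq_bigr => v _; rewrite mulrCA.
Qed.

Lemma wdeg_mix t p p' v : wdeg f (mix t p p') v = (1 - t) * wdeg f p v + t * wdeg f p' v.
Proof. exact: sum_mix. Qed.

(* Frank-Wolfe iteration for the convex function [\sum_v (N/r deg v - 1)^2],
   whose gradient is handed to [lowcost] as the cost function [y]. *)
Lemma near_regular b (r : nat) (C0 delta : R) : (0 < r)%N -> 0 < #|V|%:R :> R ->
  0 < delta -> 0 <= C0 ->
  (forall e, P e -> uniq (f e) /\ size (f e) = r) ->
  (forall p, distribution b p -> forall v, wdeg f p v <= C0 / #|V|%:R) ->
  (forall y : V -> R, exists2 p, distribution b p &
     \sum_v y v * wdeg f p v <= r%:R / #|V|%:R * \sum_v y v) ->
  exists2 p, distribution b p &
    \sum_v (#|V|%:R / r%:R * wdeg f p v - 1) ^+ 2 <= delta * #|V|%:R.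
Proof.
move=> r0 N0 d0 C00 fP degC lowcost; set N : R := #|V|%:R in N0 degC lowcost *.
have rR : 0 < r%:R :> R by rewrite ltr0n.
pose D p v := N / r%:R * wdeg f p v; pose c := C0 / r%:R.
have c0 : 0 <= c by rewrite divr_ge0.
have Dc p v : distribution b p -> 0 <= D p v <= c.
  move=> dp; have [p0 _ _] := dp; apply/andP; split.
    rewrite mulr_ge0 // ?divr_ge0 ?(ltW N0) //; apply: sumr_ge0 => e _.
    by rewrite mulr_ge0 //; have /andP[] := p0 e.
  apply: le_trans (_ : N / r%:R * (C0 / N) <= _).
    by rewrite ler_wpM2l ?degC // divr_ge0 // ltW.
  by rewrite le_eqVlt; apply/orP; left; apply/eqP; rewrite /c; field; rewrite !gt_eqF.
have sumD p : distribution b p -> \sum_v D p v = N.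
  move=> [p0 p1 pP]; rewrite -mulr_sumr.
  have := sum_wdeg p (fun=> 1); under eq_bigr do rewrite mul1r.
  move=> ->; rewrite (eq_bigr (fun e => p e * r%:R)).
    by rewrite -mulr_suml p1 mul1r divfK // gt_eqF.
  move=> e _; have /andP[] := p0 e; rewrite le_eqVlt => /orP[/eqP<- _|/pP/fP[ue se] _].
    by rewrite !mul0r.
  congr (_ * _); under eq_bigr do rewrite mul1r.
  rewrite -natr_sum -big_mkcond sum1_card -se -(card_uniqP ue) //.
pose F p := \sum_v (D p v - 1) ^+ 2.
(* A move of length [h] lowers F by [2 * h * F p] up to an error [h ^+ 2 * c ^+ 2 * N]; while F
   exceeds [delta * N], at least half of the decrease remains. *)
pose h := Num.min 1 (delta / (c ^+ 2 + 1)).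
have c1 : 0 < c ^+ 2 + 1 by rewrite ltr_wpDl ?sqr_ge0.
have h0 : 0 < h by rewrite lt_min ltr01 divr_gt0.
have h1 : h <= 1 by rewrite ge_min lexx.
have hc : h * c ^+ 2 <= delta.
  have : h <= delta / (c ^+ 2 + 1) by rewrite ge_min lexx orbT.
  by rewrite ler_pdivlMr // mulrDr; lra.
have step p : distribution b p -> delta * N < F p ->
    exists2 p', distribution b p' & F p' <= F p - h * delta * N.
  move=> dp Fp; have [p' dp' low] := lowcost (fun v => D p v - 1).
  exists (mix h p p'); first exact: distribution_mix (ltW h0) h1 dp dp'.
  have E1 v : D (mix h p p') v - 1 = (D p v - 1) + h * (D p' v - D p v).
    by rewrite /D wdeg_mix; ring.
  have E2 : F (mix h p p') = F p + 2 * h * \sum_v (D p v - 1) * (D p' v - D p v)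
      + h ^+ 2 * \sum_v (D p' v - D p v) ^+ 2.
    rewrite /F !mulr_sumr -!big_split; apply: eq_bigr => v _ /=.
    by rewrite E1; ring.
  have E3 : \sum_v (D p v - 1) * D p' v <= 0.
    have -> : \sum_v (D p v - 1) * D p' v = N / r%:R * \sum_v (D p v - 1) * wdeg f p' v.
      by rewrite mulr_sumr; apply: eq_bigr => v _; rewrite /D; ring.
    rewrite mulr_ge0_le0 ?divr_ge0 ?(ltW N0) //; apply: le_trans low _.
    by rewrite sumrB sumD // sumr_const -/N subrr mulr0.
  have E4 : \sum_v (D p v - 1) * D p v = F p.
    apply/eqP; rewrite -subr_eq0 -sumrB (eq_bigr (fun v => D p v - 1)).
      by rewrite sumrB sumD // sumr_const subrr.
    by move=> v _; ring.
  have E5 : \sum_v (D p' v - D p v) ^+ 2 <= c ^+ 2 * N.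
    have -> : c ^+ 2 * N = \sum_(v : V) c ^+ 2 by rewrite sumr_const mulr_natr.
    apply: ler_sum => v _; have /andP[a1 a2] := Dc _ v dp; have /andP[b1 b2] := Dc _ v dp'.
    by rewrite -real_normK ?num_real // lerXn2r ?nnegrE // ler_norml; lra.
  rewrite E2 (eq_bigr (fun v => (D p v - 1) * D p' v - (D p v - 1) * D p v)); last first.
    by move=> v _; rewrite mulrBr.
  rewrite sumrB E4.
  have e1 : 2 * h * (\sum_v (D p v - 1) * D p' v - F p) <= 2 * h * (0 - F p).
    by rewrite ler_wpM2l ?lerB // mulr_ge0 // ltW.
  have e2 : h ^+ 2 * \sum_v (D p' v - D p v) ^+ 2 <= h * (delta * N).
    apply: le_trans (_ : h * (h * c ^+ 2 * N) <= _).
      have -> : h * (h * c ^+ 2 * N) = h ^+ 2 * (c ^+ 2 * N) by ring.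
      by rewrite ler_wpM2l ?sqr_ge0.
    by rewrite ler_wpM2l ?(ltW h0) // ler_wpM2r ?(ltW N0).
  have e3 : h * (delta * N) <= h * F p by rewrite ler_wpM2l ?(ltW h0) ?(ltW Fp).
  by move: e1 e2 e3; lra.
have iter k : (exists2 p, distribution b p & F p <= delta * N) \/
    (exists2 p, distribution b p & F p <= (c + 1) ^+ 2 * N - k%:R * (h * delta * N)).
  elim: k => [|k [IH|[p dp Fp]]]; [right|by left|].
    have [p dp _] := lowcost (fun=> 0); exists p => //.
    rewrite mul0r subr0 mulr_natr -sumr_const; apply: ler_sum => v _.
    have /andP[a1 a2] := Dc _ v dp.
    by rewrite -real_normK ?num_real // lerXn2r ?nnegrE ?addr_ge0 // ler_norml; lra.
  have [small|large] := leP (F p) (delta * N); first by left; exists p.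
  have [p' dp' Fp'] := step p dp large; right; exists p' => //.
  by rewrite -natr1; move: Fp Fp'; lra.
have z0 : 0 < h * delta * N by rewrite !mulr_gt0.
pose k := Num.bound ((c + 1) ^+ 2 * N / (h * delta * N)).
case: (iter k) => [|[p dp Fp]]; first by [].
exists p => //; apply: (le_trans Fp); apply: le_trans (_ : 0 <= _); last by rewrite mulr_ge0 // ltW.
rewrite subr_le0 -ler_pdivrMr // ltW //; apply: le_lt_trans (archi_boundP _).
  exact: lexx.
by rewrite divr_ge0 ?(ltW z0) // mulr_ge0 ?sqr_ge0 ?(ltW N0).
Qed.

End Distributions.

(** * Tuples through one or two given vertices *)

Section TupleCounts.

Variables (V : finType).

Lemma card_tuple_mem n (v : V) :
  (#|V| * #|[set s : n.-tuple V | v \in val s]| <= n * #|V| ^ n)%N.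
Proof.
elim: n => [|n IH].
  by rewrite (_ : [set _ | _] = set0) ?cards0 ?muln0 //; apply/setP => s; rewrite !inE tuple0.
rewrite (@card_tuple_cons V n (fun s => v \in s)) big_distrr /=.
apply: leq_trans (_ : \sum_(u : V) ((u == v) * (#|V| * #|V| ^ n) + n * #|V| ^ n) <= _)%N.
  apply: leq_sum => u _; have [->|uv] := eqVneq u v.
    apply: leq_trans (leq_addr _ _); rewrite mul1n leq_mul2l; apply/orP; right.
    by rewrite -card_tuple max_card.
  rewrite add0n; apply: leq_trans IH; rewrite leq_mul2l; apply/orP; right.
  by apply/subset_leq_card/subsetP => s; rewrite !inE eq_sym (negPf uv).
rewrite big_split /= sum_nat_const -big_distrl /= (bigD1 v) //= eqxx big1 ?addn0; last first.
  by move=> u /negPf->.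
by rewrite mul1n -expnS mulnCA -expnS mulSn.
Qed.

Lemma card_tuple_mem2 n (u v : V) : u != v ->
  (#|V| ^ 2 * #|[set s : n.-tuple V | (u \in val s) && (v \in val s)]|
    <= n ^ 2 * #|V| ^ n)%N.
Proof.
move=> uv; elim: n => [|n IH].
  by rewrite (_ : [set _ | _] = set0) ?cards0 ?muln0 //; apply/setP => s; rewrite !inE tuple0.
rewrite (@card_tuple_cons V n (fun s => (u \in s) && (v \in s))) big_distrr /=.
pose M := (n * #|V| ^ n.+1)%N.
apply: leq_trans (_ : \sum_(x : V) ((x == u) * M + (x == v) * M + n ^ 2 * #|V| ^ n) <= _)%N.
  have part x : (#|V| ^ 2 * #|[set s : n.-tuple V | x \in val s]| <= M)%N.
    by rewrite /M !expnS expn0 muln1 -mulnA [leqRHS]mulnCA leq_mul2l card_tuple_mem orbT.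
  apply: leq_sum => x _; have [xu|xu] := eqVneq x u.
    rewrite -addnA; apply: leq_trans (leq_addr _ _); rewrite mul1n; apply: leq_trans (part v).
    by rewrite leq_mul2l; apply/orP; right; apply/subset_leq_card/subsetP => s; rewrite !inE => /andP[_];
       rewrite xu eq_sym (negPf uv).
  rewrite add0n; have [xv|xv] := eqVneq x v.
    apply: leq_trans (leq_addr _ _); rewrite mul1n; apply: leq_trans (part u).
    by rewrite leq_mul2l; apply/orP; right; apply/subset_leq_card/subsetP => s; rewrite !inE => /andP[];
       rewrite xv (negPf uv).
  rewrite add0n; apply: leq_trans IH; rewrite leq_mul2l; apply/orP; right.
  by apply/subset_leq_card/subsetP => s; rewrite !inE ![_ == x]eq_sym (negPf xu) (negPf xv).
have one x : (\sum_(y : V) (y == x) = 1)%N.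
  by rewrite (bigD1 x) //= eqxx big1 // => y /negPf->.
rewrite !big_split /= sum_nat_const -!big_distrl /= !one !mul1n.
have -> : (#|V| * (n ^ 2 * #|V| ^ n) = n ^ 2 * #|V| ^ n.+1)%N by rewrite mulnCA -expnS.
rewrite /M -!mulnDl leq_mul2r; apply/orP; right; rewrite !expnS expn0 !muln1 mulnS mulSn; lia.
Qed.

End TupleCounts.

Section TupleDegrees.

Variables (R : realType) (V : finType) (r : nat) (P : pred (r.-tuple V)) (C : R).
Local Notation N := (#|V|%:R : R).

(** Only about [r / N] of all tuples contain a given vertex and [r ^+ 2 / N ^+ 2] a given pair, and
    no tuple has more than [C] times its uniform share. *)
Lemma distribution_wdeg p : 0 < N -> 0 <= C -> distribution P (C / N ^+ r) p ->
  (forall v, wdeg val p v <= C * r%:R / N) /\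
  (forall u v, u != v -> wcodeg val p u v <= C * r%:R ^+ 2 / N ^+ 2).
Proof.
move=> N0 C0 [p0 _ _].
have gen (X : {set r.-tuple V}) k : (#|V| ^ k * #|X| <= r ^ k * #|V| ^ r)%N ->
    \sum_(e in X) p e <= C * r%:R ^+ k / N ^+ k.
  move=> cX; apply: le_trans (_ : #|X|%:R * (C / N ^+ r) <= _).
    by rewrite -sumr_card; apply: ler_sum => e _; have /andP[] := p0 e.
  have Nk : 0 < N ^+ k by rewrite exprn_gt0.
  have Nr : 0 < N ^+ r by rewrite exprn_gt0.
  rewrite ler_pdivlMr // mulrC mulrA mulrA ler_pdivrMr //.
  have : N ^+ k * #|X|%:R <= r%:R ^+ k * N ^+ r by rewrite -!natrX -!natrM ler_nat.
  by move=> h; rewrite mulrA [leLHS]mulrC -[leRHS]mulrA ler_wpM2l.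
split=> [v|u v uv].
  have := gen [set s : r.-tuple V | v \in val s] 1%N; rewrite !expr1 !expn1 => /(_ (card_tuple_mem _ _)).
  apply: le_trans; rewrite /wdeg [leRHS]big_mkcond; apply: ler_sum => e _; rewrite inE.
  by case: (v \in val e); rewrite ?mulr1 ?mulr0.
have := gen [set s : r.-tuple V | (u \in val s) && (v \in val s)] 2%N (card_tuple_mem2 _ uv).
apply: le_trans; rewrite /wcodeg [leRHS]big_mkcond; apply: ler_sum => e _; rewrite inE.
by case: ifP; rewrite ?mulr1 ?mulr0.
Qed.

End TupleDegrees.

Lemma nat_ceil (R : realType) (x : R) : 0 <= x ->
  exists2 k : nat, x <= k%:R & k%:R < x + 1.
Proof.
move=> x0; have ex : exists k, x <= k%:R.
  by exists (Num.bound x); apply/ltW/archi_boundP.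
case: (ex_minnP ex) => k xk mink; exists k => //.
case: k xk mink => [|k] _ mink; first by lra.
by rewrite -natr1 ltrD2r ltNge; apply/negP => /mink; rewrite ltnn.
Qed.

(** * Vertices ranked by cost *)

Section Ranks.

Variables (R : realType) (V : finType) (y : V -> R).

Definition by_cost := sort (fun u v => y u <= y v) (enum V).
(** The rank bound is real because the thresholds, such as [(j - al) * a], are. *)
Definition low (x : R) : {set V} := [set v | (index v by_cost)%:R < x].

Lemma mem_by_cost v : v \in by_cost.
Proof. by rewrite mem_sort mem_enum. Qed.

Lemma low_take k : low k%:R = [set v in take k by_cost].
Proof. by apply/setP => v; rewrite !inE ltr_nat in_take ?mem_by_cost. Qed.

Lemma card_low_nat k : #|low k%:R| = minn k #|V|.
Proof.
have us : uniq by_cost by rewrite sort_uniq enum_uniq.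
rewrite low_take cardsE (card_uniqP _) ?take_uniq // size_take size_sort -cardE.
by rewrite /minn.
Qed.

Lemma sub_low x x' : x <= x' -> low x \subset low x'.
Proof. by move=> xx; apply/subsetP => v; rewrite !inE => /lt_le_trans; apply. Qed.

Lemma card_low x : x <= #|V|%:R -> x <= #|low x|%:R.
Proof.
move=> xV; have [x0|/ltW x0] := lerP 0 x; last by apply: le_trans x0 _.
have [k xk kx] := nat_ceil x0.
have kV : (k <= #|V|)%N by rewrite -ltnS -(ltr_nat R) -natr1; lra.
apply: (le_trans xk); rewrite -{1}(minn_idPl kV) -card_low_nat ler_nat.
apply/subset_leq_card/subsetP => v; rewrite !inE ltr_nat => vk.
have : (index v by_cost).+1%:R <= k%:R :> R by rewrite ler_nat.
by rewrite -natr1; lra.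
Qed.

Lemma card_low_le x : 0 <= x -> #|low x|%:R <= x + 1.
Proof.
move=> x0; have [k xk kx] := nat_ceil x0; apply: le_trans (ltW kx).
rewrite ler_nat; apply: leq_trans (subset_leq_card (sub_low xk)) _.
by rewrite card_low_nat geq_minl.
Qed.

(** Summation by parts: the partial sums of [c] are nonnegative, so raising the costs of a prefix to
    the cost of the next vertex only increases the sum. *)
Lemma abel_le (c : V -> R) (s : seq V) (z : R) :
  pairwise (fun u v => y u <= y v) s ->
  (forall k, (k <= size s)%N -> 0 <= \sum_(v <- take k s) c v) ->
  all (fun v => y v <= z) s ->
  \sum_(v <- s) y v * c v <= z * \sum_(v <- s) c v.
Proof.
elim/last_ind: s z => [|s x IH] z; first by move=> _ _ _; rewrite !big_nil mulr0.
rewrite pairwise_rcons all_rcons => /andP[sx ps] pre /andP[xz _].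
have pos : 0 <= \sum_(v <- rcons s x) c v.
  by have := pre _ (leqnn _); rewrite take_size.
apply: le_trans (_ : y x * \sum_(v <- rcons s x) c v <= _); last by rewrite ler_wpM2r.
rewrite -cats1 !big_cat !big_seq1 /= mulrDr lerD2r; apply: IH => // k ks.
by have := pre k; rewrite size_rcons -cats1 takel_cat // => /(_ (leqW ks)).
Qed.

Lemma cost_le0 (c : V -> R) :
  (forall k, (k <= #|V|)%N -> 0 <= \sum_(v in low k%:R) c v) ->
  \sum_v c v = 0 -> \sum_v y v * c v <= 0.
Proof.
move=> pre tot; have us : uniq by_cost by rewrite sort_uniq enum_uniq.
have srt F : \sum_v F v = \sum_(v <- by_cost) F v :> R.
  transitivity (\sum_(v <- enum V) F v); first by rewrite big_enum.
  by apply: perm_big; rewrite perm_sym perm_sort.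
pose z := \sum_v `|y v|.
have yz v : y v <= z.
  by rewrite /z (bigD1 v) //=; apply: ler_wpDr (ler_norm _); apply: sumr_ge0.
have pw : pairwise (fun u v => y u <= y v) by_cost.
  rewrite -sorted_pairwise; last by move=> u v w; apply: le_trans.
  by apply: sort_sorted => u v; apply: le_total.
have pre' k : (k <= size by_cost)%N -> 0 <= \sum_(v <- take k by_cost) c v.
  rewrite size_sort -cardE => kV; have := pre k kV; rewrite low_take.
  by rewrite big_uniq ?take_uniq //=; under eq_bigl do rewrite inE.
have := abel_le pw pre' (_ : all (fun v => y v <= z) by_cost).
rewrite -!srt tot mulr0; apply.
by apply/allP.
Qed.

Variables (r : nat) (P : pred (r.-tuple V)).
Hypothesis PU : forall s : r.-tuple V, P s -> uniq s.

Definition hits (p : r.-tuple V -> R) (k : nat) :=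
  \sum_e p e * (count [in low k%:R] (val e))%:R.

Lemma sum_wdeg_set (p : r.-tuple V -> R) (L : {set V}) b : distribution P b p ->
  \sum_(v in L) wdeg val p v = \sum_e p e * (count [in L] (val e))%:R.
Proof.
move=> [p0 _ pP]; rewrite /wdeg exchange_big; apply: eq_bigr => e _ /=.
rewrite -mulr_sumr; have /andP[] := p0 e.
rewrite le_eqVlt => /orP[/eqP<-|/pP/PU ue] _; first by rewrite !mul0r.
congr (_ * _); rewrite -natr_sum; congr _%:R.
rewrite -big_mkcondr sum1dep_card -size_filter -(card_uniqP (filter_uniq _ ue)).
by apply: eq_card => v; rewrite !inE mem_filter.
Qed.

(** A criterion in which the cost enters only through its order: an equidistributed random tile
    would hit the [k] cheapest vertices [k / a] times on average, and no initial segment may be hit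
    less often. *)
Lemma low_cost_of_hits b (p : r.-tuple V -> R) (a : R) : 0 < a -> #|V|%:R = r%:R * a ->
  distribution P b p -> (forall k, (k <= #|V|)%N -> k%:R / a <= hits p k) ->
  \sum_v y v * wdeg val p v <= r%:R / #|V|%:R * \sum_v y v.
Proof.
move=> a0 Va dp hp; have [N0|N0] := posnP #|V|.
  have V0 (v : V) : False by have := card0_eq N0 v; rewrite inE.
  by rewrite !big1 ?mulr0 // => v; case: (V0 v).
have r0 : r%:R != 0 :> R.
  by apply: contraTneq N0 => r0; rewrite -leqNgt leqn0 -(pnatr_eq0 R) Va r0 mul0r.
have -> : r%:R / #|V|%:R = a^-1 :> R by rewrite Va; field; rewrite r0 gt_eqF.
rewrite -subr_le0 mulr_sumr -sumrB (eq_bigr (fun v => y v * (wdeg val p v - a^-1))); last first.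
  by move=> v _; ring.
have sumc (L : {set V}) : \sum_(v in L) (wdeg val p v - a^-1) =
    \sum_e p e * (count [in L] (val e))%:R - #|L|%:R / a.
  by rewrite sumrB (sum_wdeg_set _ dp) sumr_const -[_ *+ _]mulr_natl.
apply: cost_le0 => [k kV|].
  by rewrite sumc card_low_nat (minn_idPl kV) subr_ge0 hp.
have -> : \sum_v (wdeg val p v - a^-1) = \sum_(v in setT) (wdeg val p v - a^-1).
  by apply: eq_bigl => v; rewrite inE.
rewrite sumc cardsT Va mulfK ?gt_eqF //; have [_ p1 _] := dp.
rewrite (eq_bigr (fun e => p e * r%:R)) -?mulr_suml ?p1 ?mul1r ?subrr // => e _.
by rewrite (eq_count (a2 := predT)) ?count_predT ?size_tuple // => v; rewrite /= inE.
Qed.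

End Ranks.

Lemma count_prefix (X : Type) (x0 : X) (A : pred X) (s : seq X) i :
  (i < size s)%N -> (forall k, (k <= i)%N -> A (nth x0 s k)) -> (i < count A s)%N.
Proof.
move=> il H; rewrite -(cat_take_drop i.+1 s) count_cat.
have : all A (take i.+1 s).
  by apply/(all_nthP x0) => k; rewrite size_takel // => ki; rewrite nth_take // H.
by rewrite all_count size_takel // => /eqP->; rewrite leq_addr.
Qed.

Section Windows.

Variables (R : realType) (a alpha kappa tau eta : R) (r : nat).
Hypotheses (a0 : 0 < a) (al0 : 0 < alpha) (tau0 : 0 <= tau) (tau1 : tau <= 1)
  (kte : kappa <= tau * eta).

Lemma window j (k : R) : (j < r)%N -> k <= r%:R * a -> (j%:R - alpha) * a <= k ->
  exists i, [/\ (j <= i < r)%N, (i%:R - alpha) * a <= k & k <= (i%:R + 1) * a].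
Proof.
move=> jr kr; have [d] := ubnP (r - j)%N; elim: d j jr => // d IH j jr djr jk.
have [kj|jk'] := lerP k ((j%:R + 1) * a); first by exists j; rewrite leqnn jr.
have j1r : (j.+1 < r)%N.
  by rewrite -(ltr_nat R) -natr1 -(ltr_pM2r a0); lra.
have [|//|i [/andP[ji ir] h1 h2]] := IH j.+1 j1r.
- by apply: (leq_trans (ltn_sub2l jr (ltnSn j))); rewrite -ltnS.
- have a0' := a0; have : 0 < alpha * a by rewrite mulr_gt0.
  by rewrite -natr1; lra.
by exists i; rewrite (ltnW ji) ir.
Qed.

(* [S] and [Q] are the expected numbers of vertices of a random tile in the
   initial segments, for the two distributions being mixed. *)
Lemma mix_windows (S Q : nat -> R) (n j : nat) : (j < r)%N -> n%:R = r%:R * a ->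
  (forall i k, (j <= i < r)%N -> (i%:R - alpha) * a <= k%:R -> i%:R <= S k) ->
  (forall i k, (j <= i < r)%N -> (i%:R + kappa) * a <= k%:R -> i%:R + 1 <= S k) ->
  (forall i k, (j <= i < r)%N -> (i%:R - alpha) * a <= k%:R -> i%:R + eta <= Q k) ->
  (forall k, (k <= n)%N -> (j%:R - alpha) * a <= k%:R -> k%:R / a <= Q k) ->
  (forall i k, (j <= i < r)%N -> (i%:R - alpha) * a <= k%:R ->
     i%:R + tau * eta <= (1 - tau) * S k + tau * Q k) /\
  (forall k, (k <= n)%N -> (j%:R - alpha) * a <= k%:R ->
     k%:R / a <= (1 - tau) * S k + tau * Q k).
Proof.
move=> jr nE S1 S2 Q1 Q2; have t1 : 0 <= 1 - tau by have := tau1; lra.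
have F1 i k : (j <= i < r)%N -> (i%:R - alpha) * a <= k%:R ->
     i%:R + tau * eta <= (1 - tau) * S k + tau * Q k.
  move=> ir ik; have : (1 - tau) * i%:R <= (1 - tau) * S k by rewrite ler_wpM2l // S1.
  have : tau * (i%:R + eta) <= tau * Q k by rewrite ler_wpM2l // Q1.
  by lra.
split=> // k kn jk.
have kr : k%:R <= r%:R * a by rewrite -nE ler_nat.
have [i [ir h1 h2]] := window jr kr jk.
(* Up to rank [(i + kappa) * a] the surplus contributed by Q suffices; beyond it S alone already
   hits [i + 1] times. *)
have [big|small] := lerP ((i%:R + kappa) * a) k%:R; last first.
  apply: le_trans (F1 i k ir h1); rewrite ler_pdivrMr //.
  apply: (le_trans (ltW small)); rewrite ler_wpM2r ?(ltW a0) // lerD2l.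
  exact: kte.
have : (1 - tau) * (k%:R / a) <= (1 - tau) * S k.
  rewrite ler_wpM2l //; apply: le_trans (S2 i k ir big).
  by rewrite ler_pdivrMr.
have : tau * (k%:R / a) <= tau * Q k by rewrite ler_wpM2l // Q2.
by lra.
Qed.

End Windows.

Section HitBounds.

Variables (R : realType) (W V : finType) (T : rel W) (G : rel V) (y : V -> R).
Variables (l : seq W) (B : W -> {set V}).

Lemma count_low_okl (s : seq V) (i k : nat) : uniq l -> (i < size l)%N ->
  okl T G l B s ->
  (forall w, (index w l <= i)%N -> B w \subset low y k%:R) ->
  (i < count [in low y k%:R] s)%N.
Proof.
move=> ul il ok sub; have ss := okl_size ok.
case: l ul il ok sub ss => // w0 l' ul il ok sub ss.
case: s ok ss => // v0 s' ok ss.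
apply: (@count_prefix _ v0); first by rewrite ss.
move=> j ji; have jl := leq_ltn_trans ji il.
by have := okl_in w0 v0 ok jl; apply: subsetP; apply: sub; rewrite index_uniq.
Qed.

End HitBounds.

(* Sort the vertices by cost. A greedy embedding places the i-th vertex of the
   tile among the i(1+c)a cheapest vertices, which is slightly too dear when the
   cost is concentrated just above a multiple of a = n/r. This loss is made up by
   mixing in embeddings of the first j + 1 vertices into the (j - alpha)a
   cheapest ones, with weights decreasing fast in j. *)
Lemma low_cost_distribution (R : realType) (r : nat) (alpha gamma : R) :
  (3 <= r)%N -> 0 < alpha -> 0 < gamma ->
  exists c : R, [/\ 0 < c, c <= 1 &
  forall (W V : finType) (T : rel W) (G : rel V) (a : R) (l : seq W) (y : V -> R),
  (forall w w', w != w' -> T w w' = ~~ T w' w) -> irreflexive T -> irreflexive G ->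
  4 <= a -> #|V|%:R = r%:R * a -> codeg_le G ((1 + c) * a) ->
  nonext G a alpha gamma ->
  perm_eq l (enum W) -> trans_prefix T l -> size l = r ->
  exists2 p : r.-tuple V -> R,
    distribution (fun s : r.-tuple V => tile T G s) ((c * a) ^- r) p &
    \sum_v y v * wdeg val p v <= r%:R / #|V|%:R * \sum_v y v].
Proof.
move=> r3 alpha0 gamma0.
have [ce [ce0 ce1 Hce]] := cnt_large (ltnW r3) alpha0 gamma0.
have [rr Err rr3] : exists2 rr : R, rr = r%:R & 3 <= rr by exists r%:R; rewrite ?ler_nat.
(* Each mixing multiplies a surplus by [tau], so [kappa] is a lower bound for all surpluses that
   occur. As [tau * r] is below [al], giving away the share [tau] loses less than [al] hits, and [c]
   keeps the overhead of the greedy ranks below [kappa * a]. *)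
pose al : R := ce / 2; pose tau := al / (4 * rr); pose kappa := tau ^+ r.
pose c := kappa / (2 * rr).
have al0 : 0 < al by rewrite divr_gt0.
have tau0 : 0 < tau by rewrite divr_gt0 // mulr_gt0 //; lra.
have taur : tau * rr = al / 4 by rewrite /tau; field; rewrite gt_eqF //; lra.
have al2 : al * 2 = ce by rewrite /al; field.
have tau3 : tau * 3 <= tau * rr by rewrite ler_wpM2l // ltW.
have tau1 : tau <= 1 by lra.
have kap0 : 0 < kappa by rewrite exprn_gt0.
have kapt : kappa <= tau.
  have -> : kappa = tau * tau ^+ r.-1 by rewrite -exprS prednK // ltnW // ltnW.
  by rewrite ler_piMr ?(ltW tau0) // exprn_ile1 // ltW.
have c0 : 0 < c by rewrite divr_gt0 // mulr_gt0 //; lra.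
have crr : c * rr = kappa / 2 by rewrite /c; field; rewrite gt_eqF //; lra.
have c3 : c * 3 <= c * rr by rewrite ler_wpM2l // ltW.
have [clece c12] : c <= ce /\ c <= 2^-1 by split; lra.
exists c; split; [by []|lra|].
move=> W V T G a l y tourT irrT irrG a4 Va dG xG pl tl sl.
have a0 : 0 < a by lra.
have a0' := ltW a0; have ca0 : 0 < c * a by rewrite mulr_gt0.
pose P (s : r.-tuple V) := tile T G s.
have PU (s : r.-tuple V) : P s -> uniq s by apply: tile_uniq.
have ul : uniq l by rewrite (perm_uniq pl) enum_uniq.
have dG' : codeg_le G ((1 + ce) * a).
  move=> v; have : c * a <= ce * a by rewrite ler_wpM2r.
  by have [d1 d2] := dG v; split; [apply: (le_trans d1)|apply: (le_trans d2)]; lra.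
pose b := (c * a) ^- r.
(* A rank below which vertex [i] of the tile, counted from 0, still has [c * a] choices after [i]
   placements. *)
pose gre (i : nat) := i%:R * ((1 + c) * a) + c * a.
have gre_le i : (i < r)%N -> gre i <= (i%:R + kappa) * a.
  move=> ir; have : (i%:R + 1) * (c * a) <= rr * (c * a).
    by rewrite ler_wpM2r ?(ltW ca0) // natr1 Err ler_nat.
  have -> : rr * (c * a) = kappa / 2 * a by rewrite -crr; ring.
  have : 0 <= kappa / 2 * a by rewrite mulr_ge0 // divr_ge0 // ltW.
  by rewrite /gre; lra.
have gre_mono i i' : (i <= i')%N -> gre i <= gre i'.
  by move=> ii; rewrite /gre lerD2r ler_wpM2r ?ler_nat // mulr_ge0 //; lra.
have gre_N i : (i < r)%N -> gre i <= #|V|%:R.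
  move=> ir; apply: le_trans (gre_le i ir) _; rewrite Va ler_wpM2r //.
  have : i.+1%:R <= r%:R :> R by rewrite ler_nat.
  by rewrite -natr1; lra.
have gre_win i : (0 < i)%N -> (i < r)%N -> gre i.-1 <= (i%:R - al) * a.
  move=> i0 ir; apply: le_trans (gre_le i.-1 (leq_ltn_trans (leq_pred i) ir)) _.
  have : i%:R = i.-1%:R + 1 :> R by rewrite natr1 prednK.
  by move=> ->; rewrite ler_wpM2r //; lra.
have lowk (x : R) k : x <= k%:R -> low y x \subset low y k%:R by apply: sub_low.
pose n := #|V|.
(* [F2 j] is the criterion of [low_cost_of_hits] from rank [(j - al) * a] on; [F1 j] is the surplus
   there that pays for mixing in the next distribution. *)
pose F1 j (q : r.-tuple V -> R) := forall i k, (j <= i < r)%N ->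
  (i%:R - al) * a <= k%:R -> i%:R + tau ^+ (r - j) <= hits y q k.
pose F2 j (q : r.-tuple V -> R) := forall k, (k <= n)%N ->
  (j%:R - al) * a <= k%:R -> k%:R / a <= hits y q k.
have hits0 q k : distribution P b q -> 0 <= hits y q k.
  by move=> [q0 _ _]; apply: sumr_ge0 => e _; rewrite mulr_ge0 //; have /andP[] := q0 e.
have strategy j : (0 < j < r)%N -> exists S, [/\ distribution P b S,
    forall k : nat, (j%:R - al) * a <= k%:R -> j%:R + 1 <= hits y S k &
    forall (i k : nat), (j < i < r)%N -> gre i <= k%:R -> i%:R + 1 <= hits y S k].
  move=> /andP[j0 jr].
  pose th i := if (i <= j)%N then (j%:R - al) * a else gre i.
  pose B w := low y (th (index w l)).
  pose X := [set s : r.-tuple V | okl T G l B s].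
  have jth : (j%:R - al) * a <= #|V|%:R.
    rewrite Va ler_wpM2r //; have : j%:R <= r%:R :> R by rewrite ler_nat ltnW.
    by lra.
  have cX : (c * a) ^+ r <= #|X|%:R.
    rewrite -(cnt_card _ _ _ sl) -(cat_take_drop j.+1 l).
    have sz1 : size (take j.+1 l) = j.+1 by rewrite size_takel // sl.
    have := @cnt_cat R W V T G ((1 + c) * a) (c * a) (take j.+1 l) (drop j.+1 l) B.
    have [w0 _] : exists w0 : W, true by case: (l) tl => // w0 *; exists w0.
    move=> /(_ w0 dG (ltW ca0)) H.
    apply: (le_trans _ (H _)) => [|i il]; last first.
      move: il; rewrite size_drop sl => il; rewrite sz1 nth_drop /B index_uniq //; last first.
        by rewrite sl -ltn_subRL.
      rewrite /th leqNgt ltnS leq_addr /=; apply: card_low; apply: gre_N.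
      by rewrite -ltn_subRL.
    rewrite size_drop sl -{1}(subnKC jr) exprD ler_pM ?exprn_ge0 ?(ltW ca0) //.
    rewrite (@eq_cnt _ _ _ _ _ _ (fun=> low y ((j%:R - al) * a))); last first.
      by move=> w wt; rewrite /B /th -ltnS -in_take ?wt // (mem_take wt).
    apply: le_trans (_ : (ce * a) ^+ j.+1 <= _).
      have cace : c * a <= ce * a by rewrite ler_wpM2r.
      by rewrite lerXn2r ?nnegrE ?(ltW ca0) // mulr_ge0 // ltW.
    rewrite -{1}sz1; apply: (Hce W V T G a) => //; rewrite ?take_uniq ?sz1 //.
      have : (2 < size l)%N by rewrite sl.
      case: (l) tl => [|u1 [|u2 [|u3 l']]] //= /and3P[t12 t13 t23] _.
      by case: j j0 {jr th B X jth sz1 H} => [|[|j]] //= _; rewrite t12 ?t13.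
    apply: le_trans (card_low y jth); rewrite ler_wpM2r //=; lra.
  have X0 : (0 < #|X|)%N by rewrite -(ltr0n R); apply: lt_le_trans cX; rewrite exprn_gt0.
  exists (uniform R X); split.
  - apply: (@distribution_uniform R _ P b ((c * a) ^+ r)) => //; rewrite ?exprn_gt0 //.
    by move=> s; rewrite inE => ok; apply: (tile_subdigraph pl ok).
  - move=> k jk; apply: sum_uniform_ge => // s; rewrite inE => ok.
    rewrite natr1 ler_nat; apply: (count_low_okl ul _ ok); first by rewrite sl.
    by move=> w wj; apply: lowk; rewrite /th wj.
  move=> i k /andP[ji ir] ik; apply: sum_uniform_ge => // s; rewrite inE => ok.
  rewrite natr1 ler_nat; apply: (count_low_okl ul _ ok); first by rewrite sl.
  move=> w wi; apply: lowk; apply: le_trans ik; rewrite /th; case: ifP => [_|_]; last exact: gre_mono.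
  apply: le_trans (_ : gre j.+1 <= _); last exact: gre_mono.
  have : 0 <= c * a by rewrite ltW.
  have : 0 <= j%:R * (c * a) by rewrite mulr_ge0 // ltW.
  have : 0 <= al * a by rewrite mulr_ge0 // ltW.
  by rewrite /gre -natr1; lra.
(* For the ranks below [(1 - al) * a], the first vertex is spread evenly over the cheapest [a / 2].
   As [4 <= a], rounding leaves at most [3 / 4 * a] of them, and the resulting factor 4/3 pays for
   the weight [1 - tau]. *)
have base : exists S, [/\ distribution P b S,
    forall k : nat, a / 2 <= k%:R -> 1 <= hits y S k,
    forall k : nat, (k <= n)%N -> k%:R <= a / 2 -> k%:R / (3 / 4 * a) <= hits y S k &
    forall (i k : nat), (0 < i < r)%N -> gre i <= k%:R -> i%:R + 1 <= hits y S k].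
  case El : l pl tl sl ul => [|w0 l'] // pl tl sl ul.
  pose Low := low y (a / 2).
  pose B v w := if index w l == 0%N then [set v] else low y (gre (index w l)).
  pose X v := [set s : r.-tuple V | okl T G l (B v) s].
  pose z := (c * a) ^+ r.-1.
  have z0 : 0 < z by rewrite exprn_gt0.
  have i0 : index w0 l = 0%N by rewrite El /= eqxx.
  have szl' : size l' = r.-1 by rewrite -sl.
  have cX v : z <= #|X v|%:R.
    rewrite /X -(@cnt_card _ _ T G l (B v) r) ?El //.
    have := @cnt_cat R W V T G ((1 + c) * a) (c * a) [:: w0] l' (B v) w0 dG (ltW ca0).
    rewrite /= /B i0 /= big_set1 mul1r szl' => H; apply: (le_trans _ (H _)) => // i il.
    have il' : (i.+1 < size (w0 :: l'))%N by rewrite /= szl' ltnS.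
    rewrite El -[nth w0 l' i]/(nth w0 (w0 :: l') i.+1) index_uniq //= add1n.
    by apply: card_low; apply: gre_N; rewrite -sl.
  have X0 v : (0 < #|X v|)%N by rewrite -(ltr0n R); apply: lt_le_trans (cX v).
  have hLow : a / 2 <= #|Low|%:R.
    apply: card_low; rewrite Va -Err; have : 3 * a <= rr * a by rewrite ler_wpM2r.
    by lra.
  have Low0 : 0 < #|Low|%:R :> R by apply: lt_le_trans hLow; lra.
  have hLow' : #|Low|%:R <= 3 / 4 * a.
    apply: (le_trans (card_low_le _ _)); lra.
  pose S e := (\sum_(v in Low) uniform R (X v) e) / #|Low|%:R.
  have hS k : hits y S k = (\sum_(v in Low) hits y (uniform R (X v)) k) / #|Low|%:R.
    rewrite /hits exchange_big /= mulr_suml; apply: eq_bigr => e _.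
    by rewrite /S mulrAC mulr_suml.
  have avg F (t : R) : (forall v, v \in Low -> t <= F v) ->
      t <= (\sum_(v in Low) F v) / #|Low|%:R.
    move=> tF; rewrite ler_pdivlMr // mulrC -sumr_card; exact: ler_sum.
  exists S; split.
  - have u0 v e : 0 <= uniform R (X v) e.
      by rewrite /uniform; case: ifP => // _; rewrite invr_ge0.
    split=> [e||e].
    + apply/andP; split; first by rewrite divr_ge0 // sumr_ge0.
      apply: le_trans (_ : z^-1 / #|Low|%:R <= _).
        rewrite ler_pM2r ?invr_gt0 //.
        have uz v : uniform R (X v) e <= z^-1.
          rewrite /uniform; case: ifP => _; last by rewrite invr_ge0 ltW.
          by rewrite lef_pV2 ?posrE ?ltr0n.
        (* The averaged distributions have disjoint supports, so averaging over [Low] divides the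
           probabilities by [#|Low|]; this makes up for the first vertex being fixed. *)
        have only v : e \in X v -> ohead (tval e) = Some v.
          rewrite inE El; case: (tval e) => //= v1 s' /andP[].
          by rewrite /B i0 eqxx inE => /eqP-> _.
        have [/existsP[v eX]|/existsPn none] := boolP [exists v, e \in X v].
          have hv := only _ eX.
          rewrite big_mkcond (bigD1 v) //= big1 ?addr0.
            by case: ifP => // _; rewrite invr_ge0 ltW.
          move=> v' v'v; case: ifP => // _; rewrite /uniform; case: ifP => // /only.
          by rewrite hv => -[vv']; rewrite vv' eqxx in v'v.
        rewrite big1 ?invr_ge0 ?(ltW z0) // => v _; rewrite /uniform; case: ifP => // eX.
        by rewrite (negPf (none v)) in eX.
      have -> : b = z^-1 / (c * a).
        by rewrite /b /z -invfM -exprSr prednK // ltnW // ltnW.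
      rewrite ler_pM2l ?invr_gt0 // lef_pV2 ?posrE //; apply: le_trans hLow.
      by have : c * a <= 2^-1 * a; [rewrite ler_wpM2r|lra].
    + rewrite -mulr_suml exchange_big (eq_bigr (fun=> 1)).
        by rewrite sumr_const divff // gt_eqF.
      move=> v _; have [|_ ->//] := @distribution_uniform R _ predT z^-1 z (X v) z0 (cX v) (lexx _).
      by move=> ?.
    rewrite /S => Se; have /existsP[v vL] : [exists v, 0 < uniform R (X v) e].
      apply: contraT => /existsPn H; move: Se; rewrite big1 ?mul0r ?ltxx // => v _.
      by apply/le_anti; rewrite u0 andbT leNgt H.
    move: vL; rewrite /uniform; case: ifP; rewrite ?ltxx // inE => ok _.
    by apply: (tile_subdigraph _ ok); rewrite El.
  - move=> k ak; rewrite hS; apply: avg => v vL; apply: sum_uniform_ge => // s.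
    rewrite inE => ok; rewrite ler1n -[X in (X <= _)%N]/(0.+1).
    apply: (count_low_okl _ _ ok); rewrite ?El //.
    move=> w; rewrite -El leqn0 /B => ->; rewrite sub1set.
    by apply: (subsetP (lowk _ _ ak)).
  - move=> k kn ka; rewrite hS.
    apply: le_trans (_ : k%:R / #|Low|%:R <= _).
      by rewrite ler_wpM2l // lef_pV2 ?posrE // mulr_gt0 //; lra.
    rewrite ler_pM2r ?invr_gt0 //.
    have kL : low y k%:R \subset Low by apply: sub_low.
    apply: le_trans (_ : \sum_(v in Low) (v \in low y k%:R)%:R <= _).
      rewrite -natr_sum -big_mkcondr sum1dep_card ler_nat.
      rewrite -{1}(minn_idPl kn) -(card_low_nat y k); apply/subset_leq_card/subsetP => v vk.
      by rewrite inE vk (subsetP kL).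
    apply: ler_sum => v vL; case: (boolP (v \in low y k%:R)) => [vk|_]; last first.
      by apply: sumr_ge0 => e _; rewrite mulr_ge0 // /uniform; case: ifP => // _; rewrite invr_ge0.
    apply: sum_uniform_ge => // s.
    rewrite inE => ok; rewrite ler1n -[X in (X <= _)%N]/(0.+1).
    apply: (count_low_okl _ _ ok); rewrite ?El //.
    by move=> w; rewrite -El leqn0 /B => ->; rewrite sub1set.
  move=> i k /andP[i1 ir] ik; rewrite hS; apply: avg => v vL; apply: sum_uniform_ge => // s.
  rewrite inE => ok; rewrite natr1 ler_nat.
  apply: (count_low_okl _ _ ok); rewrite ?El // ?sl //.
  move=> w; rewrite -El /B; case: eqP => [_ _|_ wi].
    rewrite sub1set; apply: (subsetP (lowk _ _ _) _ vL); apply: le_trans ik.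
    apply: le_trans (gre_mono 1%N _ i1).
    by rewrite /gre mul1r; lra.
  by apply: lowk; apply: le_trans ik; apply: gre_mono.
have mixS j S q : (0 < j < r)%N -> distribution P b S -> distribution P b q ->
    F1 j q -> F2 j q ->
    (forall i k : nat, (j <= i < r)%N -> gre i.-1 <= k%:R -> (i%:R - al) * a <= k%:R -> i%:R <= hits y S k) ->
    (forall i k : nat, (j <= i < r)%N -> gre i <= k%:R -> i%:R + 1 <= hits y S k) ->
    (forall i k : nat, (j <= i < r)%N -> (i%:R - al) * a <= k%:R ->
       i%:R + tau ^+ (r - j).+1 <= hits y (mix tau S q) k) /\
    F2 j (mix tau S q).
  move=> /andP[j0 jr] dS dq f1 f2 s1 s2.
  have kte : kappa <= tau * tau ^+ (r - j).
    rewrite -exprS /kappa; apply: ler_wiXn2l; rewrite ?(ltW tau0) //.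
    by rewrite -subSn ?(ltnW jr) // leq_subLR -addn1 addnC leq_add2r.
  have S1 i k : (j <= i < r)%N -> (i%:R - al) * a <= k%:R -> i%:R <= hits y S k.
    move=> ijr ik; apply: s1 => //; apply: le_trans ik; have /andP[ji ir] := ijr.
    by apply: gre_win => //; apply: leq_trans ji.
  have S2 i k : (j <= i < r)%N -> (i%:R + kappa) * a <= k%:R -> i%:R + 1 <= hits y S k.
    by move=> ijr ik; apply: s2 => //; apply: le_trans ik; apply: gre_le; case/andP: ijr.
  have [G1 G2] := mix_windows a0 al0 (ltW tau0) tau1 kte jr Va S1 S2 f1 f2.
  split=> [i k ijr ik|k kn jk]; rewrite /hits sum_mix; last exact: G2.
  by rewrite exprS; apply: G1.
(* Strategies are added from [r - 1] down to 1. The newest, with index [i] and weight [1 - tau],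
   serves the ranks between [(i - al) * a] and [(i + 1 - al) * a] on its own, by [low_k]. *)
have chain d : (d.+1 < r)%N -> exists q, [/\ distribution P b q, F1 (r.-1 - d)%N q & F2 (r.-1 - d)%N q].
  elim: d => [|d IH] dr.
    have r1 : (0 < r.-1 < r)%N by case: (r) r3 => [|[|r']] //=.
    have [S [dS s1 _]] := strategy _ r1; exists S.
    have rE : r.-1%:R + 1 = r%:R :> R by rewrite natr1 prednK // ltnW // ltnW.
    rewrite subn0; split=> // [i k /andP[ri ir] ik|k kn jk].
      have -> : i = r.-1 by apply/eqP; rewrite eqn_leq ri -ltnS prednK ?ir // ltnW // ltnW.
      apply: le_trans (s1 k _); last by move: ik; have -> : i = r.-1;
        first by apply/eqP; rewrite eqn_leq ri -ltnS prednK ?ir // ltnW // ltnW.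
      by rewrite lerD2l exprn_ile1 // ltW.
    apply: le_trans (s1 k jk); rewrite rE ler_pdivrMr // -Va ler_nat //.
  have [q [dq f1 f2]] := IH (ltnW dr); set j := (r.-1 - d)%N in f1 f2.
  have jE : (r.-1 - d.+1 = j.-1)%N by rewrite subnS.
  have j1 : (1 < j)%N by rewrite /j ltn_subRL addnC addSn add0n -ltnS prednK // ltnW // ltnW.
  have jr : (j < r)%N.
    by rewrite /j; apply: leq_ltn_trans (leq_subr _ _) _; rewrite prednK // ltnW // ltnW.
  have jj : (0 < j.-1 < r)%N by rewrite -ltnS prednK ?j1 ?(leq_ltn_trans (leq_pred j)) // ltnW.
  have [S [dS s1 s2]] := strategy _ jj.
  have j1E : j.-1%:R + 1 = j%:R :> R by rewrite natr1 prednK // ltnW.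
  have [g1 g2] : (forall i k : nat, (j <= i < r)%N -> (i%:R - al) * a <= k%:R ->
       i%:R + tau ^+ (r - j).+1 <= hits y (mix tau S q) k) /\ F2 j (mix tau S q).
    apply: mixS => //; first by rewrite (ltnW j1) jr.
      move=> i k /andP[ji ir] gk ik; have [ij|ij] := eqVneq i j.
        by move: ik; rewrite ij -j1E => ik; apply: s1; lra.
      have ji' : (j < i)%N by rewrite ltn_neqAle eq_sym ij ji.
      have iE : i.-1%:R + 1 = i%:R :> R by rewrite natr1 prednK //; apply: leq_trans ji'.
      rewrite -iE; apply: s2 => //; apply/andP; split; last exact: leq_ltn_trans (leq_pred i) ir.
      by rewrite prednK ?(ltnW j1) // -ltnS prednK //; apply: leq_trans ji'.
    move=> i k /andP[ji ir] gk; apply: s2 => //; rewrite ir andbT.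
    by rewrite prednK // ltnW.
  have rj : (r - j.-1 = (r - j).+1)%N by rewrite -subn1 subnBA ?addn1 ?subSn ?(ltnW jr) // ltnW.
  have tj1 : tau ^+ (r - j).+1 <= tau.
    by rewrite exprS ler_piMr ?(ltW tau0) // exprn_ile1 // ltW.
  have tj : tau * j%:R <= al / 4.
    by rewrite -taur ler_wpM2l ?(ltW tau0) // Err ler_nat ltnW.
  have low_k k : (j.-1%:R - al) * a <= k%:R -> (1 - tau) * j%:R <= hits y (mix tau S q) k.
    move=> jk; rewrite /hits sum_mix; have h := s1 k jk; rewrite j1E in h.
    have : (1 - tau) * j%:R <= (1 - tau) * hits y S k by rewrite ler_wpM2l //; lra.
    have : 0 <= tau * hits y q k by rewrite mulr_ge0 ?(ltW tau0) // hits0.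
    by rewrite /hits; lra.
  exists (mix tau S q); rewrite jE; split.
  - exact: distribution_mix (ltW tau0) tau1 dS dq.
  - move=> i k /andP[ji ir] ik; rewrite rj; have [ij|ij] := leqP j i.
      by apply: g1; rewrite ?ij.
    have iE : i = j.-1 by apply/eqP; rewrite eqn_leq ji -ltnS prednK ?ij // ltnW.
    rewrite iE in ik *; apply: le_trans (low_k _ ik).
    by move: j1E; lra.
  move=> k kn jk; have [kj|kj] := leP ((j%:R - al) * a) k%:R; first exact: g2.
  apply: le_trans (low_k _ jk); rewrite ler_pdivrMr //; apply: le_trans (ltW kj) _.
  by rewrite ler_wpM2r //; lra.
have [q [dq f1 f2]] : exists q, [/\ distribution P b q, F1 1%N q & F2 1%N q].
  have := chain (r - 2)%N; have -> : (r.-1 - (r - 2) = 1)%N by case: (r) r3 => [|[|r']] //= _; rewrite subn2 /= subSn ?subnn.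
  by apply; case: (r) r3 => [|[|r']] //= _; rewrite subn2.
have [S [dS s0 s1 s2]] := base.
have r1 : (0 < 1 < r)%N by exact: ltnW r3.
have [_ g2] : (forall i k : nat, (1 <= i < r)%N -> (i%:R - al) * a <= k%:R ->
       i%:R + tau ^+ (r - 1).+1 <= hits y (mix tau S q) k) /\ F2 1%N (mix tau S q).
  apply: mixS => //.
  move=> [|[|i]] // k /andP[_ ir] gk ik.
    apply: s0; apply: le_trans ik; have : al * a <= 2^-1 * a by rewrite ler_wpM2r //; lra.
    by lra.
  by have := s2 i.+1 k; rewrite /= (ltnW ir) natr1 => /(_ isT gk).
have dm := distribution_mix (ltW tau0) tau1 dS dq.
exists (mix tau S q) => //; apply: (low_cost_of_hits PU a0 Va dm) => k kn.
have [kj|kj] := leP ((1 - al) * a) k%:R; first exact: g2.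
have hm : (1 - tau) * hits y S k <= hits y (mix tau S q) k.
  rewrite [leRHS]/hits sum_mix lerDl mulr_ge0 ?(ltW tau0) //; exact: hits0.
apply: le_trans hm; have [ka|ka] := lerP (a / 2) k%:R.
  apply: le_trans (_ : 1 - al <= _); first by rewrite ler_pdivrMr // ltW.
  apply: le_trans (_ : (1 - tau) * 1 <= _); first by lra.
  by rewrite ler_wpM2l ?s0 //; lra.
apply: le_trans (_ : (1 - tau) * (k%:R / (3 / 4 * a)) <= _); last first.
  by rewrite ler_wpM2l ?s1 ?(ltW ka) //; lra.
have -> : (1 - tau) * (k%:R / (3 / 4 * a)) = ((1 - tau) * (4 / 3)) * (k%:R / a).
  by field; rewrite gt_eqF.
by rewrite ler_peMl ?divr_ge0 //; lra.
Qed.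

(** * Absorption *)

(* Each step picks a gadget maximising the total weight of the things it serves,
   where a thing already served [k] times has weight [2 ^- k]. *)
Lemma serving_family (R : realType) (Q E V : finType) (serves : Q -> E -> bool)
    (supp : E -> {set V}) (xi mu : R) (d m c : nat) :
  0 < xi -> (0 < #|Q|)%N -> (0 < #|E|)%N ->
  (forall e, #|supp e| <= d)%N -> (d * m)%:R <= mu ->
  (forall (U : {set V}) x, #|U|%:R <= mu ->
     xi * #|E|%:R <= #|[set e | serves x e && [disjoint supp e & U]]|%:R) ->
  #|Q|%:R * (1 - xi / 2) ^+ m * 2 ^+ c < 1 :> R ->
  exists es : seq E, [/\ size es = m,
    pairwise (fun e e' => [disjoint supp e & supp e']) es,
    (forall e, e \in es -> exists x, serves x e) &
    forall x, (c < count (serves x) es)%N].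
Proof.
move=> xi0 Q0 E0 suppd dm H small.
pose wt (es : seq E) x : R := 2 ^- (count (serves x) es).
have wt0 es x : 0 < wt es x by rewrite invr_gt0 exprn_gt0.
have ERpos : 0 < #|E|%:R :> R by rewrite ltr0n.
have /card_gt0P[x0 _] := Q0.
have claim k : (k <= m)%N -> exists es : seq E, [/\ size es = k,
    pairwise (fun e e' => [disjoint supp e & supp e']) es,
    (forall e, e \in es -> exists x, serves x e) &
    \sum_x wt es x <= #|Q|%:R * (1 - xi / 2) ^+ k].
  elim: k => [|k IH] km.
    exists [::]; split=> //; rewrite expr0 mulr1 /wt /=.
    by rewrite sumr_const expr0 invr1.
  have [es [ses pes ses' wes]] := IH (ltnW km).
  pose U := \bigcup_(e <- es) supp e.
  have cU : (#|U| <= d * size es)%N.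
    rewrite /U; elim: (es) => [|e es' IHe]; first by rewrite big_nil cards0.
    rewrite big_cons /= mulnS; apply: leq_trans (leq_add (suppd e) IHe).
    by rewrite cardsU leq_subr.
  have UmuR : #|U|%:R <= mu.
    by apply: le_trans dm; rewrite ler_nat (leq_trans cU) // ses leq_mul2l ltnW ?orbT.
  pose ok e := [disjoint supp e & U] && [exists x, serves x e].
  pose gain e := \sum_(x | serves x e) wt es x.
  have tot : xi * #|E|%:R * \sum_x wt es x <= \sum_(e | ok e) gain e.
    have -> : \sum_(e | ok e) gain e =
        \sum_x #|[set e | serves x e && [disjoint supp e & U]]|%:R * wt es x.
      rewrite (exchange_big_dep predT) //=; apply: eq_bigr => x _.
      rewrite sumr_const -[LHS]mulr_natl; congr (_%:R * _).
      apply: eq_card => e; rewrite [in RHS]inE unfold_in /ok.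
      case: (boolP (serves x e)) => sx; rewrite ?andbF // !andbT.
      by have -> : [exists x, serves x e]; [apply/existsP; exists x|rewrite andbT].
    by rewrite mulr_sumr; apply: ler_sum => x _; rewrite ler_wpM2r ?H // ltW.
  have [e0 ok0] : exists e0, ok e0.
    have : 0 < #|[set e | serves x0 e && [disjoint supp e & U]]|%:R :> R.
      by apply: lt_le_trans (H U x0 UmuR); rewrite mulr_gt0.
    rewrite ltr0n => /card_gt0P[e]; rewrite inE => /andP[se de]; exists e.
    by rewrite /ok de; apply/existsP; exists x0.
  case: (arg_maxP gain ok0) => e oke maxe.
  have ge : xi * \sum_x wt es x <= gain e.
    rewrite -(ler_pM2l ERpos) mulrCA mulrA; apply: (le_trans tot).
    apply: le_trans (_ : \sum_(e' | ok e') gain e <= _); first exact: ler_sum.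
    rewrite sumr_const -[leLHS]mulr_natl ler_wpM2r ?ler_nat ?max_card //.
    by apply: sumr_ge0 => x _; apply: ltW.
  have /andP[dU /existsP[x1 sx1]] := oke.
  exists (e :: es); split.
  - by rewrite /= ses.
  - rewrite /= pes andbT; apply/allP => e' e'es.
    rewrite disjoint_sym; apply: disjointWl _ _ _; last by rewrite disjoint_sym; exact: dU.
    by rewrite /U (big_rem e') //= subsetUl.
  - by move=> e'; rewrite inE => /orP[/eqP->|/ses'//]; exists x1.
  have wtE x : wt (e :: es) x = wt es x - (if serves x e then wt es x / 2 else 0).
    rewrite /wt /=; case: ifP => _; last by rewrite add0n subr0.
    by rewrite -[(true + _)%N]/(count (serves x) es).+1 exprS invfM; lra.
  under eq_bigr do rewrite wtE.
  rewrite sumrB -big_mkcond -mulr_suml -/(gain e) exprSr mulrA.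
  (* If [xi] exceeded 2, one gadget would gain more than the total weight. *)
  have x2 : 0 <= 1 - xi / 2.
    rewrite leNgt; apply/negP => neg.
    have s0 : 0 < \sum_x wt es x.
      by rewrite (bigD1 x0) //=; apply: ltr_wpDr => //; apply: sumr_ge0 => x _; apply: ltW.
    have : gain e <= \sum_x wt es x.
      rewrite /gain big_mkcond; apply: ler_sum => x _; case: ifP => // _; exact: ltW.
    have : 2 * \sum_x wt es x < xi * \sum_x wt es x by rewrite ltr_pM2r //; lra.
    by lra.
  have : (\sum_x wt es x) * (1 - xi / 2) <= #|Q|%:R * (1 - xi / 2) ^+ k * (1 - xi / 2).
    by rewrite ler_wpM2r.
  by lra.
have [es [ses pes ses' wes]] := claim m (leqnn m).
exists es; split=> // x; rewrite ltnNge; apply/negP => cx.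
(* A thing served at most [c] times would alone outweigh the bound on the total. *)
have : 2 ^- c <= wt es x.
  rewrite /wt lef_pV2 ?posrE ?exprn_gt0 //; apply: ler_weXn2l => //; lra.
have : wt es x <= \sum_x wt es x.
  by rewrite (bigD1 x) //= lerDl; apply: sumr_ge0 => x' _; apply: ltW.
have c2 : 0 < 2 ^+ c :> R by rewrite exprn_gt0.
move=> h1 h2; have : 2 ^- c <= #|Q|%:R * (1 - xi / 2) ^+ m.
  by apply: le_trans wes; apply: le_trans h1.
by rewrite -[2 ^- c]div1r ler_pdivrMr // leNgt small.
Qed.

(** * Absorbing arrays and their number *)

Section Tiled.

Variables (V : finType) (tl : pred (seq V)).

(** A partition of [s] as a multiset; the tiles are disjoint as soon as [s] has no repetitions. *)
Definition tiled (s : seq V) := exists2 ps, all tl ps & perm_eq (flatten ps) s.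

Lemma tiled_perm s s' : perm_eq s s' -> tiled s -> tiled s'.
Proof. by move=> ss' [ps tps ps_s]; exists ps => //; apply: perm_trans ps_s ss'. Qed.

Lemma tiled_cat s s' : tiled s -> tiled s' -> tiled (s ++ s').
Proof.
move=> [ps tps ps_s] [ps' tps' ps_s']; exists (ps ++ ps'); first by rewrite all_cat tps.
by rewrite flatten_cat perm_cat.
Qed.

Lemma perm_flatten_cons (I : Type) (f : I -> V) (h : I -> seq V) (s : seq I) :
  perm_eq (flatten [seq f i :: h i | i <- s]) (map f s ++ flatten (map h s)).
Proof.
elim: s => //= i s IH; rewrite perm_cons.
by rewrite perm_sym perm_catCA perm_cat2l perm_sym.
Qed.

Variable q : nat.
Local Notation r := q.+1.

(* An r x r array of vertices whose rows are tiles. Its first column is a tile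
   as well, and may be exchanged for the entries of a served r-tuple [X]. *)
Definition gadget := {ffun 'I_r * 'I_r -> V}.
Implicit Types (g : gadget) (X : r.-tuple V).

Definition grow g i := [seq g (i, lift ord0 j) | j <- enum 'I_q].
Definition gcol g := [seq g (i, ord0) | i <- enum 'I_r].
Definition gverts g := flatten [seq g (i, ord0) :: grow g i | i <- enum 'I_r].

(** Injectivity is kept apart so that the rows can be chosen independently when counting; collisions
    are subtracted afterwards. *)
Definition serves0 X g := tl (gcol g) &&
  [forall i, tl (g (i, ord0) :: grow g i) && tl (tnth X i :: grow g i)].
Definition serves X g := injectiveb g && serves0 X g.
Definition gsupp g : {set V} := [set g k | k : 'I_r * 'I_r].

Lemma gverts_allpairs g : gverts g = [seq g k | k <- [seq (i, j) | i <- enum 'I_r, j <- enum 'I_r]].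
Proof.
rewrite /gverts [RHS]map_flatten -[in RHS]map_comp; congr (flatten _).
apply/eq_in_map => i _ /=.
by rewrite -map_comp enum_ordSl /= -map_comp.
Qed.

Lemma gverts_uniq g : injective g -> uniq (gverts g).
Proof.
move=> ig; rewrite gverts_allpairs map_inj_uniq //.
by apply: allpairs_uniq; rewrite ?enum_uniq // => -[i j] [i' j'].
Qed.

Lemma mem_gverts g v : (v \in gverts g) = (v \in gsupp g).
Proof.
rewrite gverts_allpairs; apply/mapP/imsetP => -[k k1 ->]; exists k => //.
by case: k {k1} => i j; apply: allpairs_f; rewrite mem_enum.
Qed.

Lemma tiled_gadget X g : serves X g -> tiled (gverts g).
Proof.
move=> /and3P[_ _ /forallP H].
exists [seq g (i, ord0) :: grow g i | i <- enum 'I_r] => //.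
by apply/allP => s /mapP[i _ ->]; have /andP[] := H i.
Qed.

(** The first column becomes a tile of its own, and the entries of X take its place at the heads of
    the rows. *)
Lemma tiled_absorb X g : serves X g -> tiled (val X ++ gverts g).
Proof.
move=> /and3P[_ tc /forallP H].
exists (gcol g :: [seq tnth X i :: grow g i | i <- enum 'I_r]).
  by rewrite /= tc; apply/allP => s /mapP[i _ ->]; have /andP[] := H i.
rewrite /=; apply: perm_trans (_ : perm_eq (gcol g ++ (val X ++ flatten (map (grow g) (enum 'I_r)))) _).
  by rewrite perm_cat2l; apply: perm_trans (perm_flatten_cons _ _ _) _; rewrite map_tnth_enum.
rewrite perm_catCA perm_cat2l perm_sym; exact: perm_flatten_cons.
Qed.

Lemma tiled_absorb_all (Xs : seq (r.-tuple V)) (es : seq gadget) :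
  (forall e, e \in es -> exists X, serves X e) ->
  (forall X, X \in Xs -> (size Xs <= count (serves X) es)%N) ->
  tiled (flatten (map val Xs) ++ flatten (map gverts es)).
Proof.
elim: Xs es => [|X Xs IH] es Hes HX /=.
  elim: es Hes {HX} => [|e es IHe] Hes; first by exists [::].
  have [X sX] := Hes e (mem_head _ _).
  apply: (tiled_cat (tiled_gadget sX)); apply: IHe => e' e'es.
  by apply: Hes; rewrite inE e'es orbT.
have : (0 < count (serves X) es)%N by apply: leq_trans (HX X (mem_head _ _)).
rewrite -has_count => /hasP[e ees sX].
have pe := perm_to_rem ees.
have tr : tiled (flatten (map val Xs) ++ flatten (map gverts (rem e es))).
  apply: IH => [e' /mem_rem|X' X'Xs]; first exact: Hes.
  have := HX X'; rewrite inE X'Xs orbT => /(_ isT); rewrite (permP pe) /=.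
  by case: (serves X' e) => //= /ltnW.
apply: tiled_perm (tiled_cat (tiled_absorb sX) tr).
rewrite -!catA perm_cat2l perm_catCA perm_cat2l.
rewrite -[gverts e ++ _]/(flatten (map gverts (e :: rem e es))).
by apply: perm_flatten; rewrite perm_map // perm_sym.
Qed.

Lemma chop_tuples (L : seq V) l : size L = (l * r)%N ->
  exists2 Xs : seq (r.-tuple V), flatten (map val Xs) = L & size Xs = l.
Proof.
elim: l L => [|l IH] L; first by move/size0nil=> ->; exists [::].
rewrite mulSn => sL; have [|Xs fX sX] := IH (drop r L).
  by rewrite size_drop sL addKn.
have st : size (take r L) == r by rewrite size_takel // sL leq_addr.
by exists (Tuple st :: Xs); rewrite /= ?sX // fX cat_take_drop.
Qed.

Lemma card_gadget : #|{: gadget}| = (#|V| ^ (r * r))%N.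
Proof. by rewrite card_ffun card_prod card_ord. Qed.

(** Overwriting entry [k] by an arbitrary vertex while recording its old value, an element of U, is
    injective. *)
Lemma card_gcoord (k : 'I_r * 'I_r) (U : {set V}) (A : {set gadget}) :
  (forall g, g \in A -> g k \in U) ->
  (#|V| * #|A| <= #|U| * #|{: gadget}|)%N.
Proof.
move=> AU; pose upd (p : V * gadget) : V * gadget :=
  (p.2 k, [ffun k' => if k' == k then p.1 else p.2 k']).
have injupd : injective upd.
  move=> [v g] [v' g'] [gk /ffunP gg]; congr (_, _).
    by have := gg k; rewrite !ffunE eqxx.
  by apply/ffunP => k'; have := gg k'; rewrite !ffunE; case: eqP => [->|].
rewrite -[#|V|]cardsT -cardsX -(card_imset _ injupd) -[#|{: gadget}|]cardsT -cardsX.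
apply/subset_leq_card/subsetP => p /imsetP[[v g]]; rewrite !inE /= => gA ->.
by rewrite andbT; apply: AU.
Qed.

Lemma card_gcollide (k k' : 'I_r * 'I_r) : k != k' ->
  (#|V| * #|[set g : gadget | g k == g k']| <= #|{: gadget}|)%N.
Proof.
move=> kk'; pose upd (p : V * gadget) : gadget :=
  [ffun k1 => if k1 == k then p.1 else p.2 k1].
rewrite -[#|V|]cardsT -cardsX -(@card_in_imset _ _ upd) ?max_card //.
move=> [v g] [v' g']; rewrite !inE /= => /eqP gk /eqP g'k /ffunP gg; congr (_, _).
  by have := gg k; rewrite !ffunE eqxx.
apply/ffunP => k1; have [->|k1k] := eqVneq k1 k; last first.
  by have := gg k1; rewrite !ffunE (negPf k1k).
by rewrite gk g'k; have := gg k'; rewrite !ffunE eq_sym (negPf kk').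
Qed.

(** The first column is any tile; then each row is completed independently by a tuple that fits both
    its head and the matching entry of X. *)
Lemma card_serves0 (X : r.-tuple V) (t1 t2 : nat) :
  (t1 <= #|[set s : r.-tuple V | tl s]|)%N ->
  (forall x y, t2 <= #|[set S : q.-tuple V | tl (x :: S) && tl (y :: S)]|)%N ->
  (t1 * t2 ^ r <= #|[set g : gadget | serves0 X g]|)%N.
Proof.
move=> H1 H2.
pose phi (p : r.-tuple V * {ffun 'I_r -> q.-tuple V}) : gadget :=
  [ffun k => if unlift ord0 k.2 is Some j then tnth (p.2 k.1) j else tnth p.1 k.1].
have phi0 p i : phi p (i, ord0) = tnth p.1 i by rewrite ffunE /= unlift_none.
have phiS p i j : phi p (i, lift ord0 j) = tnth (p.2 i) j by rewrite ffunE /= liftK.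
have injphi : injective phi.
  move=> [Y Z] [Y' Z'] /ffunP pp; congr (_, _).
    by apply: eq_from_tnth => i; have := pp (i, ord0); rewrite !phi0.
  by apply/ffunP => i; apply: eq_from_tnth => j; have := pp (i, lift ord0 j); rewrite !phiS.
pose F Y i := [set S : q.-tuple V | tl (tnth Y i :: S) && tl (tnth X i :: S)].
pose A := [set p : r.-tuple V * {ffun 'I_r -> q.-tuple V} |
  tl p.1 && (p.2 \in family (F p.1))].
apply: leq_trans (_ : #|A| <= _)%N.
  have -> : #|A| = (\sum_(Y : r.-tuple V | tl Y) #|family (F Y)|)%N.
    rewrite -sum1_card (eq_bigl (fun p : r.-tuple V * {ffun 'I_r -> q.-tuple V} =>
      tl p.1 && (p.2 \in family (F p.1)))); last first.
      by move=> p; rewrite inE.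
    rewrite -(pair_big_dep (fun Y : r.-tuple V => tl Y) (fun Y Z => Z \in family (F Y)) (fun _ _ => 1%N)) /=.
    by apply: eq_bigr => Y _; rewrite sum1_card.
  apply: leq_trans (_ : \sum_(Y : r.-tuple V | tl Y) t2 ^ r <= _)%N.
    rewrite sum_nat_const leq_mul2r; apply/orP; right; apply: (leq_trans H1).
    by rewrite leq_eqVlt; apply/orP; left; apply/eqP; apply: eq_card => s; rewrite inE.
  apply: leq_sum => Y _; rewrite card_family foldrE big_map big_enum /=.
  rewrite -[X in (_ ^ X)%N](card_ord r) -prod_nat_const.
  by apply: leq_prod => i _; apply: H2.
rewrite -(card_imset _ injphi); apply/subset_leq_card/subsetP => g /imsetP[[Y Z]].
rewrite !inE /= => /andP[tY /familyP FZ] ->; rewrite /serves0.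
have -> : gcol (phi (Y, Z)) = Y.
  by rewrite /gcol (eq_map (phi0 (Y, Z))) map_tnth_enum.
rewrite tY /=; apply/forallP => i; have := FZ i; rewrite inE phi0 /=.
by rewrite /grow (eq_map (phiS (Y, Z) i)) map_tnth_enum.
Qed.

End Tiled.

Lemma expR_beats_power (R : realType) (r : nat) (K theta : R) : 0 < theta ->
  exists n0 : R, forall x, 0 < x -> n0 <= x -> K * x ^+ r < expR (theta * x).
Proof.
move=> t0; pose F : R := (r.+1)`!%:R; have F0 : 0 < F by rewrite ltr0n fact_gt0.
exists (K * F / theta ^+ r.+1) => x x0 xn.
have tx0 : 0 <= theta * x by rewrite mulr_ge0 // ltW.
apply: lt_le_trans (expR_ge1Dxn r tx0).
suff : K * x ^+ r <= (theta * x) ^+ r.+1 / F by rewrite -/F; lra.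
rewrite ler_pdivlMr // exprMn [x ^+ r.+1]exprSr mulrA [leLHS]mulrAC [leRHS]mulrAC.
rewrite ler_pM2r ?exprn_gt0 //; move: xn; rewrite ler_pdivrMr ?exprn_gt0 //.
by rewrite [x * _]mulrC.
Qed.

Lemma card_bigcup_le (I V : finType) (P : pred I) (F : I -> {set V}) :
  (#|\bigcup_(i | P i) F i| <= \sum_(i | P i) #|F i|)%N.
Proof.
elim/big_rec2: _ => [|i n A _ IH]; first by rewrite cards0.
by rewrite (leq_trans _ (leq_add (leqnn _) IH)) // cardsU leq_subr.
Qed.

Section Absorber.

Variables (R : realType) (q : nat).
Local Notation r := q.+1.

(** A proportion [2 * xi] of all arrays satisfies [serves0]. Those with a repeated entry make up at
    most [r ^ 4 / #|V|] and those meeting U at most [r ^ 2 * mu], each at most [xi / 2]. *)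
Lemma many_serving (V : finType) (tl : pred (seq V)) (a c xi mu : R)
    (X : r.-tuple V) (U : {set V}) :
  0 < a -> 0 < c -> #|V|%:R = r%:R * a ->
  (c * a) ^+ r <= #|[set s : r.-tuple V | tl s]|%:R ->
  (forall x y, (c * a) ^+ q <=
     #|[set S : q.-tuple V | tl (x :: S) && tl (y :: S)]|%:R) ->
  2 * xi = (c / r%:R) ^+ (r * r) -> (r * r)%:R * mu <= xi / 2 ->
  (r * r)%:R ^+ 2 / #|V|%:R <= xi / 2 -> #|U|%:R <= mu * #|V|%:R ->
  xi * #|{: gadget V q}|%:R <=
    #|[set g | serves tl X g && [disjoint gsupp g & U]]|%:R.
Proof.
move=> a0 c0 Va H1 H2 xiE kmu kN cU.
pose k := (r * r)%N; pose E : R := #|{: gadget V q}|%:R; pose N : R := #|V|%:R.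
have N0 : 0 < N by rewrite /N Va mulr_gt0.
have [t2 t2l t2u] : exists2 t2 : nat, (c * a) ^+ q <= t2%:R & t2%:R < (c * a) ^+ q + 1 :> R.
  by apply: nat_ceil; rewrite exprn_ge0 // mulr_ge0 // ltW.
have H2' x y : (t2 <= #|[set S : q.-tuple V | tl (x :: S) && tl (y :: S)]|)%N.
  by rewrite -ltnS -(ltr_nat R) -natr1; apply: lt_le_trans t2u _; rewrite lerD2r.
have s0 := card_serves0 X (leqnn _) H2'.
have E0 : 0 <= E by [].
have EN : E = N ^+ k by rewrite /E card_gadget natrX.
have s0R : 2 * xi * E <= #|[set g | serves0 tl X g]|%:R.
  have : (c * a) ^+ r * ((c * a) ^+ q) ^+ r <= #|[set g | serves0 tl X g]|%:R.
    apply: le_trans (_ : (#|[set s : r.-tuple V | tl s]| * t2 ^ r)%:R <= _); last by rewrite ler_nat.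
    have ca0 : 0 <= c * a by rewrite mulr_ge0 // ltW.
    by rewrite natrM natrX ler_pM ?exprn_ge0 // lerXn2r ?nnegrE ?exprn_ge0.
  apply: le_trans; rewrite -exprM -exprD xiE EN /N Va -/k -exprMn.
  have -> : (r + q * r)%N = k by rewrite /k mulSn.
  by rewrite le_eqVlt; apply/orP; left; apply/eqP; congr (_ ^+ _); field; rewrite addrC natr1 pnatr_eq0.
pose C (p : ('I_r * 'I_r) * ('I_r * 'I_r)) := [set g : gadget V q | g p.1 == g p.2].
pose D (p : 'I_r * 'I_r) := [set g : gadget V q | g p \in U].
have cover : [set g | serves0 tl X g] \subset
    [set g | serves tl X g && [disjoint gsupp g & U]] :|:
    ((\bigcup_(p | p.1 != p.2) C p) :|: \bigcup_p D p).
  apply/subsetP => g; rewrite !inE => sg; rewrite /serves sg andbT.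
  have [ig|] := boolP (injectiveb g); last first.
    move=> /injectivePn[x [y xy gxy]]; apply/orP; right; apply/orP; left.
    by apply/bigcupP; exists (x, y) => //; rewrite inE /= gxy.
  have [//|] := boolP [disjoint gsupp g & U].
  rewrite -setI_eq0 => /set0Pn[v]; rewrite inE => /andP[/imsetP[x _ ->] xU].
  by apply/orP; right; apply/orP; right; apply/bigcupP; exists x; rewrite ?inE.
have cC : N * #|\bigcup_(p | p.1 != p.2) C p|%:R <= k%:R ^+ 2 * E.
  apply: le_trans (_ : N * (\sum_(p | p.1 != p.2) #|C p|)%:R <= _).
    by rewrite ler_wpM2l ?(ltW N0) // ler_nat card_bigcup_le.
  rewrite natr_sum mulr_sumr; apply: le_trans (_ : \sum_(p | p.1 != p.2) E <= _).
    by apply: ler_sum => p pp; rewrite -natrM ler_nat card_gcollide.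
  rewrite sumr_const -[leLHS]mulr_natl ler_wpM2r // -natrX ler_nat.
  by rewrite (leq_trans (max_card _)) // !card_prod card_ord expnS expn1.
have cD : N * #|\bigcup_p D p|%:R <= k%:R * #|U|%:R * E.
  apply: le_trans (_ : N * (\sum_p #|D p|)%:R <= _).
    by rewrite ler_wpM2l ?(ltW N0) // ler_nat card_bigcup_le.
  rewrite natr_sum mulr_sumr; apply: le_trans (_ : \sum_(p : 'I_r * 'I_r) #|U|%:R * E <= _).
    apply: ler_sum => p _; rewrite -!natrM ler_nat.
    by apply: (@card_gcoord _ _ p) => g; rewrite inE.
  by rewrite sumr_const -[leLHS]mulr_natl card_prod card_ord mulrA.
have : #|[set g | serves0 tl X g]|%:R <=
    #|[set g | serves tl X g && [disjoint gsupp g & U]]|%:R +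
    (#|\bigcup_(p | p.1 != p.2) C p|%:R + #|\bigcup_p D p|%:R) :> R.
  rewrite -!natrD ler_nat; apply: leq_trans (subset_leq_card cover) _.
  apply: leq_trans (leq_card_setU _ _) _; rewrite leq_add2l; exact: leq_card_setU.
set good := #|[set g | serves tl X g && _]|%:R; rewrite -/E => fin.
have cC' : #|\bigcup_(p | p.1 != p.2) C p|%:R <= xi / 2 * E.
  apply: le_trans (_ : k%:R ^+ 2 / N * E <= _); last by rewrite ler_wpM2r.
  by rewrite mulrAC ler_pdivlMr // mulrC.
have cD' : #|\bigcup_p D p|%:R <= xi / 2 * E.
  apply: le_trans (_ : k%:R * mu * E <= _); last by rewrite ler_wpM2r.
  rewrite -(ler_pM2l N0); apply: (le_trans cD).
  have -> : N * (k%:R * mu * E) = k%:R * (mu * N) * E by ring.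
  by rewrite ler_wpM2r // ler_wpM2l.
by lra.
Qed.

Lemma uniq_flatten_gverts (V : finType) (es : seq (gadget V q)) :
  pairwise (fun e e' : gadget V q => [disjoint gsupp e & gsupp e']) es ->
  (forall e, e \in es -> injective e) -> uniq (flatten (map (@gverts V q) es)).
Proof.
elim: es => //= e es IH /andP[de pes] inj; rewrite cat_uniq gverts_uniq /=; last by apply: inj; rewrite mem_head.
rewrite IH //; last by move=> e' e'es; apply: inj; rewrite inE e'es orbT.
rewrite andbT; apply/hasPn => v /flatten_mapP[e' e'es]; rewrite !mem_gverts => ve'.
have := allP de e' e'es; rewrite disjoint_sym => /disjoint_setI0/setP/(_ v).
by rewrite !inE ve' /= => ->.
Qed.

Lemma absorber (c mu0 : R) : 0 < c -> 0 < mu0 ->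
  exists omega n0 : R, 0 < omega /\
  forall (V : finType) (tl : pred (seq V)) (a : R), 0 < a ->
  #|V|%:R = r%:R * a -> n0 <= #|V|%:R ->
  (c * a) ^+ r <= #|[set s : r.-tuple V | tl s]|%:R ->
  (forall x y, (c * a) ^+ q <=
     #|[set S : q.-tuple V | tl (x :: S) && tl (y :: S)]|%:R) ->
  exists M : seq V, [/\ uniq M, (size M)%:R <= mu0 * #|V|%:R &
    forall L : seq V, (r %| size L)%N -> (size L)%:R <= omega * #|V|%:R ->
    tiled tl (L ++ M)].
Proof.
move=> c0 mu00; pose k := (r * r)%N; have k0 : 0 < k%:R :> R by [].
pose xi := (c / r%:R) ^+ k / 2; have xi0 : 0 < xi by rewrite divr_gt0 // exprn_gt0 // divr_gt0.
pose mu := Num.min mu0 (xi / (2 * k%:R)).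
have mu1 : 0 < mu by rewrite lt_min mu00 divr_gt0 // mulr_gt0.
have muk : k%:R * mu <= xi / 2.
  rewrite mulrC -ler_pdivlMr //; have -> : xi / 2 / k%:R = xi / (2 * k%:R) by rewrite invfM mulrA.
  by rewrite ge_min lexx orbT.
(* At least [mu * N / (2 * k)] gadgets are chosen, so the weights shrink by [expR (- (2 * th * N))].
   Half of this exponent pays for serving about [th * N] times, the other half for the [N ^+ r]
   tuples. *)
pose th := xi * mu / (8 * k%:R); have th0 : 0 < th by apply: divr_gt0; apply: mulr_gt0.
have [n1 Hn1] := expR_beats_power r (expR 1) th0.
pose n0 := Num.max n1 (Num.max (k%:R ^+ 2 / (xi / 2)) (4 * k%:R / mu)).
exists th, n0; split=> // V tl a a0 Va n0N H1 H2.
set N : R := #|V|%:R in Va n0N *.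
have N0 : 0 < N by rewrite Va mulr_gt0.
have [nN1 nN2 nN3] : [/\ n1 <= N, k%:R ^+ 2 / (xi / 2) <= N & 4 * k%:R / mu <= N].
  by split; apply: le_trans n0N; rewrite !le_max lexx ?orbT.
have kN : k%:R ^+ 2 / N <= xi / 2.
  by rewrite ler_pdivrMr // mulrC -ler_pdivrMr // divr_gt0.
have [m m1 m2] : exists2 m : nat, mu * N / (2 * k%:R) <= m%:R & m%:R <= mu * N / k%:R :> R.
  have x0 : 0 <= mu * N / (2 * k%:R) by rewrite divr_ge0 ?mulr_ge0 ?(ltW mu1) ?(ltW N0).
  have [m m1 m2] := nat_ceil x0; exists m => //; apply: (le_trans (ltW m2)).
  have h : mu * N / k%:R = mu * N / (2 * k%:R) + mu * N / (2 * k%:R).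
    by field; rewrite gt_eqF.
  rewrite h lerD2l ler_pdivlMr ?mulr_gt0 // mul1r.
  move: nN3; rewrite ler_pdivrMr // mulrC; have := k0; lra.
have [cn cn1 cn2] : exists2 cn : nat, th * N <= cn%:R & cn%:R < th * N + 1 :> R.
  by apply: nat_ceil; rewrite mulr_ge0 // ltW.
have Q0 : (0 < #|{: r.-tuple V}|)%N by rewrite card_tuple expn_gt0 -(ltr_nat R) N0.
have E0 : (0 < #|{: gadget V q}|)%N by rewrite card_gadget expn_gt0 -(ltr_nat R) N0.
have suppk (e : gadget V q) : (#|gsupp e| <= k)%N.
  by rewrite (leq_trans (leq_imset_card _ _)) // card_prod card_ord.
have dm : (k * m)%:R <= mu * N.
  by move: m2; rewrite ler_pdivlMr // natrM mulrC.
have HH (U : {set V}) (X : r.-tuple V) : #|U|%:R <= mu * N ->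
    xi * #|{: gadget V q}|%:R <=
    #|[set g | serves tl X g && [disjoint gsupp g & U]]|%:R.
  have xiE : 2 * xi = (c / r%:R) ^+ (r * r) by rewrite /xi -/k; field.
  move=> hU; exact: (@many_serving V tl a c xi mu X U a0 c0 Va H1 H2 xiE muk kN hU).
have xile1 : xi <= 1.
  have /card_gt0P[X _] := Q0.
  have ER : 0 < #|{: gadget V q}|%:R :> R by rewrite ltr0n.
  rewrite -(ler_pM2r ER) mul1r; apply: le_trans (HH set0 X _) _.
    by rewrite cards0 mulr_ge0 // ltW.
  by rewrite ler_nat max_card.
have small : #|{: r.-tuple V}|%:R * (1 - xi / 2) ^+ m * 2 ^+ cn < 1 :> R.
  rewrite card_tuple natrX -/N.
  have x1 : 0 <= 1 - xi / 2 by lra.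
  have e1 : (1 - xi / 2) ^+ m <= expR (- (2 * th * N)).
    apply: le_trans (_ : expR (- (xi / 2)) ^+ m <= _).
      by rewrite lerXn2r ?nnegrE ?expR_ge0 // expR_ge1Dx.
    rewrite -expRM_natl ler_expR mulrN lerN2.
    have -> : 2 * th * N = xi / 2 * (mu * N / (2 * k%:R)).
      by rewrite /th; field; rewrite gt_eqF.
    by rewrite mulrC ler_wpM2r // divr_ge0 // ltW.
  have e2 : 2 ^+ cn <= expR (th * N + 1).
    apply: le_trans (_ : expR 1 ^+ cn <= _).
      by rewrite lerXn2r ?nnegrE ?expR_ge0 //; apply: le_trans (expR_ge1Dx 1); lra.
    by rewrite -expRM_natl mulr1 ler_expR ltW.
  have e3 : expR 1 * N ^+ r < expR (th * N) by apply: Hn1.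
  have f1 : 0 <= N ^+ r * (1 - xi / 2) ^+ m by rewrite mulr_ge0 ?exprn_ge0 // ltW.
  have f2 : 0 <= 2 ^+ cn :> R by rewrite exprn_ge0.
  have f3 : N ^+ r * (1 - xi / 2) ^+ m <= N ^+ r * expR (- (2 * th * N)).
    by rewrite ler_wpM2l // exprn_ge0 // ltW.
  apply: le_lt_trans (ler_pM f1 f2 f3 e2) _.
  have -> : N ^+ r * expR (- (2 * th * N)) * expR (th * N + 1) =
      (expR 1 * N ^+ r) * expR (- (th * N)).
    have E : expR (- (2 * th * N)) * expR (th * N + 1) = expR 1 * expR (- (th * N)).
      by rewrite -!expRD; congr expR; ring.
    by rewrite -(mulrA (N ^+ r)) E; ring.
  by rewrite expRN ltr_pdivrMr ?expR_gt0 // mul1r.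
have [es [ses pes Hes Hc]] := serving_family xi0 Q0 E0 suppk dm HH small.
exists (flatten (map (@gverts V q) es)); split.
- apply: uniq_flatten_gverts => // e ees; apply/injectiveP.
  by have [X /andP[]] := Hes e ees.
- apply: le_trans (_ : mu * N <= _); last by rewrite ler_wpM2r ?(ltW N0) // ge_min lexx.
  apply: le_trans dm; rewrite ler_nat -ses.
  elim: (es) => //= e es' IH; rewrite size_cat mulnS leq_add //.
  by rewrite gverts_allpairs size_map size_allpairs !size_enum_ord.
move=> L /dvdnP[l Ll] Lom; have [Xs <- sXs] := chop_tuples Ll.
apply: tiled_absorb_all => // X _; apply: leq_trans (ltnW (Hc X)).
rewrite sXs -(ler_nat R); apply: le_trans cn1; apply: le_trans Lom.
by rewrite Ll ler_nat leq_pmulr.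
Qed.

End Absorber.

(** * Perfect packings *)

(** The slack [nu] must precede [om]: removing the absorber consumes part of [nu], and [om] depends
    on the size of the absorber. *)
Lemma almost_packing (R : realType) (r : nat) (alpha gamma : R) :
  (3 <= r)%N -> 0 < alpha -> 0 < gamma ->
  exists2 nu : R, 0 < nu & forall om : R, 0 < om -> om <= 1 ->
  exists n0 : R, forall (W V : finType) (T : rel W) (G : rel V) (a : R) (l : seq W),
  (forall w w', w != w' -> T w w' = ~~ T w' w) -> irreflexive T -> irreflexive G ->
  0 < a -> #|V|%:R = r%:R * a -> n0 <= #|V|%:R -> codeg_le G ((1 + nu) * a) ->
  nonext G a alpha gamma ->
  perm_eq l (enum W) -> trans_prefix T l -> size l = r ->
  exists (ps : seq (seq V)) (U : {set V}), [/\ all (tile T G) ps,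
    perm_eq (flatten ps ++ enum U) (enum V) & #|U|%:R <= om * #|V|%:R].
Proof.
move=> r3 alpha0 gamma0.
have [c [c0 c1 Hc]] := low_cost_distribution r3 alpha0 gamma0.
exists c => // om om0 om1.
have r0 : (0 < r)%N by apply: leq_trans r3.
have rR : 0 < r%:R :> R by rewrite ltr0n.
pose C1 := (r%:R / c) ^+ r; have C10 : 0 < C1 by rewrite exprn_gt0 // divr_gt0.
have C0 : 0 <= C1 * r%:R by rewrite mulr_ge0 // ltW.
have [delta [n1 [d0 Hn]]] := nibble r.-1 C0 om0 om1.
exists (Num.max n1 (4 * r%:R)) => W V T G a l tourT irrT irrG a0 Va.
rewrite ge_max => /andP[n1N rN] dG xG pl tl sl.
have N0 : 0 < #|V|%:R :> R by rewrite Va mulr_gt0.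
have a4 : 4 <= a by move: rN; rewrite Va mulrC ler_pM2l.
pose P (s : r.-tuple V) := tile T G s.
have cW : #|W| = r by rewrite -sl (perm_size pl) cardE.
have PU (s : r.-tuple V) : P s -> uniq s /\ size s = r.
  by move=> ts; rewrite size_tuple; split=> //; apply: (tile_uniq tourT irrT irrG ts).
have bE : (c * a) ^- r = C1 / #|V|%:R ^+ r.
  rewrite /C1 Va !exprMn exprVn; field.
  by rewrite !expf_neq0 ?gt_eqF.
have low y := Hc W V T G a l y tourT irrT irrG a4 Va dG xG pl tl sl.
have degs p : distribution P ((c * a) ^- r) p -> (forall v, wdeg val p v <= C1 * r%:R / #|V|%:R) /\
    (forall u v, u != v -> wcodeg val p u v <= C1 * r%:R ^+ 2 / #|V|%:R ^+ 2).
  by rewrite bE; apply: distribution_wdeg => //; apply: ltW.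
have degC p : distribution P ((c * a) ^- r) p -> forall v, wdeg val p v <= C1 * r%:R / #|V|%:R.
  by case/degs.
have [p dp reg] := near_regular r0 N0 d0 C0 PU degC low.
(* This scaling makes the average weighted degree equal to 1. *)
pose w e := #|V|%:R / r%:R * p e.
have Nr0 : 0 < #|V|%:R / r%:R :> R by rewrite divr_gt0.
have [p0 _ pP] := dp.
have wE v : wdeg val w v = #|V|%:R / r%:R * wdeg val p v.
  by rewrite mulr_sumr; apply: eq_bigr => e _; rewrite mulrA.
have w0 e : 0 <= w e by rewrite mulr_ge0 ?(ltW Nr0) //; have /andP[] := p0 e.
have wP e : 0 < w e -> P e by rewrite /w pmulr_rgt0 // => /pP.
have wfU e : 0 < w e -> uniq (val e) /\ size (val e) = r.-1.+1.
  by move=> /wP/PU; rewrite prednK.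
have [d1 d2] := degs p dp.
have wC v : wdeg val w v <= C1 * r%:R.
  rewrite wE; apply: le_trans (_ : #|V|%:R / r%:R * (C1 * r%:R / #|V|%:R) <= _).
    by rewrite ler_wpM2l // ltW.
  have -> : #|V|%:R / r%:R * (C1 * r%:R / #|V|%:R) = C1 by field; rewrite !gt_eqF.
  by rewrite ler_peMr ?(ltW C10) // ler1n.
have wcC u v : u != v -> wcodeg val w u v <= C1 * r%:R / #|V|%:R.
  move=> uv; have -> : wcodeg val w u v = #|V|%:R / r%:R * wcodeg val p u v.
    by rewrite mulr_sumr; apply: eq_bigr => e _; rewrite mulrA.
  apply: le_trans (_ : #|V|%:R / r%:R * (C1 * r%:R ^+ 2 / #|V|%:R ^+ 2) <= _).
    by rewrite ler_wpM2l ?d2 // ltW.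
  by rewrite le_eqVlt; apply/orP; left; apply/eqP; field; rewrite !gt_eqF.
have wreg : \sum_v (wdeg val w v - 1) ^+ 2 <= delta * #|V|%:R.
  by under eq_bigr do rewrite wE.
have [es [U [pes pU cU]]] := Hn V _ val w N0 n1N w0 wfU wC wcC wreg.
exists (map val es), U; split=> //.
by apply/allP => s /mapP[e ees ->]; apply: wP; apply: (allP pes).
Qed.

(** * Passing to the vertices outside the absorber *)

Section Induced.

Variables (R : realType) (W V V' : finType) (T : rel W) (G : rel V) (f : V' -> V).
Hypothesis injf : injective f.

Lemma okl_relpre l (B : W -> {set V'}) (B' : W -> {set V}) s :
  (forall w v, v \in B w -> f v \in B' w) ->
  okl T (relpre f G) l B s -> okl T G l B' (map f s).
Proof.
elim: l B B' s => [|w l IH] B B' [|v s] //= BB' /andP[vB ok].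
rewrite BB' //=; apply: IH ok => u v'; rewrite !inE => /andP[/BB'-> /=].
by rewrite /nb; case: ifP; rewrite !inE.
Qed.

Lemma tile_relpre s : tile T (relpre f G) s -> tile T G (map f s).
Proof.
move=> /hasP[l pl ok]; apply/hasP; exists l => //.
by apply: okl_relpre ok => w v _; rewrite inE.
Qed.

Lemma codeg_le_relpre (A : R) : codeg_le G A -> codeg_le (relpre f G) A.
Proof.
move=> dG v; have [d1 d2] := dG (f v).
by split; [apply: le_trans d1|apply: le_trans d2]; rewrite ler_nat -(card_imset _ injf);
  apply/subset_leq_card/subsetP => x /imsetP[y]; rewrite !inE => yv ->.
Qed.

Lemma card_edgeset_relpre (S : {set V'}) :
  #|edgeset (relpre f G) S| = #|edgeset G (f @: S)|.
Proof.
pose ff p := (f p.1, f p.2).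
have injff : injective ff by move=> [x y] [x' y'] [/injf-> /injf->].
rewrite -(card_imset _ injff); apply: eq_card => -[x y]; apply/imsetP/idP.
  move=> [[x' y']]; rewrite !inE /= => /and3P[xS yS xy] [-> ->].
  by rewrite !imset_f.
rewrite !inE /= => /and3P[/imsetP[x' x'S ->] /imsetP[y' y'S ->] xy].
by exists (x', y'); rewrite // !inE x'S y'S.
Qed.

End Induced.

Lemma perfect_tiling (R : realType) (r : nat) (alpha gamma : R) :
  (3 <= r)%N -> 0 < alpha -> 0 < gamma ->
  exists2 nu : R, 0 < nu & exists n0 : R,
  forall (W V : finType) (T : rel W) (G : rel V) (a : R) (l : seq W),
  (forall w w', w != w' -> T w w' = ~~ T w' w) -> irreflexive T -> irreflexive G ->
  0 < a -> #|V|%:R = r%:R * a -> (r %| #|V|)%N -> n0 <= #|V|%:R ->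
  codeg_le G ((1 + nu) * a) -> nonext G a alpha gamma ->
  perm_eq l (enum W) -> trans_prefix T l -> size l = r ->
  tiled (tile T G) (enum V).
Proof.
move=> r3 alpha0 gamma0; have r0 : (0 < r)%N by apply: leq_trans r3.
have rR : 0 < r%:R :> R by rewrite ltr0n.
(* Halved constants, as the packing is found outside the absorber, where [a] is replaced by a
   slightly smaller [a']. *)
have [nu nu0 Hpack] := almost_packing r3 (divr_gt0 alpha0 (ltr0n R 2)) (divr_gt0 gamma0 (ltr0n R 2)).
have [c1 [c10 c11 Hex]] := exchange_pairs r3 alpha0 gamma0.
have [c2 [c20 c21 Hcnt]] := cnt_large (ltnW r3) alpha0 gamma0.
pose c := Num.min c1 c2.
have c0 : 0 < c by rewrite lt_min c10.
have [cc1 cc2] : c <= c1 /\ c <= c2 by rewrite !ge_min !lexx orbT.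
pose nu1 := Num.min 1 nu.
have nu10 : 0 < nu1 by rewrite lt_min ltr01.
have [nu11 nu1nu] : nu1 <= 1 /\ nu1 <= nu by rewrite !ge_min !lexx orbT.
(* The bounds on the absorber keep, in this order, the degree condition with [nu], [nonext] with
   halved constants, and three quarters of the vertices. *)
pose mu := Num.min (nu1 / 4) (Num.min (alpha / 4) (4^-1)).
have mu0 : 0 < mu by rewrite !lt_min !divr_gt0 //=; lra.
have [muN muA mu4] : [/\ mu <= nu1 / 4, mu <= alpha / 4 & mu <= 4^-1].
  by rewrite /mu !ge_min !lexx !orbT.
have rE : r.-1.+1 = r by rewrite prednK.
have := @absorber R r.-1 c mu c0 mu0; rewrite rE => -[om [n1 [om0 Habs]]].
pose om1 := Num.min 1 om.
have om10 : 0 < om1 by rewrite lt_min ltr01.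
have [om11 om1om] : om1 <= 1 /\ om1 <= om by rewrite !ge_min !lexx orbT.
have [n2 Hn2] := Hpack om1 om10 om11.
exists (Num.min (nu1 / 4) c); first by rewrite lt_min divr_gt0.
exists (Num.max n1 (2 * n2)) => W V T G a l tourT irrT irrG a0 Va rV.
rewrite ge_max => /andP[nN1 nN2] dG xG pl tl sl.
have N0 : 0 < #|V|%:R :> R by rewrite Va mulr_gt0.
have dGle x : Num.min (nu1 / 4) c <= x -> codeg_le G ((1 + x) * a).
  move=> hx v; have [d1 d2] := dG v.
  have : Num.min (nu1 / 4) c * a <= x * a by rewrite ler_wpM2r // ltW.
  by split; [apply: (le_trans d1)|apply: (le_trans d2)]; lra.
have tiles : (c * a) ^+ r <= #|[set s : r.-tuple V | tile T G s]|%:R.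
  apply: le_trans (_ : (c2 * a) ^+ size l <= _).
    by rewrite sl lerXn2r ?nnegrE ?mulr_ge0 ?(ltW c0) ?(ltW c20) ?(ltW a0) // ler_wpM2r // ltW.
  apply: le_trans (Hcnt W V T G a l setT tourT a0 Va (dGle _ _) xG _ tl _ _) _.
  - by rewrite ge_min cc2 orbT.
  - by rewrite (perm_uniq pl) enum_uniq.
  - by rewrite sl.
  - rewrite cardsT Va ler_wpM2r ?(ltW a0) // sl; have : r.-1%:R + 1 = r%:R :> R by rewrite natr1 rE.
    by have := c20; lra.
  rewrite (cnt_card _ _ _ sl) ler_nat; apply/subset_leq_card/subsetP => s.
  by rewrite !inE => ok; apply: (tile_subdigraph pl ok).
have exch x y : (c * a) ^+ r.-1 <=
    #|[set S : r.-1.-tuple V | tile T G (x :: S) && tile T G (y :: S)]|%:R.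
  apply: le_trans (_ : (c1 * a) ^+ r.-1 <= _).
    by rewrite lerXn2r ?nnegrE ?mulr_ge0 ?(ltW c0) ?(ltW c10) ?(ltW a0) // ler_wpM2r // ltW.
  by apply: (Hex W V T G a l) => //; apply: dGle; rewrite ge_min cc1 orbT.
have [M [uM sM HM]] := Habs V (tile T G) a a0 Va nN1 tiles exch.
have cW : #|W| = r by rewrite -sl (perm_size pl) cardE.
have tdvd s : tiled (tile T G) s -> (r %| size s)%N.
  move=> [ps tps /perm_size <-]; elim: ps tps => //= s' ps IH /andP[ts' tps].
  by rewrite size_cat dvdn_add ?IH // (tile_size ts') cW.
(* M is itself tiled, since it can absorb the empty sequence. *)
have rM : (r %| size M)%N.
  by apply: (tdvd M); apply: (HM [::]); rewrite ?dvdn0 //= mulr_ge0 // ltW.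
pose V' : finType := {v : V | v \notin M}.
pose f (v : V') : V := val v.
have injf : injective f := val_inj.
have mapV' : perm_eq (map f (enum V') ++ M) (enum V).
  apply: uniq_perm; rewrite ?enum_uniq //.
    rewrite cat_uniq map_inj_uniq // enum_uniq uM andbT /=.
    by apply/hasPn => v vM; apply/mapP => -[v' _ vE]; have := valP v'; rewrite -/(f v') -vE vM.
  move=> v; rewrite mem_cat mem_enum; have [vM|vM] := boolP (v \in M); first by rewrite orbT.
  by rewrite orbF inE; apply/mapP; exists (Sub v vM : V'); rewrite ?mem_enum.
have cV' : (#|V'| + size M = #|V|)%N.
  by rewrite [#|V|]cardE -(perm_size mapV') size_cat size_map -cardE.
have cV'R : #|V'|%:R = #|V|%:R - (size M)%:R :> R by rewrite -cV' natrD addrK.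
pose a' : R := #|V'|%:R / r%:R.
have V'a : #|V'|%:R = r%:R * a' by rewrite /a' mulrC divfK // gt_eqF.
have a'a : a' <= a.
  by rewrite /a' ler_pdivrMr // mulrC -Va ler_nat -cV' leq_addr.
have aa' : (1 - mu) * a <= a'.
  rewrite /a' ler_pdivlMr // cV'R.
  have -> : (1 - mu) * a * r%:R = #|V|%:R - mu * #|V|%:R by rewrite Va; ring.
  by rewrite lerD2l lerN2.
have a'0 : 0 < a' by apply: lt_le_trans aa'; rewrite mulr_gt0 //; lra.
have dG' : codeg_le (relpre f G) ((1 + nu) * a').
  have h : (1 + nu1 / 4) * a <= (1 + nu) * a'.
    apply: le_trans (_ : (1 + nu1) * a' <= _); last by rewrite ler_wpM2r ?(ltW a'0) // lerD2l.
    apply: le_trans (_ : (1 + nu1) * ((1 - mu) * a) <= _); last by rewrite ler_wpM2l //; lra.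
    rewrite mulrA ler_wpM2r ?(ltW a0) //.
    have : mu * (1 + nu1) <= nu1 / 4 * 2 by rewrite ler_pM //; lra.
    by lra.
  have d : codeg_le G ((1 + nu1 / 4) * a) by apply: dGle; rewrite ge_min lexx.
  move=> v; have [d1 d2] := codeg_le_relpre injf d v.
  by split; [apply: (le_trans d1)|apply: (le_trans d2)].
have xG' : nonext (relpre f G) a' (alpha / 2) (gamma / 2).
  move=> S hS; rewrite card_edgeset_relpre //; apply: le_trans (xG (f @: S) _).
    apply: le_trans (_ : gamma * a' ^+ 2 <= _).
      by rewrite ler_wpM2r ?sqr_ge0 //; lra.
    by rewrite ler_wpM2l ?(ltW gamma0) // lerXn2r ?nnegrE // ?ltW.
  rewrite card_imset //; apply: le_trans hS.
  have [al1|al1] := lerP (1 - alpha / 2) 0.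
    apply: le_trans (_ : (1 - alpha / 2) * a <= _).
      by rewrite ler_wpM2r ?(ltW a0) //; lra.
    by rewrite ler_wnM2l.
  apply: le_trans (_ : (1 - alpha / 2) * ((1 - mu) * a) <= _); last by rewrite ler_wpM2l // ltW.
  rewrite mulrA ler_wpM2r ?(ltW a0) //.
  have : 0 <= alpha * mu by rewrite mulr_ge0 // ltW.
  by lra.
have nV' : n2 <= #|V'|%:R.
  have : mu * #|V|%:R <= 4^-1 * #|V|%:R by rewrite ler_wpM2r.
  by rewrite cV'R; move: sM nN2; lra.
have irrG' : irreflexive (relpre f G) by move=> v; rewrite /= irrG.
have [ps [U [tps pU cU]]] := Hn2 W V' T (relpre f G) a' l tourT irrT irrG' a'0 V'a nV' dG' xG' pl tl sl.
pose ps' := map (map f) ps; pose L := map f (enum U).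
have tps' : tiled (tile T G) (flatten ps').
  by exists ps' => //; apply/allP => s /mapP[s' s'ps ->]; apply: tile_relpre; apply: (allP tps).
have pall : perm_eq (flatten ps' ++ (L ++ M)) (enum V).
  apply: perm_trans mapV'; rewrite catA perm_cat2r /ps' /L -map_flatten -map_cat.
  exact: perm_map.
have rL : (r %| size L)%N.
  have := perm_size pall; rewrite !size_cat -cardE => e.
  have := rV; rewrite -e addnA dvdn_addl // dvdn_addr //; exact: tdvd.
apply: tiled_perm pall _; apply: (tiled_cat tps'); apply: HM => //.
rewrite size_map -cardE; apply: (le_trans cU).
by rewrite ler_pM ?(ltW om10) // ler_nat -cV' leq_addr.
Qed.

(** * From semidegree and independent sets to [codeg_le] and [nonext] *)

Section Bridge.

Variables (R : realType) (V : finType) (G : digraph V).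

Lemma bigminn_le (I : eqType) (s : seq I) (F : I -> nat) (n : nat) i :
  i \in s -> (\big[minn/n]_(j <- s) F j <= F i)%N.
Proof.
elim: s => // j s IH; rewrite inE big_cons => /orP[/eqP->|/IH]; first exact: geq_minl.
by apply: leq_trans; apply: geq_minr.
Qed.

Lemma codeg_le_semidegree (r : nat) (eps : R) : (0 < r)%N ->
  (1 - r%:R^-1 - eps) * #|V|%:R <= (min_semidegree G)%:R ->
  codeg_le G ((1 + r%:R * eps) * (#|V|%:R / r%:R)).
Proof.
move=> r0 hd v; have rR : r%:R != 0 :> R by rewrite pnatr_eq0 -lt0n.
have key (A : {set V}) : (min_semidegree G <= #|A|)%N ->
    #|~: A|%:R <= (1 + r%:R * eps) * (#|V|%:R / r%:R).
  move=> dA; have : (min_semidegree G)%:R <= #|A|%:R :> R by rewrite ler_nat.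
  have : #|A|%:R + #|~: A|%:R = #|V|%:R :> R by rewrite -natrD cardsC.
  have -> : (1 + r%:R * eps) * (#|V|%:R / r%:R) = (r%:R^-1 + eps) * #|V|%:R by field.
  by move: hd; lra.
split.
  have -> : [set x | ~~ G v x] = ~: [set x | G v x] by apply/setP => x; rewrite !inE.
  apply: key; apply: leq_trans (geq_minl _ _) _.
  by apply: (bigminn_le (outdegree G)); apply: mem_index_enum.
have -> : [set x | ~~ G x v] = ~: [set x | G x v] by apply/setP => x; rewrite !inE.
apply: key; apply: leq_trans (geq_minr _ _) _.
by apply: (bigminn_le (indegree G)); apply: mem_index_enum.
Qed.

(* A set of size just below n / r is enlarged to one of size n / r; each added
   vertex contributes at most 2n edges. *)
Lemma nonext_independent (r : nat) (gamma : R) : (2 <= r)%N -> 0 < gamma ->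
  (r %| #|V|)%N ->
  ~ (exists2 S : {set V}, independent_upto G gamma S &
       #|V|%:R / r%:R <= #|S|%:R :> R) ->
  nonext G (#|V|%:R / r%:R) (gamma / 4) gamma.
Proof.
move=> r2 g0 /dvdnP[k Vk] noind S hS.
have r0 : 0 < r%:R :> R by rewrite ltr0n ltnW.
have aE : #|V|%:R / r%:R = k%:R :> R by rewrite Vk natrM mulfK // gt_eqF.
have NE : #|V|%:R = r%:R * k%:R :> R by rewrite Vk natrM mulrC.
have r2R : 2 <= r%:R :> R by rewrite ler_nat.
have big (S' : {set V}) : (k <= #|S'|)%N -> gamma * #|V|%:R ^+ 2 < #|edgeset G S'|%:R.
  move=> kS; rewrite ltNge; apply/negP => ind; apply: noind; exists S' => //.
  by rewrite aE ler_nat.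
have k0 : 0 <= k%:R :> R by [].
have kk0 : 0 <= gamma * k%:R ^+ 2 by rewrite mulr_ge0 ?sqr_ge0 // ltW.
have rr : 2 * r%:R * (gamma * k%:R ^+ 2) <= r%:R ^+ 2 * (gamma * k%:R ^+ 2).
  by rewrite ler_wpM2r // expr2 ler_wpM2r // ltW.
have rr' : 2 * (gamma * k%:R ^+ 2) <= r%:R * (gamma * k%:R ^+ 2) by rewrite ler_wpM2r.
rewrite aE in hS *; have [kS|Sk] := leqP k #|S|.
  by apply: le_trans (ltW (big S kS)); rewrite NE exprMn mulrCA; lra.
pose D := [set x in take (k - #|S|) (enum (~: S))].
have sD : (k - #|S| <= size (enum (~: S)))%N.
  rewrite -cardE -(leq_add2l #|S|) cardsC subnKC ?(ltnW Sk) // Vk leq_pmulr //.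
  exact: ltnW.
have cD : #|D| = (k - #|S|)%N.
  rewrite cardsE (card_uniqP _) ?take_uniq ?enum_uniq // size_takel //.
have SD : [disjoint S & D].
  apply/pred0P => x /=; rewrite inE; apply/negP => /andP[xS /mem_take].
  by rewrite mem_enum inE xS.
have cSD : #|S :|: D| = k.
  by rewrite cardsU (disjoint_setI0 SD) cards0 subn0 cD subnKC // ltnW.
have cover : edgeset G (S :|: D) \subset
    edgeset G S :|: (setX D setT :|: setX setT D).
  apply/subsetP => -[x y]; rewrite !inE /= => /and3P[/orP[xS|xD] /orP[yS|yD] xy];
    rewrite ?xS ?yS ?xD ?yD ?xy ?orbT ?andbT ?andTb ?orbT //=.
have cE : (#|edgeset G (S :|: D)| <= #|edgeset G S| + (#|D| * #|V| + #|V| * #|D|))%N.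
  apply: leq_trans (subset_leq_card cover) _; apply: leq_trans (leq_card_setU _ _) _.
  rewrite leq_add2l; apply: leq_trans (leq_card_setU _ _) _.
  by rewrite !cardsX cardsT.
have cER : #|edgeset G (S :|: D)|%:R <= #|edgeset G S|%:R + 2 * #|D|%:R * #|V|%:R :> R.
  have := cE; rewrite -(ler_nat R) !natrD !natrM; lra.
have DR : #|D|%:R = k%:R - #|S|%:R :> R by rewrite cD natrB // ltnW.
have hD : #|D|%:R <= gamma / 4 * k%:R by rewrite DR; lra.
have hDV : 2 * #|D|%:R * #|V|%:R <= 2 * (gamma / 4 * k%:R) * #|V|%:R.
  by rewrite ler_wpM2r // ler_wpM2l.
have := big (S :|: D); rewrite cSD leqnn => /(_ isT).
rewrite NE in cER hDV *; rewrite exprMn.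
have -> : gamma * (r%:R ^+ 2 * k%:R ^+ 2) = r%:R ^+ 2 * (gamma * k%:R ^+ 2) by ring.
have e2 : 2 * (gamma / 4 * k%:R) * (r%:R * k%:R) = r%:R / 2 * (gamma * k%:R ^+ 2) by field.
by move: hDV; rewrite e2; lra.
Qed.

End Bridge.

(** * The pattern tournament and the resulting set of copies *)

Section Packing.

Variables (W V : finType) (T : digraph W) (G : digraph V).
Hypothesis tourT : tournament T.

(** Without a transitive triangle no vertex has two outneighbours or two inneighbours, so three
    vertices form a directed cycle and there is no room for a fourth. *)
Lemma transitive_enum : (2 < #|W|)%N -> ~ digraph_iso T C3 ->
  exists2 l, perm_eq l (enum W) & trans_prefix T l.
Proof.
move=> /card_gt2P[x [y [z [_ [xy yz zx]]]]] notC3.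
have [/existsP[u1 /existsP[u2 /existsP[u3 tr]]]|/existsPn noTT] :=
  boolP [exists u1, exists u2, exists u3, [&& T u1 u2, T u1 u3 & T u2 u3]].
  have /and3P[t12 t13 t23] := tr.
  have ne u v : T u v -> u != v by apply: contraTneq => ->; rewrite edge_irr.
  exists [:: u1, u2, u3 & [seq w <- enum W | w \notin [:: u1; u2; u3]]] => //.
  apply: uniq_perm; rewrite ?enum_uniq //.
    rewrite -[_ :: _]/([:: u1; u2; u3] ++ _) cat_uniq filter_uniq ?enum_uniq // andbT.
    rewrite /= !inE negb_or !ne //=; apply/hasPn => w; rewrite mem_filter => /andP[].
    by rewrite !inE.
  move=> w; rewrite -[_ :: _]/([:: u1; u2; u3] ++ _) mem_cat mem_filter mem_enum andbT.
  by rewrite orbN.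
case: notC3.
have noT u1 u2 u3 : T u1 u2 -> T u1 u3 -> T u2 u3 -> False.
  move=> t12 t13 t23; have := noTT u1 => /existsPn/(_ u2)/existsPn/(_ u3).
  by rewrite t12 t13 t23.
have out u v w : T u v -> T u w -> v = w.
  move=> uv uw; apply/eqP; apply: contraT => vw.
  have [tvw|] := boolP (T v w); first by case: (noT u v w).
  by rewrite tourT // negbK => twv; case: (noT u w v).
have inn u v w : T v u -> T w u -> v = w.
  move=> vu wu; apply/eqP; apply: contraT => vw.
  have [tvw|] := boolP (T v w); first by case: (noT v w u).
  by rewrite tourT // negbK => twv; case: (noT w v u).
have [x1 [y1 [z1 [xy1 yz1 zx1]]]] : exists x y z, [/\ T x y, T y z & T z x].
  have third u v w : T u v -> v != w -> w != u -> [/\ T u v, T v w & T w u].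
    move=> uv vw wu; split=> //.
      by rewrite tourT //; apply: contra wu => wv; apply/eqP; apply: (inn v).
    by rewrite tourT //; apply: contra vw => uw; apply/eqP; apply: (out u).
  have [txy|] := boolP (T x y); first by exists x, y, z; apply: third.
  by rewrite tourT // negbK => tyx; exists y, x, z; apply: third => //; rewrite eq_sym.
have all3 w : [|| w == x1, w == y1 | w == z1].
  have [//|wx] := eqVneq w x1; have [txw|] := boolP (T x1 w).
    by rewrite (out _ _ _ txw xy1) eqxx orbT.
  by rewrite tourT 1?eq_sym // negbK => twx; rewrite (inn _ _ _ twx zx1) eqxx !orbT.
have ne u v : T u v -> u != v by apply: contraTneq => ->; rewrite edge_irr.
have ntr u v : T u v -> T v u = false by move=> uv; rewrite tourT 1?eq_sym ?ne // uv.
pose f w : 'I_3 := if w == x1 then inord 0 else if w == y1 then inord 1 else inord 2.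
have fx : f x1 = inord 0 by rewrite /f eqxx.
have fy : f y1 = inord 1 by rewrite /f eqxx eq_sym (negPf (ne _ _ xy1)).
have fz : f z1 = inord 2.
  by rewrite /f (negPf (ne _ _ zx1)) eq_sym (negPf (ne _ _ yz1)).
exists f.
  exists (fun i : 'I_3 => if i == 0%N :> nat then x1 else if i == 1%N :> nat then y1 else z1).
    by move=> w; case/or3P: (all3 w) => /eqP->; rewrite ?fx ?fy ?fz inordK.
  move=> i; apply: val_inj; by case: i => [[|[|[|]]]] //= _; rewrite ?fx ?fy ?fz inordK.
move=> u v; case/or3P: (all3 u) => /eqP->; case/or3P: (all3 v) => /eqP->;
  by rewrite ?fx ?fy ?fz /= /C3_edge !inordK // ?edge_irr ?xy1 ?yz1 ?zx1 ?(ntr _ _ xy1) ?(ntr _ _ yz1) ?(ntr _ _ zx1).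
Qed.

Lemma packing_of_tiled : (0 < #|W|)%N -> tiled (tile T G) (enum V) ->
  exists P : {set {ffun W -> V}}, perfect_packing T G P.
Proof.
move=> W0 [ps tps pV].
have [fs fsc fsp] : exists2 fs : seq {ffun W -> V}, forall f, f \in fs -> is_copy T G f &
    perm_eq (flatten (map (fun f : {ffun W -> V} => codom f) fs)) (flatten ps).
  elim: ps tps {pV} => [|s ps IH] /=; first by exists [::].
  move=> /andP[ts /IH[fs fsc fsp]].
  have [f fc fp] := tile_copy tourT (edge_irr T) (edge_irr G) ts.
  exists (f :: fs); first by move=> g; rewrite inE => /orP[/eqP->|/fsc].
  by rewrite /= perm_cat.
have pall := perm_trans fsp pV.
have mem_copy (f : {ffun W -> V}) v : (v \in copy_verts f) = (v \in codom f).
  by apply/imsetP/codomP => [[x _ ->]|[x ->]]; exists x.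
exists [set f in fs]; split; first split.
- by move=> f; rewrite inE; apply: fsc.
- move=> f g; rewrite !inE => ffs gfs fg.
  have gr : g \in rem f fs.
    by have := gfs; rewrite (perm_mem (perm_to_rem ffs)) inE eq_sym (negPf fg).
  have : uniq (flatten (map (fun f : {ffun W -> V} => codom f) fs)).
    by rewrite (perm_uniq pall) enum_uniq.
  rewrite (perm_uniq (perm_flatten (perm_map _ (perm_to_rem ffs)))) /= cat_uniq.
  move=> /and3P[_ /hasPn H _]; apply/pred0P => v /=; rewrite !mem_copy.
  apply/negP => /andP[vf vg]; have /H : v \in flatten (map (fun f : {ffun W -> V} => codom f) (rem f fs)).
    by apply/flatten_mapP; exists g.
  by rewrite vf.
apply/setP => v; rewrite inE; apply/bigcupP.
have : v \in flatten (map (fun f : {ffun W -> V} => codom f) fs).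
  by rewrite (perm_mem pall) mem_enum.
by case/flatten_mapP => f ffs vf; exists f; rewrite ?inE ?mem_copy.
Qed.

End Packing.

Theorem theorem10p1 (R : realType) (r : nat) (hr : (3 <= r)%N) :
  exists2 gamma0 : R, 0 < gamma0 &
  forall gamma : R, 0 < gamma -> gamma <= gamma0 ->
  exists2 eps0 : R, 0 < eps0 &
  forall eps : R, 0 < eps -> eps <= eps0 ->
  exists2 nu0 : R, 0 < nu0 &
  forall n : nat, 0 < n%:R^-1 :> R -> n%:R^-1 <= nu0 -> (r %| n)%N ->
  forall (W : finType) (T : digraph W),
    #|W| = r -> tournament T -> ~ digraph_iso T C3 ->
  forall (V : finType) (G : digraph V),
    #|V| = n ->
    (1 - r%:R^-1 - eps) * n%:R <= (min_semidegree G)%:R ->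
    ~ (exists2 S : {set V}, independent_upto G gamma S &
         n%:R / r%:R <= #|S|%:R :> R) ->
  exists P : {set {ffun W -> V}}, perfect_packing T G P.
Proof.
have r0 : (0 < r)%N by apply: leq_trans hr.
have rR : 0 < r%:R :> R by rewrite ltr0n.
exists 1 => // gamma g0 _.
(* [gamma / 4] is the size tolerance that [nonext_independent] provides. *)
have [nu nu0 [n0 Htile]] := perfect_tiling hr (divr_gt0 g0 (ltr0n R 4)) g0.
exists (nu / r%:R); first by rewrite divr_gt0.
move=> eps eps0 epsle; exists (Num.max 1 n0)^-1; first by rewrite invr_gt0 lt_max ltr01.
move=> n n_gt0 n_large rn W T cW tourT notC3 V G cV hdeg noind; subst n.
(* The inverse of 0 is 0, so positivity of the inverse excludes an empty V. *)
have V0 : 0 < #|V|%:R :> R by rewrite -invr_gt0.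
have n0V : n0 <= #|V|%:R.
  by move: n_large; rewrite lef_pV2 ?posrE ?lt_max ?ltr01 // ge_max => /andP[].
have [|l pl tl] := transitive_enum tourT _ notC3; first by rewrite cW.
apply: packing_of_tiled => //; first by rewrite cW.
apply: (Htile W V T G (#|V|%:R / r%:R) l) => //.
- exact: edge_irr.
- exact: edge_irr.
- by rewrite divr_gt0.
- by rewrite mulrC divfK // gt_eqF.
- have d := codeg_le_semidegree r0 hdeg; move=> v; have [d1 d2] := d v.
  have h : (1 + r%:R * eps) * (#|V|%:R / r%:R) <= (1 + nu) * (#|V|%:R / r%:R).
    rewrite ler_wpM2r ?divr_ge0 // lerD2l; move: epsle.
    by rewrite ler_pdivlMr // mulrC.
  by split; [apply: (le_trans d1)|apply: (le_trans d2)].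
- by apply: nonext_independent => //; apply: ltnW.
- by rewrite (perm_size pl) -cardE.
Qed.
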